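(* Let $\Sigma$ be a two-dimensional surface equipped with a $C^3$-smooth Riemannian metric. Let $\gamma\subset\Sigma$ be a germ of $C^3$-smooth curve with positive geodesic curvature $\kappa$ and string Poritsky property. Let $s$ be the natural length parameter of $\gamma$, and let $t$ be its Poritsky string length parameter. Then $t$ coincides with the Lazutkin parameter $$t_L=\int_{s_0}^s\kappa^{\frac23}(\zeta)\,d\zeta$$ up to additive and multiplicative constants. That is, up to a constant factor, $$\frac{dt}{ds}=\kappa^{\frac23}(s).$$
   Context: String Poritsky property: let $\gamma$ be a germ of oriented curve with non-zero geodesic curvature on a Riemannian surface. For $A,B\in\gamma$ close enough let $C_{AB}$ be the unique nearby intersection point of the geodesics tangent to $\gamma$ at $A$ and at $B$, $\lambda(A,B)$ the length of the arc $AB$ of $\gamma$, and $L(A,B)=|AC_{AB}|+|BC_{AB}|-\lambda(A,B)$, where $|XY|$ is the length of the small geodesic segment $XY$. The germ $\gamma$ has string Poritsky property if it admits a $C^1$-smooth parametrization by a parameter $t$ (a $C^1$-smooth local coordinate on $\gamma$, called Poritsky string length) such that for every $p>0$ small enough there exists $c_p>0$ such that for every pair $B,A\in\gamma$ ordered by orientation with $L(A,B)=p$ one has $t(A)-t(B)=c_p$. In the Lazutkin parameter, $\kappa(s)$ is the geodesic curvature of $\gamma$ as a function of $s$ and $s_0$ is a fixed value of the length parameter. *)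

(* Defs.v *)
From Stdlib Require Import Reals.
From Coquelicot Require Import Coquelicot.
Open Scope R_scope.

Definition d1 (f : R * R -> R) (z : R * R) : R :=
  Derive (fun x => f (x, snd z)) (fst z).
Definition d2 (f : R * R -> R) (z : R * R) : R :=
  Derive (fun y => f (fst z, y)) (snd z).

(* C^k smoothness on an open set [V] of R^2: all partial derivatives of order
   at most k exist, and those of order k (hence all of them) are continuous. *)
Fixpoint Ck2 (k : nat) (V : R * R -> Prop) (f : R * R -> R) : Prop :=
  match k with
  | O => forall z, V z -> continuous f z
  | S k' =>
      (forall z, V z -> ex_derive (fun x => f (x, snd z)) (fst z) /\
                        ex_derive (fun y => f (fst z, y)) (snd z)) /\
      Ck2 k' V (d1 f) /\ Ck2 k' V (d2 f)
  end.

Definition Ck_near (k : nat) (f : R -> R) (s : R) : Prop :=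
  locally s (fun x =>
    (forall j, (j <= k)%nat -> ex_derive_n f j x) /\
    continuous (Derive_n f k) x).

(* A two-dimensional manifold given by an atlas.  [param i] inverts [coord i]
   on the domain of the chart [i].  The atlas is of class C^4, which is what is
   needed for the notion of a C^3-smooth metric to be independent of the chart. *)
Record surface : Type := Surface {
  point :> Type;
  chart : Type;
  dom : chart -> point -> Prop;
  coord : chart -> point -> R * R;
  param : chart -> R * R -> point;
  (* coordinates, in the chart [i], of the points of the overlap of [i] and [j] *)
  overlap (i j : chart) (z : R * R) : Prop :=
    dom i (param i z) /\ coord i (param i z) = z /\ dom j (param i z);
  transition (i j : chart) (z : R * R) : R * R := coord j (param i z);
  dom_cover : forall P, exists i, dom i P;
  paramK : forall i P, dom i P -> param i (coord i P) = P;
  overlap_open : forall i j, open (overlap i j);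
  transition_smooth : forall i j,
    Ck2 4 (overlap i j) (fun z => fst (transition i j z)) /\
    Ck2 4 (overlap i j) (fun z => snd (transition i j z));
  surface_open (W : point -> Prop) : Prop :=
    forall i, open (fun z => overlap i i z /\ W (param i z));
  surface_Hausdorff : forall P Q, P <> Q ->
    exists W W', surface_open W /\ surface_open W' /\ W P /\ W' Q /\
      forall X, W X -> W' X -> False
}.

Arguments chart : clear implicits.
Arguments dom {s} _ _.
Arguments coord {s} _ _.
Arguments param {s} _ _.
Arguments overlap {s} _ _ _.
Arguments transition {s} _ _ _.

(* The first fundamental form  E dx^2 + 2 F dx dy + G dy^2  in a chart. *)
Definition qform (E F G : R) (v : R * R) : R :=
  E * fst v ^ 2 + 2 * F * fst v * snd v + G * snd v ^ 2.

Record C3_metric (S : surface) : Type := C3Metric {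
  mE : chart S -> R * R -> R;
  mF : chart S -> R * R -> R;
  mG : chart S -> R * R -> R;
  metric_C3 : forall i,
    Ck2 3 (overlap i i) (mE i) /\ Ck2 3 (overlap i i) (mF i) /\
    Ck2 3 (overlap i i) (mG i);
  metric_pos : forall i z, overlap i i z -> forall v, v <> (0, 0) ->
    0 < qform (mE i z) (mF i z) (mG i z) v;
  metric_compat : forall i j z, overlap i j z -> forall v,
    let w := transition i j z in
    let T1 := fun z' => fst (transition i j z') in
    let T2 := fun z' => snd (transition i j z') in
    qform (mE i z) (mF i z) (mG i z) v =
    qform (mE j w) (mF j w) (mG j w)
      (d1 T1 z * fst v + d2 T1 z * snd v, d1 T2 z * fst v + d2 T2 z * snd v)
}.

Arguments mE {S} _ _ _.
Arguments mF {S} _ _ _.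
Arguments mG {S} _ _ _.

(* Curves, their lengths, accelerations and so on are computed in a chart [i];
   everything that follows is meant for curves lying in the domain of [i]. *)

Definition cx {S : surface} (i : chart S) (q : R -> S) (s : R) : R :=
  fst (coord i (q s)).
Definition cy {S : surface} (i : chart S) (q : R -> S) (s : R) : R :=
  snd (coord i (q s)).

Definition velocity {S : surface} (i : chart S) (q : R -> S) (s : R) : R * R :=
  (Derive (cx i q) s, Derive (cy i q) s).

Definition gnorm {S : surface} (g : C3_metric S) (i : chart S) (P : S)
    (v : R * R) : R :=
  let z := coord i P in sqrt (qform (mE g i z) (mF g i z) (mG g i z) v).

Definition arc_length {S : surface} (g : C3_metric S) (i : chart S)
    (q : R -> S) (a b : R) : R :=
  RInt (fun s => gnorm g i (q s) (velocity i q s)) (Rmin a b) (Rmax a b).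

(* Christoffel terms: the vector (sum_{jk} Gamma^m_{jk} v^j v^k)_{m = 1, 2}.
   Here [l1], [l2] are the same sums with the symbols of the first kind, and the
   index is raised by the inverse matrix of the metric. *)
Definition christoffel {S : surface} (g : C3_metric S) (i : chart S)
    (z v : R * R) : R * R :=
  let E := mE g i in let F := mF g i in let G := mG g i in
  let a := fst v in let b := snd v in
  let l1 := d1 E z / 2 * a ^ 2 + d2 E z * a * b
            + (d2 F z - d1 G z / 2) * b ^ 2 in
  let l2 := (d1 F z - d2 E z / 2) * a ^ 2 + d1 G z * a * b
            + d2 G z / 2 * b ^ 2 in
  let D := E z * G z - F z ^ 2 in
  ((G z * l1 - F z * l2) / D, (E z * l2 - F z * l1) / D).

(* The covariant derivative of the velocity along the curve. *)
Definition cov_acceleration {S : surface} (g : C3_metric S) (i : chart S)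
    (q : R -> S) (s : R) : R * R :=
  let h := christoffel g i (coord i (q s)) (velocity i q s) in
  (Derive_n (cx i q) 2 s + fst h, Derive_n (cy i q) 2 s + snd h).

(* [q] is assumed to be parametrized by its natural length parameter. *)
Definition geodesic_curvature {S : surface} (g : C3_metric S) (i : chart S)
    (q : R -> S) (s : R) : R :=
  gnorm g i (q s) (cov_acceleration g i q s).

Definition geodesic {S : surface} (g : C3_metric S) (i : chart S)
    (q : R -> S) (a b : R) : Prop :=
  forall u, a < u < b ->
    dom i (q u) /\
    ex_derive_n (cx i q) 1 u /\ ex_derive_n (cx i q) 2 u /\
    ex_derive_n (cy i q) 1 u /\ ex_derive_n (cy i q) 2 u /\
    cov_acceleration g i q u = (0, 0).

(* The germ at [sb] of [c] is a C^3-smooth curve in the domain of [i],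
   parametrized by its natural length parameter. *)
Definition C3_natural_germ {S : surface} (g : C3_metric S) (i : chart S)
    (c : R -> S) (sb : R) : Prop :=
  Ck_near 3 (cx i c) sb /\ Ck_near 3 (cy i c) sb /\
  locally sb (fun s => dom i (c s) /\ gnorm g i (c s) (velocity i c s) = 1).

(* [C] lies on the geodesic tangent to [c] at [c s], at distance less than [r]
   from [c s] along it, and [l] is the length of the segment joining them. *)
Definition tangent_segment {S : surface} (g : C3_metric S) (i : chart S)
    (c : R -> S) (r s : R) (C : S) (l : R) : Prop :=
  exists (q : R -> S) (a b u : R),
    a < 0 < b /\ a < u < b /\ Rabs u < r /\
    geodesic g i q a b /\
    q 0 = c s /\ velocity i q 0 = velocity i c s /\
    q u = C /\ l = arc_length g i q 0 u.

(* L(A, B) = p for A = c sA, B = c sB.  The intersection point C of the tangent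
   geodesics is searched within distance [r] from A and B along them; it is
   unique when [r] is small and A, B are close. *)
Definition string_L {S : surface} (g : C3_metric S) (i : chart S)
    (c : R -> S) (r sA sB p : R) : Prop :=
  exists (C : S) (lA lB : R),
    tangent_segment g i c r sA C lA /\ tangent_segment g i c r sB C lB /\
    p = lA + lB - arc_length g i c sA sB.

(* [t], as a function of the natural parameter, is a C^1-smooth local
   coordinate on the germ. *)
Definition C1_coordinate (t : R -> R) (sb : R) : Prop :=
  Ck_near 1 t sb /\ locally sb (fun s => Derive t s <> 0).

(* The germ of [c] at [sb] has string Poritsky property, with Poritsky string
   length [t].  The curve is oriented by its natural parameter.  If the property
   holds for some [eps], [r], it holds for all smaller ones, so "nearby" and
   "close enough" may be read existentially. *)
Definition string_Poritsky {S : surface} (g : C3_metric S) (i : chart S)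
    (c : R -> S) (sb : R) (t : R -> R) : Prop :=
  C1_coordinate t sb /\
  exists eps r p0 : R, 0 < eps /\ 0 < r /\ 0 < p0 /\
    forall p, 0 < p < p0 -> exists cp, 0 < cp /\
      forall sB sA, Rabs (sB - sb) < eps -> Rabs (sA - sb) < eps -> sB < sA ->
        string_L g i c r sA sB p -> t sA - t sB = cp.

Definition kappa23 {S : surface} (g : C3_metric S) (i : chart S)
    (c : R -> S) (s : R) : R :=
  Rpower (geodesic_curvature g i c s) (2 / 3).

Definition Lazutkin {S : surface} (g : C3_metric S) (i : chart S)
    (c : R -> S) (s0 s : R) : R :=
  RInt (kappa23 g i c) s0 s.

(* Main.v *)
(* Write L(s, d) for the string function of the pair B = c(s), A = c(s + d).
   Taylor expansion of the geodesics tangent to the curve gives, for fixed s,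
   L(s, d) = kappa(s)^2 d^3 / 12 + o(d^3), and L(s, .) is continuous, hence takes
   all small positive values p.  If L(s, d) = p then t(s + d) - t(s) = c_p, so that
   c_p^3 / p tends to 12 t'(s)^3 / kappa(s)^2 as p -> 0.  The left-hand side does not
   depend on s, hence t' is a constant multiple of kappa^(2/3).

   The expansion: let H(d, v) be the point at time v of the geodesic starting at
   c(s + d) with velocity c'(s + d), T = c'(s), k the covariant acceleration of c at s.
   The geodesics meet where H(d, v) = H(0, u), and L = u - v - d.  The k-component of
   this equation gives v = - d / 2 + o(d); its T-component, to third order, then gives L.
   Besides the geodesic equation only <T, k> = 0 and its derivative
   <T, Dk> = - |k|^2 along c are used. *)
From Stdlib Require Import Reals Lra Lia Psatz IndefiniteDescription Ranalysis5.
From Coquelicot Require Import Coquelicot.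
Require Import Defs.
Open Scope R_scope.

(** * Flows of Lipschitz vector fields *)

(** The intersection problem degenerates as d tends to 0: the two geodesics become tangent, and the
    height of one over the other, measured by k, has slope only |k|^2 d. No implicit function
    theorem applies at d = 0. Instead u is eliminated by inverting the tangential coordinate on the
    geodesic of c(s), v is found by the intermediate value theorem on [- d, 0], and strict
    monotonicity of the height gives its continuity. Of the geodesic flow only existence and
    Lipschitz dependence on the initial state are established, so H(d, v) is never differentiated in
    d. Its expansion comes from integrating three times in v from v = 0, where the values are read
    off the C^3 curve. Components are taken with covectors frozen at c(s), so Christoffel terms
    enter the expansion. Those that depend on d + v alone have the same form on both geodesics; the
    others reduce to multiples of m = <T, B(T, k)>, with B the polarized Christoffel form, and
    cancel at v = - d / 2. What remains is |k|^2 d^3 (1/4 - 1/6) = |k|^2 d^3 / 12. *)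

Lemma minus_plus_plus {G : AbelianGroup} (x y x' y' : G) :
  minus (plus x y) (plus x' y') = plus (minus x x') (minus y y').
Proof.
unfold minus. rewrite opp_plus, <- !plus_assoc. f_equal.
rewrite !plus_assoc. f_equal. apply plus_comm.
Qed.

Lemma minus_plus_l {G : AbelianGroup} (x y : G) : minus (plus x y) x = y.
Proof.
unfold minus. rewrite (plus_comm x y), <- plus_assoc.
transitivity (plus y zero); [f_equal; apply plus_opp_r | apply plus_zero_r].
Qed.

Definition dist {V : NormedModule R_AbsRing} (x y : V) : R := norm (minus x y).

Lemma dist_ge_0 {V : NormedModule R_AbsRing} (x y : V) : 0 <= dist x y.
Proof. apply norm_ge_0. Qed.

Lemma dist_refl {V : NormedModule R_AbsRing} (x : V) : dist x x = 0.
Proof. unfold dist. rewrite minus_eq_zero. apply (@norm_zero R_AbsRing V). Qed.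

Lemma dist_eq_0 {V : NormedModule R_AbsRing} (x y : V) : dist x y = 0 -> x = y.
Proof.
intros H. apply (@norm_eq_zero R_AbsRing V) in H.
apply (plus_reg_r (opp y)). rewrite (plus_opp_r y). exact H.
Qed.

Lemma dist_sym {V : NormedModule R_AbsRing} (x y : V) : dist x y = dist y x.
Proof. unfold dist. now rewrite <- norm_opp, opp_minus. Qed.

Lemma dist_plus_plus {V : NormedModule R_AbsRing} (x y x' y' : V) :
  dist (plus x y) (plus x' y') <= dist x x' + dist y y'.
Proof.
exact (eq_ind_r (fun w => norm w <= _)
  (norm_triangle (minus x x') (minus y y')) (minus_plus_plus x y x' y')).
Qed.

Lemma dist_plus_l {V : NormedModule R_AbsRing} (x y : V) :
  dist (plus x y) x = norm y.
Proof. exact (f_equal norm (minus_plus_l (G := NormedModule.AbelianGroup _ V) x y)). Qed.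

Lemma dist_triangle {V : NormedModule R_AbsRing} (y x z : V) :
  dist x z <= dist x y + dist y z.
Proof. unfold dist. rewrite (minus_trans y x z). apply norm_triangle. Qed.

Lemma continuous_dist {U : UniformSpace} {V : NormedModule R_AbsRing} (f : U -> V) (x : U) :
  continuous f x <->
  forall eps : posreal, locally x (fun y => dist (f y) (f x) < eps).
Proof. apply (filterlim_locally_ball_norm f (f x)). Qed.

Lemma lipschitz_continuous {U V : NormedModule R_AbsRing} (f : U -> V) (K : R) :
  (forall x y, dist (f x) (f y) <= K * dist x y) ->
  forall x, continuous f x.
Proof.
intros Hf x. apply continuous_dist. intros eps.
assert (HK : 0 < Rmax K 1) by (generalize (Rmax_r K 1); lra).
assert (He : 0 < eps / Rmax K 1) by (apply Rdiv_lt_0_compat; [apply cond_pos | exact HK]).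
generalize (locally_ball_norm x (mkposreal _ He)).
apply filter_imp. intros y Hy. change (dist y x < eps / Rmax K 1) in Hy.
eapply Rle_lt_trans; [apply Hf |].
apply Rle_lt_trans with (Rmax K 1 * dist y x).
- apply Rmult_le_compat_r; [apply dist_ge_0 | apply Rmax_l].
- apply (Rmult_lt_compat_l _ _ _ HK) in Hy.
  replace (Rmax K 1 * (eps / Rmax K 1)) with (pos eps) in Hy by (field; lra).
  exact Hy.
Qed.

(** Carries inequalities between Picard iterates over to their limits: the defect at index n is a
    multiple of (1/2)^n. *)
Lemma le_of_geometric_defect (a b C : R) :
  (forall n, a <= b + C * (1 / 2) ^ n) -> a <= b.
Proof.
intros H.
assert (L : is_lim_seq (fun n => b + C * (1 / 2) ^ n) b).
{ replace (Finite b) with (Rbar_plus b (Rbar_mult C 0)) by (simpl; f_equal; ring).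
  apply is_lim_seq_plus' ; [apply is_lim_seq_const |].
  replace (C * 0) with (C * 0) by ring.
  apply (is_lim_seq_scal_l _ C 0). apply is_lim_seq_geom.
  rewrite Rabs_pos_eq; lra. }
exact (is_lim_seq_le _ _ (Finite a) (Finite b) H (is_lim_seq_const a) L).
Qed.

Lemma geometric_small (C eps : R) :
  0 <= C -> 0 < eps -> exists N, C * (1 / 2) ^ N < eps.
Proof.
intros HC He.
destruct (pow_lt_1_zero (1 / 2) ltac:(rewrite Rabs_pos_eq; lra) (eps / (C + 1)))
  as [N HN]; [apply Rdiv_lt_0_compat; lra |].
exists N. specialize (HN N (Nat.le_refl _)).
assert (P : 0 < (1 / 2) ^ N) by (apply pow_lt; lra).
rewrite Rabs_pos_eq in HN by lra.
apply (Rmult_lt_compat_r (C + 1)) in HN; [|lra].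
replace (eps / (C + 1) * (C + 1)) with eps in HN by (field; lra). lra.
Qed.

Definition clamp (a b x : R) : R := Rmax a (Rmin b x).

Lemma clamp_range (a b x : R) : a <= b -> a <= clamp a b x <= b.
Proof.
intros H; unfold clamp; split; [apply Rmax_l |].
apply Rmax_lub; [exact H | apply Rmin_l].
Qed.

Lemma clamp_id (a b x : R) : a <= x <= b -> clamp a b x = x.
Proof. intros H; unfold clamp. rewrite Rmin_right, Rmax_right; lra. Qed.

Lemma clamp_lip (a b x y : R) :
  Rabs (clamp a b x - clamp a b y) <= Rabs (x - y).
Proof.
unfold clamp, Rmax, Rmin.
repeat (destruct (Rle_dec _ _)); unfold Rabs; repeat (destruct (Rcase_abs _)); lra.
Qed.

Lemma clamp_continuous (a b x : R) : continuous (clamp a b) x.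
Proof.
apply (lipschitz_continuous (U := R_NormedModule) (clamp a b) 1); intros u v; rewrite Rmult_1_l.
exact (clamp_lip a b u v).
Qed.

Section Picard.

Context {V : CompleteNormedModule R_AbsRing}.
Variables (f : V -> V) (K h : R).
Hypothesis h_pos : 0 < h.
Hypothesis K_pos : 0 <= K.
Hypothesis hK : h * K <= 1 / 2.
Hypothesis f_lip : forall x y, dist (f x) (f y) <= K * dist x y.

(* Time is clamped so that the iterates are defined and continuous on the whole line. *)
Definition picard_step (z : V) (y : R -> V) (t : R) : V :=
  plus z (RInt (fun u => f (y u)) 0 (clamp (- h) h t)).

Lemma integrand_continuous (y : R -> V) :
  (forall t, continuous y t) -> forall t, continuous (fun u => f (y u)) t.
Proof.
intros Hy t. apply (continuous_comp y f); [apply Hy |].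
exact (lipschitz_continuous f K f_lip (y t)).
Qed.

Lemma integrand_is_RInt (y : R -> V) :
  (forall t, continuous y t) ->
  forall a b, is_RInt (fun u => f (y u)) a b (RInt (fun u => f (y u)) a b).
Proof.
intros Hy a b. apply (@RInt_correct V), (@ex_RInt_continuous V).
intros; now apply integrand_continuous.
Qed.

Lemma picard_step_continuous (z : V) (y : R -> V) :
  (forall t, continuous y t) -> forall t, continuous (picard_step z y) t.
Proof.
intros Hy t. unfold picard_step.
apply (continuous_plus (V := V) (fun _ => z)); [apply continuous_const |].
apply (continuous_comp (clamp (- h) h) (RInt (fun u => f (y u)) 0)).
- apply clamp_continuous.
- apply (continuous_RInt_1 (fun u => f (y u)) 0).
  apply filter_forall. intros u. now apply integrand_is_RInt.
Qed.

(** Since h K <= 1/2, the integral contributes at most half of the uniform distance. The same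
    inequality gives convergence, with z = z', and dependence on the initial value: the bound C = 2
    [dist z z'] reproduces itself. *)
Lemma picard_step_lip (z z' : V) (y y' : R -> V) (C : R) :
  (forall t, continuous y t) -> (forall t, continuous y' t) ->
  (forall t, dist (y t) (y' t) <= C) ->
  forall t, dist (picard_step z y t) (picard_step z' y' t) <=
    dist z z' + C / 2.
Proof.
intros Hy Hy' HC t. unfold picard_step.
set (I := RInt (fun u => f (y u)) 0 _). set (I' := RInt (fun u => f (y' u)) 0 _).
eapply Rle_trans; [exact (dist_plus_plus z I z' I') |].
apply Rplus_le_compat_l.
assert (HC0 : 0 <= C) by exact (Rle_trans _ _ _ (dist_ge_0 _ _) (HC 0)).
assert (D : dist I I' <= Rabs (clamp (- h) h t - 0) * (K * C)).
{ apply (norm_RInt_le_const_abs (fun u => minus (f (y u)) (f (y' u)))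
           0 (clamp (- h) h t)).
  - intros x _. eapply Rle_trans; [apply f_lip |].
    now apply Rmult_le_compat_l.
  - apply (is_RInt_minus (V := V)); now apply integrand_is_RInt. }
eapply Rle_trans; [exact D |].
assert (Hc := clamp_range (- h) h t ltac:(lra)).
apply Rle_trans with (h * (K * C)).
- apply Rmult_le_compat_r; [now apply Rmult_le_pos |].
  rewrite Rminus_0_r. apply Rabs_le; lra.
- rewrite <- Rmult_assoc. replace (C / 2) with (1 / 2 * C) by field.
  now apply Rmult_le_compat_r.
Qed.

Fixpoint picard_iter (z : V) (n : nat) : R -> V :=
  match n with
  | O => fun _ => z
  | S m => picard_step z (picard_iter z m)
  end.

Lemma picard_iter_continuous (z : V) (n : nat) :
  forall t, continuous (picard_iter z n) t.
Proof.
induction n as [|n IH]; simpl.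
- intros t; apply continuous_const.
- now apply picard_step_continuous.
Qed.

Lemma picard_iter_step (z : V) (n : nat) (t : R) :
  dist (picard_iter z n t) (picard_iter z (S n) t) <=
  h * norm (f z) * (1 / 2) ^ n.
Proof.
revert t. induction n as [|n IH]; intros t.
- change (dist z (picard_step z (fun _ => z) t) <= h * norm (f z) * 1).
  rewrite Rmult_1_r, dist_sym. unfold picard_step.
  set (I := RInt _ _ _).
  eapply Rle_trans; [right; exact (dist_plus_l z I) |].
  assert (D : norm I <= Rabs (clamp (- h) h t - 0) * norm (f z)).
  { apply (norm_RInt_le_const_abs (fun _ => f z) 0 (clamp (- h) h t)).
    - intros; apply Rle_refl.
    - apply (integrand_is_RInt (fun _ => z)). intros; apply continuous_const. }
  eapply Rle_trans; [exact D |].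
  apply Rmult_le_compat_r; [apply norm_ge_0 |].
  assert (Hc := clamp_range (- h) h t ltac:(lra)).
  rewrite Rminus_0_r. apply Rabs_le; lra.
- change (picard_iter z (S (S n))) with (picard_step z (picard_iter z (S n))).
  change (picard_iter z (S n)) with (picard_step z (picard_iter z n)) at 1.
  eapply Rle_trans.
  + apply picard_step_lip; [apply picard_iter_continuous .. | exact IH].
  + rewrite dist_refl. simpl. lra.
Qed.

Lemma picard_iter_cauchy (z : V) (n m : nat) (t : R) :
  dist (picard_iter z n t) (picard_iter z (n + m) t) <=
  2 * (h * norm (f z)) * (1 / 2) ^ n.
Proof.
set (C := h * norm (f z)).
assert (HC : 0 <= C) by (apply Rmult_le_pos; [lra | apply norm_ge_0]).
apply Rle_trans with (2 * C * (1 / 2) ^ n - 2 * C * (1 / 2) ^ (n + m)).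
- induction m as [|m IH].
  + rewrite Nat.add_0_r, dist_refl. lra.
  + eapply Rle_trans; [apply (dist_triangle (picard_iter z (n + m) t)) |].
    rewrite Nat.add_succ_r.
    generalize (picard_iter_step z (n + m) t); fold C; intros H.
    simpl pow. lra.
- assert (0 < (1 / 2) ^ (n + m)) by (apply pow_lt; lra). nra.
Qed.

(** The rate is kept together with the limit because it is uniform in t; continuity of the limit and
    the fixed point equation both rest on it. *)
Lemma picard_limit (z : V) (t : R) :
  exists y : V, forall n,
    dist (picard_iter z n t) y <= 2 * (h * norm (f z)) * (1 / 2) ^ n.
Proof.
set (C := 2 * (h * norm (f z))).
assert (HC : 0 <= C).
{ unfold C. assert (H := norm_ge_0 (f z)). nra. }
destruct (proj1 (filterlim_locally_cauchy (F := eventually)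
  (fun n => picard_iter z n t))) as [y Hy].
- intros eps.
  destruct (geometric_small (2 * C) eps ltac:(lra) (cond_pos eps)) as [N HN].
  exists (fun n => (N <= n)%nat). split; [now exists N |].
  intros u v Hu Hv. apply (norm_compat1 (V := V)).
  eapply Rle_lt_trans; [apply (dist_triangle (picard_iter z N t)) |].
  rewrite (dist_sym _ (picard_iter z N t)).
  replace u with (N + (u - N))%nat by lia.
  replace v with (N + (v - N))%nat by lia.
  generalize (picard_iter_cauchy z N (u - N) t) (picard_iter_cauchy z N (v - N) t).
  fold C. intros A B. lra.
- exists y. intros n. apply le_epsilon. intros eps Heps.
  destruct (proj1 (filterlim_locally_ball_norm _ y) Hy (mkposreal _ Heps))
    as [N HN].
  specialize (HN (n + N)%nat ltac:(lia)).
  change (dist (picard_iter z (n + N) t) y < eps) in HN.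
  assert (A := picard_iter_cauchy z n N t).
  assert (T := dist_triangle (picard_iter z (n + N) t) (picard_iter z n t) y).
  fold C in A. lra.
Qed.

Theorem lipschitz_flow :
  exists phi : V -> R -> V,
    (forall z, phi z 0 = z) /\
    (forall z t, - h < t < h -> is_derive (phi z) t (f (phi z t))) /\
    (forall z z' t, dist (phi z t) (phi z' t) <= 2 * dist z z').
Proof.
destruct (functional_choice (fun (p : V * R) (y : V) => forall n,
  dist (picard_iter (fst p) n (snd p)) y <=
  2 * (h * norm (f (fst p))) * (1 / 2) ^ n)
  (fun p => picard_limit (fst p) (snd p))) as [F HF].
set (phi := fun z t => F (z, t)).
assert (Hphi : forall z t n, dist (picard_iter z n t) (phi z t) <=
  2 * (h * norm (f z)) * (1 / 2) ^ n) by (intros z t; exact (HF (z, t))).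
clearbody phi. clear F HF.
assert (Hcont : forall z t, continuous (phi z) t).
{ intros z t. apply (proj2 (continuous_dist (phi z) t)). intros eps.
  set (C := 2 * (h * norm (f z))).
  assert (HC : 0 <= C) by (unfold C; assert (H := norm_ge_0 (f z)); nra).
  destruct (geometric_small (4 * C) eps ltac:(lra) (cond_pos eps)) as [N HN].
  generalize (proj1 (continuous_dist _ t) (picard_iter_continuous z N t)
    (pos_div_2 eps)).
  apply filter_imp. simpl. intros u Hu.
  eapply Rle_lt_trans; [apply (dist_triangle (picard_iter z N u)) |].
  assert (T := dist_triangle (picard_iter z N t) (picard_iter z N u) (phi z t)).
  rewrite (dist_sym (phi z u)).
  assert (A := Hphi z u N). assert (B := Hphi z t N). fold C in A, B. lra. }
(* Both sides are within a multiple of (1/2)^n of the iterate of index n + 1. *)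
assert (Hfix : forall z t, phi z t = picard_step z (phi z) t).
{ intros z t.
  assert (E : dist (phi z t) (picard_step z (phi z) t) = 0).
  { apply Rle_antisym; [| apply dist_ge_0].
    apply (le_of_geometric_defect _ _ (2 * (h * norm (f z)))).
    intros n.
    eapply Rle_trans; [apply (dist_triangle (picard_iter z (S n) t)) |].
    rewrite (dist_sym (phi z t)).
    assert (A := Hphi z t (S n)).
    assert (B := picard_step_lip z z (picard_iter z n) (phi z) _
      (picard_iter_continuous z n) (Hcont z) (fun u => Hphi z u n) t).
    rewrite dist_refl in B.
    change (picard_step z (picard_iter z n)) with (picard_iter z (S n)) in B.
    replace ((1 / 2) ^ S n) with (1 / 2 * (1 / 2) ^ n) in A by reflexivity.
    lra. }
  now apply dist_eq_0. }
exists phi. split; [|split].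
- intros z. rewrite Hfix. unfold picard_step.
  rewrite clamp_id by lra. rewrite RInt_point. apply plus_zero_r.
- intros z t Ht.
  apply (is_derive_ext_loc (fun u => plus z (RInt (fun v => f (phi z v)) 0 u))).
  + assert (Hl : locally t (fun u => - h < u < h)).
    { apply (open_and _ _ (open_gt (- h)) (open_lt h)). exact Ht. }
    generalize Hl. apply filter_imp. intros u Hu.
    rewrite (Hfix z u). unfold picard_step. rewrite clamp_id by lra. reflexivity.
  + replace (f (phi z t)) with (plus zero (f (phi z t))) by apply plus_zero_l.
    apply (is_derive_plus (V := V) (fun _ => z)).
    * apply (is_derive_const (V := V) z t).
    * apply (is_derive_RInt (fun v => f (phi z v)) _ 0).
      -- apply filter_forall. intros u. now apply integrand_is_RInt.
      -- now apply integrand_continuous.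
- intros z z' t.
  assert (I : forall n u, dist (picard_iter z n u) (picard_iter z' n u) <=
    2 * dist z z').
  { induction n as [|n IH]; intros u.
    - simpl. assert (H := dist_ge_0 z z'). lra.
    - eapply Rle_trans.
      + apply picard_step_lip; [apply picard_iter_continuous .. | exact IH].
      + lra. }
  apply (le_of_geometric_defect _ _ (2 * (h * norm (f z)) + 2 * (h * norm (f z')))).
  intros n.
  eapply Rle_trans; [apply (dist_triangle (picard_iter z n t)) |].
  assert (T := dist_triangle (picard_iter z' n t) (picard_iter z n t) (phi z' t)).
  rewrite (dist_sym (phi z t)).
  assert (A := Hphi z t n). assert (B := Hphi z' t n). specialize (I n t).
  lra.
Qed.

End Picard.

(** * Orders of smallness *)

Section Orders.

Context {T : Type} (F : (T -> Prop) -> Prop) {FF : Filter F} (rho : T -> R).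
Hypothesis rho_ge_0 : forall x, 0 <= rho x.
Hypothesis rho_lim : forall eps, 0 < eps -> F (fun x => rho x < eps).

(** [small] and [big] are o(rho^n) and O(rho^n). Filter and gauge stay abstract because three
    instances are used: the origin of the plane, 0 on the line, and 0 from the right. *)
Definition small (n : nat) (e : T -> R) : Prop :=
  forall eps, 0 < eps -> F (fun x => Rabs (e x) <= eps * rho x ^ n).
Definition big (n : nat) (e : T -> R) : Prop :=
  exists C, 0 <= C /\ F (fun x => Rabs (e x) <= C * rho x ^ n).

Lemma small_ext (n : nat) (e f : T -> R) :
  F (fun x => e x = f x) -> small n e -> small n f.
Proof.
intros E H eps He. generalize (filter_and _ _ E (H eps He)).
apply filter_imp. intros x [-> A]. exact A.
Qed.

Lemma big_ext (n : nat) (e f : T -> R) :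
  F (fun x => e x = f x) -> big n e -> big n f.
Proof.
intros E [C [HC H]]. exists C; split; [exact HC |].
generalize (filter_and _ _ E H). apply filter_imp. intros x [-> A]. exact A.
Qed.

Lemma small_big (n : nat) (e : T -> R) : small n e -> big n e.
Proof. intros H. exists 1; split; [lra | exact (H 1 Rlt_0_1)]. Qed.

Lemma small_plus (n : nat) (e f : T -> R) :
  small n e -> small n f -> small n (fun x => e x + f x).
Proof.
intros He Hf eps Heps.
assert (Heps' : 0 < eps / 2) by lra.
generalize (filter_and _ _ (He _ Heps') (Hf _ Heps')).
apply filter_imp. intros x [A B].
eapply Rle_trans; [apply Rabs_triang |]. lra.
Qed.

Lemma big_plus (n : nat) (e f : T -> R) :
  big n e -> big n f -> big n (fun x => e x + f x).
Proof.
intros [C [HC A]] [D [HD B]]. exists (C + D); split; [lra |].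
generalize (filter_and _ _ A B). apply filter_imp. intros x [A' B'].
eapply Rle_trans; [apply Rabs_triang |]. lra.
Qed.

Lemma big_const (c : R) : big 0 (fun _ => c).
Proof.
exists (Rabs c); split; [apply Rabs_pos |].
apply filter_forall. intros x. simpl. lra.
Qed.

Lemma big_mult (n m : nat) (e f : T -> R) :
  big n e -> big m f -> big (n + m) (fun x => e x * f x).
Proof.
intros [C [HC A]] [D [HD B]]. exists (C * D); split; [now apply Rmult_le_pos |].
generalize (filter_and _ _ A B). apply filter_imp. intros x [A' B'].
rewrite Rabs_mult, pow_add.
replace (C * D * (rho x ^ n * rho x ^ m)) with ((C * rho x ^ n) * (D * rho x ^ m)) by ring.
apply Rmult_le_compat; try apply Rabs_pos; assumption.
Qed.

Lemma small_mult_big (n m : nat) (e f : T -> R) :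
  small n e -> big m f -> small (n + m) (fun x => e x * f x).
Proof.
intros A [D [HD B]] eps He.
assert (He' : 0 < eps / (D + 1)) by (apply Rdiv_lt_0_compat; lra).
generalize (filter_and _ _ (A _ He') B). apply filter_imp. intros x [A' B'].
rewrite Rabs_mult, pow_add.
assert (P : 0 <= rho x ^ n) by now apply pow_le.
assert (Q : 0 <= rho x ^ m) by now apply pow_le.
apply Rle_trans with ((eps / (D + 1) * rho x ^ n) * (D * rho x ^ m)).
- apply Rmult_le_compat; try apply Rabs_pos; assumption.
- replace (eps / (D + 1) * rho x ^ n * (D * rho x ^ m)) with
    (eps * (rho x ^ n * rho x ^ m) * (D / (D + 1))) by (field; lra).
  rewrite <- (Rmult_1_r (eps * (rho x ^ n * rho x ^ m))) at 2.
  apply Rmult_le_compat_l.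
  + apply Rmult_le_pos; [lra | now apply Rmult_le_pos].
  + apply Rmult_le_reg_r with (D + 1); [lra |].
    replace (D / (D + 1) * (D + 1)) with D by (field; lra). lra.
Qed.

Lemma big_mult_small (n m : nat) (e f : T -> R) :
  big n e -> small m f -> small (n + m) (fun x => e x * f x).
Proof.
intros A B. rewrite Nat.add_comm.
apply (small_ext _ (fun x => f x * e x)).
- apply filter_forall. intros; ring.
- now apply small_mult_big.
Qed.

Lemma small_scal (n : nat) (c : R) (e : T -> R) :
  small n e -> small n (fun x => c * e x).
Proof. intros H. apply (big_mult_small 0 n); [apply big_const | exact H]. Qed.

Lemma big_scal (n : nat) (c : R) (e : T -> R) :
  big n e -> big n (fun x => c * e x).
Proof. intros H. apply (big_mult 0 n); [apply big_const | exact H]. Qed.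

Lemma small_opp (n : nat) (e : T -> R) : small n e -> small n (fun x => - e x).
Proof.
intros H eps He. generalize (H eps He). apply filter_imp.
intros x. now rewrite Rabs_Ropp.
Qed.

Lemma small_minus (n : nat) (e f : T -> R) :
  small n e -> small n f -> small n (fun x => e x - f x).
Proof. intros A B. apply small_plus; [exact A | now apply small_opp]. Qed.

Lemma big_small (n m : nat) (e : T -> R) : (n < m)%nat -> big m e -> small n e.
Proof.
intros Hnm [C [HC H]] eps Heps.
assert (He : 0 < Rmin 1 (eps / (C + 1))).
{ apply Rmin_glb_lt; [lra |]. apply Rdiv_lt_0_compat; lra. }
generalize (filter_and _ _ H (rho_lim _ He)). apply filter_imp.
intros x [A B]. eapply Rle_trans; [exact A |].
replace m with (n + S (m - n - 1))%nat by lia.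
rewrite pow_add. simpl.
assert (R1 : rho x < 1) by (eapply Rlt_le_trans; [exact B | apply Rmin_l]).
assert (R2 : rho x < eps / (C + 1)) by (eapply Rlt_le_trans; [exact B | apply Rmin_r]).
assert (R0 := rho_ge_0 x).
assert (P : 0 <= rho x ^ (m - n - 1) <= 1).
{ split; [now apply pow_le |].
  rewrite <- (pow1 (m - n - 1)). apply pow_incr. lra. }
assert (Q : 0 <= rho x ^ n) by now apply pow_le.
apply Rmult_lt_compat_r with (r := C + 1) in R2; [|lra].
replace (eps / (C + 1) * (C + 1)) with eps in R2 by (field; lra).
replace (C * (rho x ^ n * (rho x * rho x ^ (m - n - 1)))) with
  ((C * rho x * rho x ^ (m - n - 1)) * rho x ^ n) by ring.
apply Rmult_le_compat_r; [exact Q |].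
assert (0 <= C * rho x) by now apply Rmult_le_pos.
nra.
Qed.

Lemma small_weaken (n m : nat) (e : T -> R) : (n <= m)%nat -> small m e -> small n e.
Proof.
intros Hnm H. destruct (Nat.eq_dec n m) as [-> | Hne]; [exact H |].
apply (big_small n m); [lia | now apply small_big].
Qed.

Lemma big_weaken (n m : nat) (e : T -> R) : (n <= m)%nat -> big m e -> big n e.
Proof.
intros Hnm H. destruct (Nat.eq_dec n m) as [-> | Hne]; [exact H |].
apply small_big, (big_small n m); [lia | exact H].
Qed.

End Orders.

(** * Orders of smallness in the plane and to the right of 0 *)

Definition planar_gauge (p : R * R) : R := Rabs (fst p) + Rabs (snd p).
Definition small2 : nat -> (R * R -> R) -> Prop := small (locally (0, 0)) planar_gauge.
Definition big2 : nat -> (R * R -> R) -> Prop := big (locally (0, 0)) planar_gauge.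
Definition small1 : nat -> (R -> R) -> Prop := small (at_right 0) Rabs.
Definition big1 : nat -> (R -> R) -> Prop := big (at_right 0) Rabs.

Lemma planar_gauge_ge_0 (p : R * R) : 0 <= planar_gauge p.
Proof. unfold planar_gauge. generalize (Rabs_pos (fst p)) (Rabs_pos (snd p)); lra. Qed.

Lemma locally_planar (P : R * R -> Prop) :
  locally (0, 0) P <->
  exists r, 0 < r /\ forall d v, Rabs d < r -> Rabs v < r -> P (d, v).
Proof.
split.
- intros [r Hr]. exists r; split; [apply cond_pos |].
  intros d v Hd Hv. apply Hr. split; unfold ball; simpl;
  unfold AbsRing_ball, abs, minus, plus, opp; simpl; now rewrite Ropp_0, Rplus_0_r.
- intros [r [Hr H]]. exists (mkposreal r Hr). intros [d v] [Hd Hv].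
  unfold ball in Hd, Hv; simpl in Hd, Hv.
  unfold AbsRing_ball, abs, minus, plus, opp in Hd, Hv; simpl in Hd, Hv.
  rewrite Ropp_0, Rplus_0_r in Hd, Hv. now apply H.
Qed.

Lemma planar_gauge_lim (eps : R) :
  0 < eps -> locally (0, 0) (fun p => planar_gauge p < eps).
Proof.
intros He. apply locally_planar. exists (eps / 2); split; [lra |].
intros d v Hd Hv. unfold planar_gauge; simpl; lra.
Qed.

Lemma at_right_0 (P : R -> Prop) :
  at_right 0 P <-> exists r, 0 < r /\ forall d, 0 < d < r -> P d.
Proof.
split.
- intros [r Hr]. exists r; split; [apply cond_pos |].
  intros d [Hd Hd']. apply Hr; [|exact Hd].
  unfold ball; simpl. unfold AbsRing_ball, abs, minus, plus, opp; simpl.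
  rewrite Ropp_0, Rplus_0_r, Rabs_pos_eq; lra.
- intros [r [Hr H]]. exists (mkposreal r Hr). intros d Hd Hd'.
  unfold ball in Hd; simpl in Hd.
  unfold AbsRing_ball, abs, minus, plus, opp in Hd; simpl in Hd.
  rewrite Ropp_0, Rplus_0_r in Hd. apply H. split; [exact Hd' |].
  rewrite Rabs_pos_eq in Hd; lra.
Qed.

Lemma Rabs_at_right_lim (eps : R) : 0 < eps -> at_right 0 (fun d => Rabs d < eps).
Proof.
intros He. apply at_right_0. exists eps; split; [exact He |].
intros d Hd. rewrite Rabs_pos_eq; lra.
Qed.

Lemma big2_fst : big2 1 fst.
Proof.
exists 1; split; [lra |]. apply filter_forall. intros [d v].
unfold planar_gauge; simpl. generalize (Rabs_pos v); lra.
Qed.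

Lemma big2_snd : big2 1 snd.
Proof.
exists 1; split; [lra |]. apply filter_forall. intros [d v].
unfold planar_gauge; simpl. generalize (Rabs_pos d); lra.
Qed.

(** Reads the order of a polynomial off its syntax. A product of required order n >= 2 is split as
    order 1 times order n - 1, and a product of required order 1 as order 0 times order 1. This
    dictates the nested shape in which the polynomials below are written. *)
Ltac big_poly :=
  unfold big1, big2 in *;
  repeat lazymatch goal with
    | |- big ?F ?rho ?n (Rmult ?c) => change (big F rho n (fun p => c * p))
    | |- big ?F ?rho _ (fun p => _ + _) => apply (big_plus F rho)
    | |- big ?F ?rho (S (S ?n)) (fun p => _ * _) => apply (big_mult F rho 1 (S n))
    | |- big ?F ?rho 1 (fun p => _ * _) => apply (big_mult F rho 0 1)
    | |- big ?F ?rho 0 (fun p => _ * _) => apply (big_mult F rho 0 0)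
    | |- big ?F ?rho 0 (fun _ => ?c) => apply (big_const F rho)
    | |- big ?F ?rho 0 _ =>
      eapply (big_weaken F rho) with (m := 1%nat);
      [ first [exact planar_gauge_ge_0 | exact Rabs_pos]
      | first [exact planar_gauge_lim | exact Rabs_at_right_lim]
      | lia
      | ]
    | |- _ => assumption
    end.

Lemma small2_comp (n : nat) (e : R * R -> R) (f g : R -> R) :
  small2 n e -> big1 1 f -> big1 1 g -> small1 n (fun d => e (f d, g d)).
Proof.
intros He [C [HC Hf]] [D [HD Hg]] eps Heps.
assert (P : 0 < (C + D + 1) ^ n) by (apply pow_lt; lra).
destruct (proj1 (locally_planar _) (He (eps / (C + D + 1) ^ n)
  (Rdiv_lt_0_compat _ _ Heps P))) as [r [Hr H]].
assert (Hr' : 0 < r / (C + D + 1)) by (apply Rdiv_lt_0_compat; lra).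
generalize (filter_and _ _ (Rabs_at_right_lim _ Hr') (filter_and _ _ Hf Hg)).
apply filter_imp. intros d [A [B B']]. rewrite pow_1 in B, B'.
apply Rmult_lt_compat_r with (r := C + D + 1) in A; [|lra].
replace (r / (C + D + 1) * (C + D + 1)) with r in A by (field; lra).
assert (Q := Rabs_pos d).
eapply Rle_trans; [apply H; nra |].
unfold planar_gauge; simpl.
apply Rle_trans with (eps / (C + D + 1) ^ n * ((C + D + 1) * Rabs d) ^ n).
- apply Rmult_le_compat_l.
  + apply Rlt_le, Rdiv_lt_0_compat; lra.
  + apply pow_incr. split; [generalize (Rabs_pos (f d)) (Rabs_pos (g d)); lra | nra].
- rewrite Rpow_mult_distr. right. field. lra.
Qed.

Lemma big1_id : big1 1 (fun d => d).
Proof.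
exists 1; split; [lra |]. apply filter_forall. intros d. rewrite pow_1; lra.
Qed.

Lemma small1_div (n : nat) (e : R -> R) :
  small1 (S n) (fun d => d * e d) -> small1 n e.
Proof.
intros H eps He.
assert (A : at_right 0 (fun d => 0 < d))
  by (apply at_right_0; exists 1; split; [lra | intros; lra]).
generalize (filter_and _ _ A (H eps He)). apply filter_imp.
intros d [Hd B]. rewrite Rabs_mult in B. simpl in B.
assert (P : 0 < Rabs d) by (apply Rabs_pos_lt; lra).
apply Rmult_le_reg_l with (Rabs d); [exact P |]. lra.
Qed.

(** * Mean value estimates and a local inverse *)

Lemma derive_bounds (g g1 : R -> R) (r lo hi : R) :
  (forall x, Rabs x < r -> is_derive g x (g1 x) /\ lo <= g1 x <= hi) ->
  forall x y, Rabs x < r -> Rabs y < r -> y <= x ->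
    lo * (x - y) <= g x - g y <= hi * (x - y).
Proof.
intros H x y Hx Hy Hyx.
assert (I : forall c, y <= c <= x -> Rabs c < r).
{ intros c Hc. apply Rabs_def2 in Hx, Hy. apply Rabs_def1; lra. }
destruct (MVT_gen g y x g1) as [c [Hc E]].
- rewrite Rmin_left, Rmax_right by lra. intros c Hc. apply H, I; lra.
- rewrite Rmin_left, Rmax_right by lra. intros c Hc.
  apply continuity_pt_filterlim.
  apply (ex_derive_continuous g). exists (g1 c). apply H, I; lra.
- rewrite Rmin_left, Rmax_right in Hc by lra.
  rewrite E. destruct (H c (I c Hc)) as [_ B]. split; apply Rmult_le_compat_r; lra.
Qed.

Lemma derive_lip (g g1 : R -> R) (r M : R) :
  (forall x, Rabs x < r -> is_derive g x (g1 x) /\ Rabs (g1 x) <= M) ->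
  forall x y, Rabs x < r -> Rabs y < r -> Rabs (g x - g y) <= M * Rabs (x - y).
Proof.
intros H x y Hx Hy.
assert (B : forall x, Rabs x < r -> is_derive g x (g1 x) /\ - M <= g1 x <= M).
{ intros c Hc. destruct (H c Hc) as [A A']. split; [exact A | now apply Rabs_le_between]. }
destruct (Rle_dec y x) as [L | L].
- assert (C := derive_bounds g g1 r _ _ B x y Hx Hy L).
  rewrite (Rabs_pos_eq (x - y)) by lra. apply Rabs_le. lra.
- assert (C := derive_bounds g g1 r _ _ B y x Hy Hx ltac:(lra)).
  rewrite (Rabs_minus_sym x y), (Rabs_minus_sym (g x)).
  rewrite (Rabs_pos_eq (y - x)) by lra. apply Rabs_le. lra.
Qed.

(** A slope of at least 1/2 gives the inverse Lipschitz bound and makes g(r / 2) >= r / 4 and g(- r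
    / 2) <= - r / 4, so every |y| < r / 4 is attained. *)
Lemma local_inverse (g g1 : R -> R) (r : R) :
  0 < r -> g 0 = 0 ->
  (forall x, Rabs x < r -> is_derive g x (g1 x) /\ 1 / 2 <= g1 x <= 3 / 2) ->
  (forall x y, Rabs x < r -> Rabs y < r -> Rabs (x - y) <= 2 * Rabs (g x - g y)) /\
  exists U : R -> R, forall y, Rabs y < r / 4 ->
    Rabs (U y) <= 2 * Rabs y /\ g (U y) = y.
Proof.
intros Hr Hg0 H.
assert (L : forall x y, Rabs x < r -> Rabs y < r ->
  Rabs (x - y) <= 2 * Rabs (g x - g y)).
{ intros x y Hx Hy. destruct (Rle_dec y x) as [A | A].
  - assert (B := derive_bounds g g1 r _ _ H x y Hx Hy A).
    rewrite !Rabs_pos_eq; lra.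
  - assert (B := derive_bounds g g1 r _ _ H y x Hy Hx ltac:(lra)).
    rewrite (Rabs_minus_sym x), (Rabs_minus_sym (g x)), !Rabs_pos_eq; lra. }
split; [exact L |].
destruct (functional_choice (fun y u => Rabs y < r / 4 ->
  Rabs u <= 2 * Rabs y /\ g u = y)) as [U HU]; [| now exists U].
intros y. destruct (Rlt_dec (Rabs y) (r / 4)) as [Hy | Hy].
2:{ exists 0; intros; contradiction. }
assert (Hy' := Rabs_def2 _ _ Hy).
assert (B1 : Rabs (r / 2) < r) by (rewrite Rabs_pos_eq; lra).
assert (B2 : Rabs (- (r / 2)) < r) by (rewrite Rabs_Ropp; exact B1).
assert (B0 : Rabs 0 < r) by (rewrite Rabs_R0; exact Hr).
assert (C1 := derive_bounds g g1 r _ _ H (r / 2) 0 B1 B0 ltac:(lra)).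
assert (C2 := derive_bounds g g1 r _ _ H 0 (- (r / 2)) B0 B2 ltac:(lra)).
destruct (IVT_interv (fun x => g x - y) (- (r / 2)) (r / 2)) as [u [Hu E]].
- intros x Hx. apply continuity_pt_minus.
  + apply continuity_pt_filterlim. apply (ex_derive_continuous g).
    exists (g1 x). apply H. apply Rabs_def1; lra.
  + apply continuity_pt_const. now intros ? ?.
- lra.
- lra.
- lra.
- exists u. intros _. assert (Eu : g u = y) by lra. split; [| exact Eu].
  assert (D := L u 0 ltac:(apply Rabs_def1; lra) B0).
  rewrite Hg0, Eu, !Rminus_0_r in D. exact D.
Qed.

(** * The intersection of two nearby curves *)

Lemma continuous_eps (f : R -> R) (x : R) :
  continuous f x <->
  forall eps, 0 < eps -> exists r, 0 < r /\
    forall y, Rabs (y - x) < r -> Rabs (f y - f x) < eps.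
Proof.
split.
- intros H eps He.
  destruct (proj1 (filterlim_locally f (f x)) H (mkposreal eps He)) as [r Hr].
  exists r; split; [apply cond_pos |]. intros y Hy. exact (Hr y Hy).
- intros H. apply filterlim_locally. intros eps.
  destruct (H eps (cond_pos eps)) as [r [Hr Hy]].
  exists (mkposreal r Hr). exact Hy.
Qed.

Section Intersection.

(* [X d] and [Z d] are coordinates, tangent and normal to the curve at [d = 0], of the
   geodesic tangent to the curve at [d]; [Z] is a normal coordinate corrected by a
   multiple of [X ^ 2] so that the geodesic [d = 0] is flat to second order. *)
Variables (X X1 Z Z1 : R -> R -> R) (K m a b r0 : R).
Hypothesis K_pos : 0 < K.
Hypothesis r0_pos : 0 < r0.
Hypothesis X_derive : forall d v, Rabs d < r0 -> Rabs v < r0 -> is_derive (X d) v (X1 d v).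
Hypothesis Z_derive : forall d v, Rabs d < r0 -> Rabs v < r0 -> is_derive (Z d) v (Z1 d v).
Hypothesis X_cont : forall d v, Rabs d < r0 -> Rabs v < r0 -> continuous (fun d => X d v) d.
Hypothesis Z_cont : forall d v, Rabs d < r0 -> Rabs v < r0 -> continuous (fun d => Z d v) d.

(** The cubic terms of X that are not a function of d + v. They vanish at d = 0, so that P 0 u is
    the same polynomial in u as P d v - q d v is in d + v. Here K stands for the squared curvature
    and m for the contribution of the Christoffel terms. *)
Let q (d v : R) : R :=
  - 2 * m * (d ^ 3 / 6 + v * d ^ 2 / 2 + v ^ 2 * d / 2)
  - (K + m) * (d ^ 3 / 6 + v * d ^ 2 / 2).
Let P (d v : R) : R := (d + v) + a * (d + v) ^ 2 + b * (d + v) ^ 3 + q d v.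

Hypothesis X1_small : small2 0 (fun p => X1 (fst p) (snd p) - 1).
Hypothesis X_small : small2 3 (fun p => X (fst p) (snd p) - P (fst p) (snd p)).
Hypothesis Z1_small : small2 1 (fun p => Z1 (fst p) (snd p) - K * fst p).
Hypothesis Z_small :
  small2 2 (fun p => Z (fst p) (snd p) - K * (fst p ^ 2 / 2 + snd p * fst p)).

Lemma X_linear : small2 1 (fun p => X (fst p) (snd p) - (fst p + snd p)).
Proof.
assert (L := planar_gauge_ge_0). assert (L' := planar_gauge_lim).
assert (B1 := big2_fst). assert (B2 := big2_snd).
assert (Q : big2 2 (fun p => P (fst p) (snd p) - (fst p + snd p))).
{ apply (big_ext _ _ _ (fun p : R * R =>
   (fst p + snd p) * ((a + b * (fst p + snd p)) * (fst p + snd p))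
   + fst p * ((- 2 * m) * (/ 6 * (fst p * fst p) + / 2 * (snd p * fst p)
                        + / 2 * (snd p * snd p))
              + - (K + m) * (/ 6 * (fst p * fst p) + / 2 * (snd p * fst p))))).
  - apply filter_forall. intros p. unfold P, q. field.
  - big_poly. }
apply (small_ext _ _ 1 (fun p => (X (fst p) (snd p) - P (fst p) (snd p))
   + (P (fst p) (snd p) - (fst p + snd p)))).
- apply filter_forall. intros; ring.
- apply small_plus; [exact _ | |].
  + now apply (small_weaken _ _ L L' 1 3); [lia |].
  + now apply (big_small _ _ L L' 1 2); [lia |].
Qed.

(** A comfortable margin: below, the errors amount to at most 148/500 of K d^2 against a main term K
    d^2 / 2, and to 43/500 of K d against a slope K d. *)
Let eps0 := K / 500.

Lemma intersection_scale :
  exists r, 0 < r <= r0 /\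
  forall d v, Rabs d < r -> Rabs v < r ->
    1 / 2 <= X1 d v <= 3 / 2 /\
    Rabs (X d v) <= 2 * (Rabs d + Rabs v) /\
    Rabs (Z1 d v - K * d) <= eps0 * (Rabs d + Rabs v) /\
    Rabs (Z d v - K * (d ^ 2 / 2 + v * d)) <= eps0 * (Rabs d + Rabs v) ^ 2.
Proof.
assert (E0 : 0 < eps0) by (unfold eps0; lra).
assert (Eh : 0 < 1 / 2) by lra.
destruct (proj1 (locally_planar _) (filter_and _ _ (X1_small _ Eh)
  (filter_and _ _ (X_linear 1 Rlt_0_1)
  (filter_and _ _ (Z1_small _ E0) (Z_small _ E0))))) as [r [Hr H]].
exists (Rmin r r0). split; [split; [now apply Rmin_glb_lt | apply Rmin_r] |].
intros d v Hd Hv.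
destruct (H d v) as (A & B & C & D).
{ eapply Rlt_le_trans; [exact Hd | apply Rmin_l]. }
{ eapply Rlt_le_trans; [exact Hv | apply Rmin_l]. }
unfold planar_gauge in *; simpl fst in *; simpl snd in *.
rewrite pow_1 in B, C. rewrite pow_O in A. apply Rabs_le_between in A.
split; [lra |]. split; [| split; [exact C | exact D]].
replace (X d v) with ((X d v - (d + v)) + (d + v)) by ring.
eapply Rle_trans; [apply Rabs_triang |].
generalize (Rabs_triang d v); lra.
Qed.

Lemma X_origin : X 0 0 = 0.
Proof.
destruct (proj1 (locally_planar _) (X_linear 1 Rlt_0_1)) as [r [Hr H]].
assert (A : Rabs 0 < r) by (rewrite Rabs_R0; exact Hr).
specialize (H 0 0 A A). unfold planar_gauge in H; simpl in H.
rewrite Rabs_R0 in H.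
assert (B : Rabs (X 0 0 - (0 + 0)) = 0)
  by (apply Rle_antisym; [lra | apply Rabs_pos]).
apply Rabs_eq_0 in B. lra.
Qed.

(** At v = 0 and v = - d the main term K (d^2 / 2 + v d) of the height equals K d^2 / 2 and - K d^2
    / 2, which gives a zero in between; the slope K d in v makes it unique, and uniqueness gives
    continuity in d. *)
Lemma intersection_exists :
  exists d0 u v, 0 < d0 /\ forall d, 0 < d < d0 ->
    Rabs (u d) <= 8 * d /\ - d < v d < 0 /\
    X d (v d) = X 0 (u d) /\ Z d (v d) = Z 0 (u d) /\
    continuous u d /\ continuous v d.
Proof.
destruct intersection_scale as [r [Hr H]].
assert (E0 : 0 < eps0) by (unfold eps0; lra).
assert (R0 : Rabs 0 < r) by (rewrite Rabs_R0; lra).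
destruct (local_inverse (X 0) (X1 0) r ltac:(lra) X_origin) as [L [U HU]].
{ intros x Hx. split; [apply X_derive; lra | apply H; lra]. }
assert (XL : forall d v v', Rabs d < r -> Rabs v < r -> Rabs v' < r ->
  Rabs (X d v - X d v') <= 3 / 2 * Rabs (v - v')).
{ intros d v v' Hd Hv Hv'. apply (derive_lip _ (X1 d) r); [|exact Hv | exact Hv'].
  intros x Hx. split; [apply X_derive; lra |].
  destruct (H d x Hd Hx) as [A _]. rewrite Rabs_pos_eq; lra. }
(* The height of the geodesic [d] over the geodesic [0]; it increases with [v]. *)
set (psi := fun d v => Z d v - Z 0 (U (X d v))).
(* With |v| <= 2 d, X d v is at most 6 d < r / 4, where U inverts X 0, and U (X d v) is at most 12 d
   < r. *)
assert (XB : forall d v, 0 < d < r / 40 -> Rabs v <= 2 * d ->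
  Rabs d < r /\ Rabs v < r /\ Rabs (X d v) <= 2 * (d + Rabs v) /\
  Rabs (U (X d v)) <= 4 * (d + Rabs v) /\ X 0 (U (X d v)) = X d v).
{ intros d v Hd Hv.
  assert (Hd' : Rabs d < r) by (rewrite Rabs_pos_eq; lra).
  assert (Hv' : Rabs v < r) by lra.
  destruct (H d v Hd' Hv') as (_ & A & _). rewrite (Rabs_pos_eq d) in A by lra.
  destruct (HU (X d v)) as [B C]; [lra |].
  repeat split; try assumption; lra. }
assert (ZU : forall d u u', 0 < d < r / 40 -> Rabs u <= 12 * d -> Rabs u' <= 12 * d ->
  Rabs (Z 0 u - Z 0 u') <= (13 * eps0 * d) * Rabs (u - u')).
{ intros d u u' Hd Hu Hu'. apply (derive_lip _ (Z1 0) (13 * d)); try lra.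
  intros x Hx. split; [apply Z_derive; lra |].
  destruct (H 0 x R0 ltac:(lra)) as (_ & _ & A & _).
  rewrite Rabs_R0, Rmult_0_r, Rminus_0_r, Rplus_0_l in A.
  eapply Rle_trans; [exact A |]. nra. }
(* Z d grows at rate at least (K - 4 eps0) d. The subtracted term varies at rate at most 39 eps0 d:
   X d is 3/2-Lipschitz, U is 2-Lipschitz, and Z 0 is 13 eps0 d-Lipschitz on the range concerned. *)
assert (Mono : forall d v v', 0 < d < r / 40 -> Rabs v <= 2 * d -> Rabs v' <= 2 * d ->
  v < v' -> psi d v < psi d v').
{ intros d v v' Hd Hv Hv' Hlt.
  destruct (XB d v Hd Hv) as (D & V & _ & B & C).
  destruct (XB d v' Hd Hv') as (_ & V' & _ & B' & C').
  assert (A := ZU d (U (X d v')) (U (X d v)) Hd ltac:(lra) ltac:(lra)).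
  assert (A' : Rabs (U (X d v') - U (X d v)) <= 3 * (v' - v)).
  { eapply Rle_trans; [apply L; lra |]. rewrite C, C'.
    assert (A' := XL d v' v D V' V). rewrite (Rabs_pos_eq (v' - v)) in A' by lra. lra. }
  assert (G : (K * d - 4 * eps0 * d) * (v' - v) <= Z d v' - Z d v).
  { apply (derive_bounds (Z d) (Z1 d) (3 * d) _ (K * d + 4 * eps0 * d)); try lra.
    intros x Hx. split; [apply Z_derive; lra |].
    destruct (H d x D ltac:(lra)) as (_ & _ & G & _).
    rewrite (Rabs_pos_eq d) in G by lra. apply Rabs_le_between in G.
    assert (eps0 * (d + Rabs x) <= eps0 * (4 * d)) by (apply Rmult_le_compat_l; lra).
    lra. }
  apply Rabs_le_between in A.
  assert (A2 : 13 * eps0 * d * Rabs (U (X d v') - U (X d v)) <=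
    13 * eps0 * d * (3 * (v' - v))) by (apply Rmult_le_compat_l; [nra | exact A']).
  assert (G2 : 0 < (K * d - 4 * eps0 * d - 39 * eps0 * d) * (v' - v)).
  { apply Rmult_lt_0_compat; [| lra]. unfold eps0. nra. }
  unfold psi. lra. }
assert (Zu : forall d u, 0 < d < r / 40 -> Rabs u <= 12 * d ->
  Rabs (Z 0 u) <= 144 * eps0 * d ^ 2).
{ intros d u Hd Hu. destruct (H 0 u R0 ltac:(lra)) as (_ & _ & _ & A).
  rewrite Rabs_R0, Rplus_0_l in A.
  replace (Z 0 u - K * (0 ^ 2 / 2 + u * 0)) with (Z 0 u) in A by field.
  eapply Rle_trans; [exact A |].
  assert (Rabs u ^ 2 <= (12 * d) ^ 2) by (apply pow_incr; split; [apply Rabs_pos | lra]).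
  nra. }
assert (psi0 : forall d, 0 < d < r / 40 -> 0 < psi d 0).
{ intros d Hd. assert (Hv : Rabs 0 <= 2 * d) by (rewrite Rabs_R0; lra).
  destruct (XB d 0 Hd Hv) as (D & V & _ & B & C).
  assert (A := Zu d (U (X d 0)) Hd ltac:(lra)).
  destruct (H d 0 D V) as (_ & _ & _ & A').
  rewrite Rabs_R0, (Rabs_pos_eq d) in A' by lra.
  apply Rabs_le_between in A, A'.
  assert (Q : 0 < K * d ^ 2) by (apply Rmult_lt_0_compat; [exact K_pos | apply pow_lt; lra]).
  replace (144 * eps0 * d ^ 2) with (144 / 500 * (K * d ^ 2)) in A
    by (unfold eps0; field).
  replace (eps0 * (d + 0) ^ 2) with (1 / 500 * (K * d ^ 2)) in A'
    by (unfold eps0; field).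
  replace (K * (d ^ 2 / 2 + 0 * d)) with (1 / 2 * (K * d ^ 2)) in A' by field.
  unfold psi. lra. }
assert (psid : forall d, 0 < d < r / 40 -> psi d (- d) < 0).
{ intros d Hd. assert (Hv : Rabs (- d) <= 2 * d) by (rewrite Rabs_Ropp, Rabs_pos_eq; lra).
  destruct (XB d (- d) Hd Hv) as (D & V & _ & B & C).
  assert (A := Zu d (U (X d (- d))) Hd ltac:(lra)).
  destruct (H d (- d) D V) as (_ & _ & _ & A').
  rewrite Rabs_Ropp, (Rabs_pos_eq d) in A' by lra.
  apply Rabs_le_between in A, A'.
  assert (Q : 0 < K * d ^ 2) by (apply Rmult_lt_0_compat; [exact K_pos | apply pow_lt; lra]).
  replace (144 * eps0 * d ^ 2) with (144 / 500 * (K * d ^ 2)) in A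
    by (unfold eps0; field).
  replace (eps0 * (d + d) ^ 2) with (4 / 500 * (K * d ^ 2)) in A'
    by (unfold eps0; field).
  replace (K * (d ^ 2 / 2 + - d * d)) with (- (1 / 2) * (K * d ^ 2)) in A' by field.
  unfold psi. lra. }
assert (UC : forall y, Rabs y < r / 4 -> continuous U y).
{ intros y Hy. apply continuous_eps. intros e He.
  exists (Rmin (e / 2) (r / 4 - Rabs y)). split; [apply Rmin_glb_lt; lra |].
  intros y' Hy'.
  assert (Hy1 := Rlt_le_trans _ _ _ Hy' (Rmin_l _ _)).
  assert (Hy2 := Rlt_le_trans _ _ _ Hy' (Rmin_r _ _)).
  assert (T := Rabs_triang_inv y' y).
  destruct (HU y Hy) as [A B]. destruct (HU y' ltac:(lra)) as [A' B'].
  eapply Rle_lt_trans; [apply L; lra |]. rewrite B, B'. lra. }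
assert (UXC : forall (w : R -> R) d, 0 < d < r / 40 -> Rabs (w d) <= 2 * d ->
  continuous (fun d' => X d' (w d')) d -> continuous (fun d' => U (X d' (w d'))) d).
{ intros w d Hd Hw Hc. apply (continuous_comp (fun d' => X d' (w d')) U d); [exact Hc |].
  apply UC. destruct (XB d (w d) Hd Hw) as (_ & _ & A & _). lra. }
assert (ZC : forall u, Rabs u < r -> continuous (Z 0) u).
{ intros u Hu. apply (ex_derive_continuous (Z 0)). exists (Z1 0 u).
  apply Z_derive; lra. }
destruct (functional_choice (fun d v => 0 < d < r / 40 -> - d < v < 0 /\ psi d v = 0))
  as [v Hv].
{ intros d. destruct (Rlt_dec 0 d) as [D1 | D1]; [| exists 0; intros; lra].
  destruct (Rlt_dec d (r / 40)) as [D2 | D2]; [| exists 0; intros; lra].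
  destruct (IVT_interv (psi d) (- d) 0) as [v [Hv E]].
  - intros v Hv. assert (Hv' : Rabs v <= 2 * d) by (apply Rabs_le; lra).
    destruct (XB d v ltac:(lra) Hv') as (D & V & A & B & C).
    apply continuity_pt_filterlim. unfold psi.
    apply (continuous_minus (V := R_NormedModule) (Z d) (fun v => Z 0 (U (X d v)))).
    + apply (ex_derive_continuous (Z d)). exists (Z1 d v). apply Z_derive; lra.
    + apply (continuous_comp (fun v => U (X d v)) (Z 0)); [| apply ZC; lra].
      apply (continuous_comp (X d) U); [| apply UC; lra].
      apply (ex_derive_continuous (X d)). exists (X1 d v). apply X_derive; lra.
  - lra.
  - apply psid; lra.
  - apply psi0; lra.
  - exists v. intros _. split; [| exact E].
    assert (N0 := psi0 d ltac:(lra)). assert (Nd := psid d ltac:(lra)).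
    split.
    + destruct (proj1 Hv) as [? | E']; [assumption |]. rewrite <- E' in E. lra.
    + destruct (proj2 Hv) as [? | E']; [assumption |]. rewrite E' in E. lra. }
assert (Vb : forall d, 0 < d < r / 40 -> Rabs (v d) <= d).
{ intros d Hd. destruct (Hv d Hd) as [A _]. apply Rabs_le; lra. }
assert (psiC : forall d w, 0 < d < r / 40 -> Rabs w <= 2 * d ->
  continuous (fun d' => psi d' w) d).
{ intros d w Hd Hw. destruct (XB d w Hd Hw) as (D & W & A & B & C).
  unfold psi.
  apply (continuous_minus (V := R_NormedModule) (fun d' => Z d' w)
    (fun d' => Z 0 (U (X d' w)))); [apply Z_cont; lra |].
  apply (continuous_comp (fun d' => U (X d' w)) (Z 0)); [| apply ZC; lra].
  apply (UXC (fun _ => w) d Hd Hw). apply X_cont; lra. }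
(* Choose v1 < v d < v2 within e of v d. The strict signs of psi at v1 and v2 persist for d' near d,
   and monotonicity of psi d' traps v d' between them. *)
assert (VC : forall d, 0 < d < r / 40 -> continuous v d).
{ intros d Hd. apply continuous_eps. intros e He.
  destruct (Hv d Hd) as [Vd Ed].
  set (v1 := (v d + Rmax (- d) (v d - e)) / 2).
  set (v2 := (v d + Rmin 0 (v d + e)) / 2).
  assert (V1 : - d < v1 < v d /\ v d - e < v1).
  { unfold v1, Rmax; destruct (Rle_dec _ _); lra. }
  assert (V2 : v d < v2 < 0 /\ v2 < v d + e).
  { unfold v2, Rmin; destruct (Rle_dec _ _); lra. }
  assert (B1 : Rabs v1 <= 2 * d) by (apply Rabs_le; lra).
  assert (B2 : Rabs v2 <= 2 * d) by (apply Rabs_le; lra).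
  assert (B : Rabs (v d) <= 2 * d) by (apply Rabs_le; lra).
  assert (S1 := Mono d v1 (v d) Hd B1 B ltac:(lra)).
  assert (S2 := Mono d (v d) v2 Hd B B2 ltac:(lra)).
  rewrite Ed in S1, S2.
  destruct (proj1 (continuous_eps _ _) (psiC d v1 Hd B1) (- psi d v1) ltac:(lra))
    as [r1 [Hr1 C1]].
  destruct (proj1 (continuous_eps _ _) (psiC d v2 Hd B2) (psi d v2) ltac:(lra))
    as [r2 [Hr2 C2]].
  set (rr := Rmin (Rmin r1 r2) (Rmin (d + v1) (Rmin d (r / 40 - d)))).
  exists rr. split.
  { unfold rr. repeat apply Rmin_glb_lt; lra. }
  intros d' Hd'.
  assert (Q1 : rr <= r1) by (eapply Rle_trans; [apply Rmin_l | apply Rmin_l]).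
  assert (Q2 : rr <= r2) by (eapply Rle_trans; [apply Rmin_l | apply Rmin_r]).
  assert (Q3 : rr <= d + v1) by (eapply Rle_trans; [apply Rmin_r | apply Rmin_l]).
  assert (Q4 : rr <= d).
  { eapply Rle_trans; [apply Rmin_r |]. eapply Rle_trans; [apply Rmin_r | apply Rmin_l]. }
  assert (Q5 : rr <= r / 40 - d).
  { eapply Rle_trans; [apply Rmin_r |]. eapply Rle_trans; [apply Rmin_r | apply Rmin_r]. }
  specialize (C1 d' ltac:(lra)). specialize (C2 d' ltac:(lra)).
  apply Rabs_def2 in C1, C2, Hd'.
  assert (Hd2 : 0 < d' < r / 40) by lra.
  destruct (Hv d' Hd2) as [Vd' Ed'].
  assert (B1' : Rabs v1 <= 2 * d') by (apply Rabs_le; lra).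
  assert (B' : Rabs (v d') <= 2 * d') by (apply Rabs_le; lra).
  assert (I1 : v1 < v d').
  { apply Rnot_le_lt. intros Hle. destruct Hle as [Hlt | Heq].
    - assert (M := Mono d' (v d') v1 Hd2 B' B1' Hlt). lra.
    - rewrite Heq in Ed'. lra. }
  assert (I2 : v d' < v2).
  { apply Rnot_le_lt. intros Hle.
    assert (B2' : Rabs v2 <= 2 * d') by (apply Rabs_le; lra).
    destruct Hle as [Hlt | Heq].
    - assert (M := Mono d' v2 (v d') Hd2 B2' B' Hlt). lra.
    - rewrite <- Heq in Ed'. lra. }
  apply Rabs_def1; lra. }
exists (r / 40), (fun d => U (X d (v d))), v. split; [lra |].
intros d Hd. destruct (Hv d Hd) as [Vd Ed].
assert (B := Vb d Hd).
destruct (XB d (v d) Hd ltac:(lra)) as (D & V & A & A' & C).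
split; [lra |]. split; [exact Vd |]. split; [now symmetry |].
split; [unfold psi in Ed; lra |]. split; [| now apply VC].
apply UXC; [exact Hd | lra |].
apply continuous_eps. intros e He.
destruct (proj1 (continuous_eps _ _) (VC d Hd) (e / 4) ltac:(lra)) as [r1 [Hr1 C1]].
destruct (proj1 (continuous_eps _ _) (X_cont d (v d) ltac:(lra) ltac:(lra)) (e / 4)
  ltac:(lra)) as [r2 [Hr2 C2]].
set (rr := Rmin (Rmin r1 r2) (Rmin d (r / 40 - d))).
exists rr. split.
{ unfold rr. repeat apply Rmin_glb_lt; lra. }
intros d' Hd'.
assert (Q1 : rr <= r1) by (eapply Rle_trans; [apply Rmin_l | apply Rmin_l]).
assert (Q2 : rr <= r2) by (eapply Rle_trans; [apply Rmin_l | apply Rmin_r]).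
assert (Q3 : rr <= d) by (eapply Rle_trans; [apply Rmin_r | apply Rmin_l]).
assert (Q4 : rr <= r / 40 - d) by (eapply Rle_trans; [apply Rmin_r | apply Rmin_r]).
specialize (C1 d' ltac:(lra)). specialize (C2 d' ltac:(lra)).
apply Rabs_def2 in Hd'.
assert (Hd2 : 0 < d' < r / 40) by lra.
assert (B' := Vb d' Hd2).
replace (X d' (v d') - X d (v d)) with
  ((X d' (v d') - X d' (v d)) + (X d' (v d) - X d (v d))) by ring.
eapply Rle_lt_trans; [apply Rabs_triang |].
assert (A2 := XL d' (v d') (v d) ltac:(rewrite Rabs_pos_eq; lra) ltac:(lra) ltac:(lra)).
lra.
Qed.

(** Equal heights give d K (v + d / 2) = o(d^2). Equal X give p(u) - p(d + v) = q + o(d^3) with p(x)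
    = x + a x^2 + b x^3; the left side factors as (u - v - d) (1 + th) with th = o(1). *)
Lemma intersection_asymptotics (d0 : R) (u v : R -> R) :
  0 < d0 ->
  (forall d, 0 < d < d0 -> Rabs (u d) <= 8 * d /\ - d < v d < 0 /\
    X d (v d) = X 0 (u d) /\ Z d (v d) = Z 0 (u d)) ->
  small1 1 (fun d => v d + d / 2) /\
  small1 3 (fun d => u d - v d - d - K / 12 * d ^ 3).
Proof.
intros Hd0 H.
assert (L := Rabs_pos). assert (L' := Rabs_at_right_lim).
assert (D0 : at_right 0 (fun d => 0 < d < d0))
  by (apply at_right_0; now exists d0).
assert (Bu : big1 1 u).
{ exists 8; split; [lra |]. generalize D0. apply filter_imp. intros d Hd.
  rewrite pow_1, (Rabs_pos_eq d) by lra. now apply H. }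
assert (Bv : big1 1 v).
{ exists 1; split; [lra |]. generalize D0. apply filter_imp. intros d Hd.
  rewrite pow_1, (Rabs_pos_eq d) by lra. destruct (H d Hd) as (_ & A & _).
  apply Rabs_le; lra. }
assert (Bd := big1_id).
assert (Bz : big1 1 (fun _ => 0)).
{ exists 0; split; [lra |]. apply filter_forall. intros d. rewrite Rabs_R0; lra. }
assert (Sv : small1 1 (fun d => v d + d / 2)).
{ apply small1_div.
  assert (E1 := small2_comp 2 _ _ _ Z_small Bd Bv).
  assert (E2 := small2_comp 2 _ _ _ Z_small Bz Bu).
  apply (small_ext _ _ _ (fun d => / K * ((Z 0 (u d) - K * (0 ^ 2 / 2 + u d * 0))
    - (Z d (v d) - K * (d ^ 2 / 2 + v d * d))))).
  - generalize D0. apply filter_imp. intros d Hd.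
    destruct (H d Hd) as (_ & _ & _ & ->). field. lra.
  - apply (small_scal _ _ L 2), (small_minus _ _ 2); [exact E2 | exact E1]. }
split; [exact Sv |].
assert (E1 := small2_comp 3 _ _ _ X_small Bd Bv).
assert (E2 := small2_comp 3 _ _ _ X_small Bz Bu).
simpl fst in E1, E2. simpl snd in E1, E2.
(* At v = - d / 2 the first bracket of q is d^3 / 24 and the second is - d^3 / 12, so the multiples
   of m cancel and K d^3 / 12 is left. *)
assert (Sq : small1 3 (fun d => q d (v d) - K / 12 * d ^ 3)).
{ apply (small_ext _ _ _ (fun d => (v d + d / 2) *
     (v d * (- m * d) + d * ((- m * / 2 + - (K + m) * / 2) * d)))).
  - apply filter_forall. intros d. unfold q. field.
  - apply (small_mult_big _ _ L 1 2); [exact Sv |]. big_poly. }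
assert (Bq : big1 3 (fun d => q d (v d))).
{ apply (big_ext _ _ _ (fun d => (q d (v d) - K / 12 * d ^ 3) + d * (d * (K / 12 * d)))).
  - apply filter_forall. intros d. ring.
  - apply small_big in Sq. big_poly. }
set (w := fun d => u d - v d - d).
set (th := fun d => a * (u d + (d + v d)) +
  b * (u d * u d + (u d * (d + v d) + (d + v d) * (d + v d)))).
set (e := fun d => (X d (v d) - P d (v d)) - (X 0 (u d) - P 0 (u d))).
assert (Se : small1 3 e) by (apply (small_minus _ _ 3); [exact E1 | exact E2]).
assert (Sth : small1 0 th).
{ apply (big_small _ _ L L' 0 1); [lia |].
  unfold th. big_poly. }
assert (Eq : at_right 0 (fun d => w d * (1 + th d) = q d (v d) + e d)).
{ generalize D0. apply filter_imp. intros d Hd.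
  destruct (H d Hd) as (_ & _ & E & _). unfold w, th, e. rewrite E.
  unfold P, q. field. }
(* A first bound w = O(d^3), from 1 + th >= 1/2, is what makes th w negligible at order 3. *)
assert (Bw : big1 3 w).
{ destruct (big_plus _ _ 3 _ _ Bq (small_big _ _ _ _ Se)) as [C [HC HB]].
  exists (2 * C). split; [lra |].
  assert (Hh : 0 < 1 / 2) by lra.
  generalize (filter_and _ _ Eq (filter_and _ _ (Sth _ Hh) HB)). apply filter_imp.
  intros d (A & B & D). rewrite pow_O, Rmult_1_r in B. apply Rabs_le_between in B.
  cbv beta in D. rewrite <- A, Rabs_mult, (Rabs_pos_eq (1 + th d)) in D by lra.
  assert (Q := Rabs_pos (w d)). nra. }
apply (small_ext _ _ _ (fun d => ((q d (v d) - K / 12 * d ^ 3) + e d) - th d * w d)).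
- generalize Eq. apply filter_imp. intros d A. fold (w d).
  replace (w d) with (w d * (1 + th d) - th d * w d) at 2 by ring. rewrite A. ring.
- apply (small_minus _ _ 3).
  + apply (small_plus _ _ 3); [exact Sq | exact Se].
  + apply (small_mult_big _ _ L 0 3); [exact Sth | exact Bw].
Qed.

Theorem string_intersection :
  exists d0 u v, 0 < d0 /\
    (forall d, 0 < d < d0 ->
      0 < u d < d /\ - d < v d < 0 /\
      X d (v d) = X 0 (u d) /\ Z d (v d) = Z 0 (u d) /\
      continuous (fun d => u d - v d - d) d) /\
    small1 3 (fun d => u d - v d - d - K / 12 * d ^ 3).
Proof.
destruct intersection_exists as (d0 & u & v & Hd0 & H).
destruct (intersection_asymptotics d0 u v Hd0) as [Sv Sw].
{ intros d Hd. destruct (H d Hd) as (A & B & C & D & _). repeat split; assumption || apply B. }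
assert (L := Rabs_pos). assert (L' := Rabs_at_right_lim).
(* Adding the two asymptotics gives u = d / 2 + o(d), hence 0 < u < d for small d. *)
assert (Su : small1 1 (fun d => u d - d / 2)).
{ apply (small_ext _ _ _ (fun d => ((u d - v d - d - K / 12 * d ^ 3) + (v d + d / 2))
    + d * (d * (K / 12 * d)))).
  - apply filter_forall. intros d. field.
  - apply (small_plus _ _ 1); [apply (small_plus _ _ 1); [| exact Sv] |].
    + apply (small_weaken _ _ L L' 1 3); [lia | exact Sw].
    + apply (big_small _ _ L L' 1 3); [lia |]. assert (Bd := big1_id). big_poly. }
assert (Hq : 0 < 1 / 4) by lra.
destruct (proj1 (at_right_0 _) (Su _ Hq)) as [r [Hr Hu]].
exists (Rmin r d0), u, v. split; [now apply Rmin_glb_lt |]. split; [| exact Sw].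
intros d [Hd Hd'].
assert (Hd1 := Rlt_le_trans _ _ _ Hd' (Rmin_l _ _)).
assert (Hd2 := Rlt_le_trans _ _ _ Hd' (Rmin_r _ _)).
destruct (H d (conj Hd Hd2)) as (A & B & C & D & E & G).
specialize (Hu d (conj Hd Hd1)). rewrite pow_1, (Rabs_pos_eq d) in Hu by lra.
apply Rabs_le_between in Hu.
split; [lra |]. split; [exact B |]. split; [exact C |]. split; [exact D |].
apply (continuous_minus (V := R_NormedModule) (fun d => u d - v d) (fun d => d)).
- apply (continuous_minus (V := R_NormedModule) u v); assumption.
- apply continuous_id.
Qed.

End Intersection.

(** * Taylor expansions along a family of curves *)

Definition small0 : nat -> (R -> R) -> Prop := small (locally 0) Rabs.

Lemma locally_0 (P : R -> Prop) :
  locally 0 P <-> exists r, 0 < r /\ forall d, Rabs d < r -> P d.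
Proof.
split.
- intros [r Hr]. exists r; split; [apply cond_pos |]. intros d Hd. apply Hr.
  unfold ball; simpl. unfold AbsRing_ball, abs, minus, plus, opp; simpl.
  now rewrite Ropp_0, Rplus_0_r.
- intros [r [Hr H]]. exists (mkposreal r Hr). intros d Hd.
  unfold ball in Hd; simpl in Hd.
  unfold AbsRing_ball, abs, minus, plus, opp in Hd; simpl in Hd.
  rewrite Ropp_0, Rplus_0_r in Hd. now apply H.
Qed.

Lemma mvt_power (g g1 : R -> R) (M x : R) :
  (forall y, Rabs y <= Rabs x -> is_derive g y (g1 y) /\ Rabs (g1 y) <= M) ->
  Rabs (g x - g 0) <= M * Rabs x.
Proof.
intros H.
destruct (MVT_cor4 g g1 0 (Rabs x)) with (b := x) as [c [E Hc]].
- intros c Hc. rewrite Rminus_0_r in Hc. now apply H.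
- rewrite Rminus_0_r. apply Rle_refl.
- rewrite !Rminus_0_r in Hc. rewrite E, Rminus_0_r, Rabs_mult.
  apply Rmult_le_compat_r; [apply Rabs_pos | now apply H].
Qed.

Lemma small0_integrate (n : nat) (g g1 : R -> R) :
  locally 0 (fun d => is_derive g d (g1 d)) -> g 0 = 0 ->
  small0 n g1 -> small0 (S n) g.
Proof.
intros Hg G0 S eps Heps.
destruct (proj1 (locally_0 _) (filter_and _ _ Hg (S eps Heps))) as [r [Hr H]].
apply locally_0. exists r; split; [exact Hr |]. intros d Hd.
replace (g d) with (g d - g 0) by (rewrite G0; ring).
replace (eps * Rabs d ^ Datatypes.S n) with ((eps * Rabs d ^ n) * Rabs d) by (simpl; ring).
apply mvt_power with g1. intros y Hy. destruct (H y ltac:(lra)) as [A B].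
split; [exact A |]. eapply Rle_trans; [exact B |].
apply Rmult_le_compat_l; [lra |]. apply pow_incr. split; [apply Rabs_pos | exact Hy].
Qed.

(** The order is gained by integrating in v alone; the dependence on d is supplied by the values at
    v = 0. *)
Lemma small2_integrate (n : nat) (e e1 : R -> R -> R) :
  locally (0, 0) (fun p => is_derive (e (fst p)) (snd p) (e1 (fst p) (snd p))) ->
  small2 n (fun p => e1 (fst p) (snd p)) ->
  small0 (S n) (fun d => e d 0) ->
  small2 (S n) (fun p => e (fst p) (snd p)).
Proof.
intros He S0 S1 eps Heps. assert (Heps' : 0 < eps / 2) by lra.
destruct (proj1 (locally_planar _) (filter_and _ _ He (S0 _ Heps'))) as [r [Hr H]].
destruct (proj1 (locally_0 _) (S1 _ Heps')) as [r' [Hr' H']].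
apply locally_planar. exists (Rmin r r'). split; [now apply Rmin_glb_lt |].
intros d v Hd Hv.
assert (Hd1 := Rlt_le_trans _ _ _ Hd (Rmin_l _ _)).
assert (Hd2 := Rlt_le_trans _ _ _ Hd (Rmin_r _ _)).
assert (Hv1 := Rlt_le_trans _ _ _ Hv (Rmin_l _ _)).
unfold planar_gauge in *. simpl fst in *. simpl snd in *.
assert (A : Rabs (e d v - e d 0) <= (eps / 2 * (Rabs d + Rabs v) ^ n) * Rabs v).
{ apply mvt_power with (e1 d). intros y Hy. destruct (H d y Hd1 ltac:(lra)) as [A B].
  split; [exact A |]. eapply Rle_trans; [exact B |].
  apply Rmult_le_compat_l; [lra |]. apply pow_incr. simpl.
  generalize (Rabs_pos d) (Rabs_pos y); lra. }
specialize (H' d Hd2).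
replace (e d v) with ((e d v - e d 0) + e d 0) by ring.
eapply Rle_trans; [apply Rabs_triang |].
assert (P := Rabs_pos d). assert (Q := Rabs_pos v).
assert (B : Rabs d ^ S n <= (Rabs d + Rabs v) ^ S n) by (apply pow_incr; lra).
assert (C : (Rabs d + Rabs v) ^ n * Rabs v <= (Rabs d + Rabs v) ^ S n).
{ simpl. rewrite Rmult_comm. apply Rmult_le_compat_r; [apply pow_le |]; lra. }
nra.
Qed.

Lemma small0_derive (g : R -> R) (l : R) :
  is_derive g 0 l -> small0 1 (fun d => g d - g 0 - l * d).
Proof.
intros [_ H] eps Heps.
specialize (H 0 (fun P HP => HP) (mkposreal eps Heps)).
generalize H. apply filter_imp. intros d Hd. simpl in Hd.
unfold minus, plus, opp, scal, norm in Hd; simpl in Hd.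
unfold mult, abs in Hd; simpl in Hd. rewrite Ropp_0, Rplus_0_r in Hd.
rewrite pow_1. replace (g d - g 0 - l * d) with (g d + - g 0 + - (d * l)) by ring.
exact Hd.
Qed.

Ltac derive_by D :=
  match type of D with
  | is_derive ?f ?x ?l =>
    auto_derive; [now exists l |
      replace (Derive (fun y => f y) x) with l
        by (symmetry; exact (is_derive_unique f x l D))]
  end.

Section Jet.

(* A family of solutions [X d] of a second order equation, starting on the curve [x] with
   the velocity of [x]; [- w] is the value on [x] of the right-hand side. *)
Variables (X X1 X2 X3 : R -> R -> R) (x x' x'' w : R -> R) (x3 w1 J : R).

Definition jet : Prop :=
  locally (0, 0) (fun p =>
    is_derive (X (fst p)) (snd p) (X1 (fst p) (snd p)) /\
    is_derive (X1 (fst p)) (snd p) (X2 (fst p) (snd p)) /\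
    is_derive (X2 (fst p)) (snd p) (X3 (fst p) (snd p))) /\
  small2 0 (fun p => X3 (fst p) (snd p) - J) /\
  locally 0 (fun d => X d 0 = x d /\ X1 d 0 = x' d /\ X2 d 0 = - w d /\
    is_derive x d (x' d) /\ is_derive x' d (x'' d)) /\
  is_derive x'' 0 x3 /\ is_derive w 0 w1.

(** Integrates the constant approximation J of the third v-derivative three times. At each stage the
    initial values at v = 0 are expanded along the curve: to order 1 for w, 2 for x' and 3 for x. *)
Lemma jet_taylor : jet ->
  small2 2 (fun p => let d := fst p in let v := snd p in
    X1 d v - (x' 0 + x'' 0 * d + x3 * d ^ 2 / 2 - (w 0 + w1 * d) * v + J * v ^ 2 / 2)) /\
  small2 3 (fun p => let d := fst p in let v := snd p in
    X d v - (x 0 + x' 0 * d + x'' 0 * d ^ 2 / 2 + x3 * d ^ 3 / 6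
      + (x' 0 + x'' 0 * d + x3 * d ^ 2 / 2) * v
      - (w 0 + w1 * d) * v ^ 2 / 2 + J * v ^ 3 / 6)).
Proof.
intros (HX & S3 & Hx & Hx3 & Hw).
assert (T1 := small0_derive _ _ Hx3). assert (W1 := small0_derive _ _ Hw).
assert (T2 : small0 2 (fun d => x' d - (x' 0 + x'' 0 * d + x3 * d ^ 2 / 2))).
{ apply small0_integrate with (fun d => x'' d - x'' 0 - x3 * d); [| field | exact T1].
  generalize Hx. apply filter_imp. intros d (_ & _ & _ & _ & D).
  derive_by D. field. }
assert (T3 : small0 3 (fun d => x d - (x 0 + x' 0 * d + x'' 0 * d ^ 2 / 2 + x3 * d ^ 3 / 6))).
{ apply small0_integrate with
    (fun d => x' d - (x' 0 + x'' 0 * d + x3 * d ^ 2 / 2)); [| field | exact T2].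
  generalize Hx. apply filter_imp. intros d (_ & _ & _ & D & _).
  derive_by D. field. }
assert (S2 : small2 1 (fun p => (fun d v => X2 d v - (- w 0 - w1 * d + J * v)) (fst p) (snd p))).
{ apply (small2_integrate 0 (fun d v => X2 d v - (- w 0 - w1 * d + J * v))
    (fun d v => X3 d v - J)); [| exact S3 |].
  - generalize HX. apply filter_imp. intros [d v] (_ & _ & D). simpl in *.
    derive_by D. ring.
  - apply (small_ext _ _ _ (fun d => - (w d - w 0 - w1 * d))).
    + generalize Hx. apply filter_imp. intros d (_ & _ & -> & _). ring.
    + exact (small_opp (locally 0) Rabs 1 _ W1). }
assert (S1 : small2 2 (fun p => (fun d v => X1 d v -
   (x' 0 + x'' 0 * d + x3 * d ^ 2 / 2 - (w 0 + w1 * d) * v + J * v ^ 2 / 2))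
   (fst p) (snd p))).
{ apply (small2_integrate 1 (fun d v => X1 d v -
   (x' 0 + x'' 0 * d + x3 * d ^ 2 / 2 - (w 0 + w1 * d) * v + J * v ^ 2 / 2))
   (fun d v => X2 d v - (- w 0 - w1 * d + J * v)));
    [| exact S2 |].
  - generalize HX. apply filter_imp. intros [d v] (_ & D & _). simpl in *.
    derive_by D. field.
  - refine (small_ext (locally 0) Rabs _ _ _ _ T2).
    generalize Hx. apply filter_imp. intros d (_ & -> & _). field. }
split; [exact S1 |].
apply (small2_integrate 2 (fun d v => X d v - (x 0 + x' 0 * d + x'' 0 * d ^ 2 / 2
      + x3 * d ^ 3 / 6 + (x' 0 + x'' 0 * d + x3 * d ^ 2 / 2) * v
      - (w 0 + w1 * d) * v ^ 2 / 2 + J * v ^ 3 / 6))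
  (fun d v => X1 d v -
   (x' 0 + x'' 0 * d + x3 * d ^ 2 / 2 - (w 0 + w1 * d) * v + J * v ^ 2 / 2)));
  [| exact S1 |].
- generalize HX. apply filter_imp. intros [d v] (D & _). simpl in *.
  derive_by D. field.
- refine (small_ext (locally 0) Rabs _ _ _ _ T3).
  generalize Hx. apply filter_imp. intros d (-> & _). field.
Qed.

End Jet.

(** X and Y are the components along T and k. The hypotheses on [x''] and [y''] say that the
    covariant acceleration of the curve is k; those on w1 and x3 encode the effect of <T, Dk> = -
    |k|^2 in a frame frozen at c(s). *)
Theorem string_intersection_jet
  (X X1 X2 X3 Y Y1 Y2 Y3 : R -> R -> R) (x x' x'' w y y' y'' z : R -> R)
  (x3 w1 J y3 z1 I K m : R) :
  0 < K ->
  jet X X1 X2 X3 x x' x'' w x3 w1 J ->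
  jet Y Y1 Y2 Y3 y y' y'' z y3 z1 I ->
  locally (0, 0) (fun p => continuous (fun d => X d (snd p)) (fst p) /\
                           continuous (fun d => Y d (snd p)) (fst p)) ->
  x 0 = 0 -> x' 0 = 1 -> x'' 0 = - w 0 ->
  y 0 = 0 -> y' 0 = 0 -> y'' 0 = K - z 0 ->
  w1 = 2 * m - J -> x3 = - K - m - w1 ->
  exists d0 u v, 0 < d0 /\
    (forall d, 0 < d < d0 ->
      0 < u d < d /\ - d < v d < 0 /\
      X d (v d) = X 0 (u d) /\ Y d (v d) = Y 0 (u d) /\
      continuous (fun d => u d - v d - d) d) /\
    small1 3 (fun d => u d - v d - d - K / 12 * d ^ 3).
Proof.
intros HK HX HY HC x0 x1 x2 y0 y1 y2 Hw1 Hx3.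
destruct (jet_taylor _ _ _ _ _ _ _ _ _ _ _ HX) as [TX1 TX].
destruct (jet_taylor _ _ _ _ _ _ _ _ _ _ _ HY) as [TY1 TY].
rewrite x0, x1, x2 in TX. rewrite x1, x2 in TX1.
rewrite y0, y1, y2 in TY. rewrite y1, y2 in TY1.
destruct HX as (DX & _). destruct HY as (DY & _).
destruct (proj1 (locally_planar _) (filter_and _ _ HC (filter_and _ _ DX DY)))
  as [r [Hr H]].
simpl in H.
assert (L := planar_gauge_ge_0). assert (L' := planar_gauge_lim).
assert (B1 := big2_fst). assert (B2 := big2_snd).
assert (XS : big2 2 (fun p => X (fst p) (snd p) - (fst p + snd p))).
{ apply (small_big _ _ 3) in TX. apply (big_weaken _ _ L L' 2 3) in TX; [| lia].
  apply (big_ext _ _ _ (fun p => (X (fst p) (snd p) -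
   (0 + 1 * fst p + - w 0 * fst p ^ 2 / 2 + x3 * fst p ^ 3 / 6 +
    (1 + - w 0 * fst p + x3 * fst p ^ 2 / 2) * snd p -
    (w 0 + w1 * fst p) * snd p ^ 2 / 2 + J * snd p ^ 3 / 6)) +
   (fst p * ((- w 0 / 2 + x3 / 6 * fst p) * fst p + (- w 0 + x3 / 2 * fst p) * snd p)
    + snd p * ((- w 0 / 2 + - w1 / 2 * fst p + J / 6 * snd p) * snd p)))).
  - apply filter_forall. intros p. field.
  - apply (big_plus _ _ 2); [exact TX |].
    big_poly. }
assert (X1S : small2 0 (fun p => X1 (fst p) (snd p) - 1)).
{ apply (small_weaken _ _ L L' 0 2) in TX1; [| lia].
  apply (small_ext _ _ _ (fun p => (X1 (fst p) (snd p) -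
       (1 + - w 0 * fst p + x3 * fst p ^ 2 / 2 - (w 0 + w1 * fst p) * snd p
        + J * snd p ^ 2 / 2)) +
     ((- w 0 + x3 / 2 * fst p) * fst p + (- w 0 + - w1 * fst p + J / 2 * snd p) * snd p))).
  - apply filter_forall. intros p. field.
  - apply (small_plus _ _ 0); [exact TX1 |]. apply (big_small _ _ L L' 0 1); [lia |].
    big_poly. }
assert (XB : big2 1 (fun p => X (fst p) (snd p))).
{ apply (big_ext _ _ _ (fun p => (X (fst p) (snd p) - (fst p + snd p)) + (fst p + snd p))).
  - apply filter_forall. intros p. ring.
  - apply (big_plus _ _ 1).
    + now apply (big_weaken _ _ L L' 1 2); [lia |].
    + big_poly. }
assert (X1B : big2 0 (fun p => X1 (fst p) (snd p))).
{ apply (big_ext _ _ _ (fun p => (X1 (fst p) (snd p) - 1) + 1)).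
  - apply filter_forall. intros p. ring.
  - apply (big_plus _ _ 0); [now apply small_big |].
    exact (big_const (locally (0, 0)) planar_gauge 1). }
assert (SB : big2 1 (fun p => fst p + snd p)) by big_poly.
(* To second order Y = K (d^2 / 2 + d v) - z(0) (d + v)^2 / 2, and X = d + v to first order, so the
   added square removes the Christoffel term. When the values of X agree, equality of Z and equality
   of Y are equivalent. *)
set (Z := fun d v => Y d v + z 0 / 2 * X d v ^ 2).
set (Z1 := fun d v => Y1 d v + z 0 * (X d v * X1 d v)).
destruct (string_intersection X X1 Z Z1 K m (- w 0 / 2) (J / 6) r)
  as (d0 & u & v & Hd0 & Huv & Hl); try assumption.
- intros d v Hd Hv. now apply H.
- intros d v Hd Hv. destruct (H d v Hd Hv) as (_ & (D & _) & D' & _).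
  unfold Z, Z1.
  auto_derive.
  + split; [now exists (Y1 d v) |]. split; [now exists (X1 d v) | exact Logic.I].
  + replace (Derive (fun y => X d y) v) with (X1 d v)
      by (symmetry; exact (is_derive_unique _ _ _ D)).
    replace (Derive (fun y => Y d y) v) with (Y1 d v)
      by (symmetry; exact (is_derive_unique _ _ _ D')).
    field.
- intros d v Hd Hv. now apply H.
- intros d v Hd Hv. destruct (H d v Hd Hv) as ((C & C') & _). unfold Z.
  apply (continuous_plus (V := R_NormedModule) (fun d => Y d v)); [exact C' |].
  apply (continuous_scal_r (V := R_NormedModule) (z 0 / 2) (fun d => X d v ^ 2)).
  simpl. apply (continuous_mult (K := R_AbsRing) (fun d => X d v)); [exact C |].
  apply (continuous_mult (K := R_AbsRing) (fun d => X d v)); [exact C |].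
  apply continuous_const.
- refine (small_ext (locally (0, 0)) planar_gauge _ _ _ _ TX). apply filter_forall. intros p.
  cbv beta zeta. rewrite Hx3, Hw1. field.
- apply (small_ext _ _ _ (fun p => (Y1 (fst p) (snd p) -
      (0 + (K - z 0) * fst p + y3 * fst p ^ 2 / 2 - (z 0 + z1 * fst p) * snd p
       + I * snd p ^ 2 / 2)) +
     ((fst p * (y3 / 2 * fst p) + snd p * (- z1 * fst p + I / 2 * snd p))
      + z 0 * ((X (fst p) (snd p) - (fst p + snd p)) * X1 (fst p) (snd p)
               + (fst p + snd p) * (X1 (fst p) (snd p) - 1))))).
  + apply filter_forall. intros p. unfold Z1. field.
  + apply (small_plus _ _ 1); [now apply (small_weaken _ _ L L' 1 2); [lia |] |].
    apply (small_plus _ _ 1).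
    * apply (big_small _ _ L L' 1 2); [lia |].
      big_poly.
    * apply (small_scal _ _ L 1). apply (small_plus _ _ 1).
      -- apply (big_small _ _ L L' 1 2); [lia |].
         apply (big_mult _ _ 2 0); assumption.
      -- apply (big_mult_small _ _ L 1 0); assumption.
- apply (small_ext _ _ _ (fun p => (Y (fst p) (snd p) -
      (0 + 0 * fst p + (K - z 0) * fst p ^ 2 / 2 + y3 * fst p ^ 3 / 6
       + (0 + (K - z 0) * fst p + y3 * fst p ^ 2 / 2) * snd p
       - (z 0 + z1 * fst p) * snd p ^ 2 / 2 + I * snd p ^ 3 / 6)) +
     ((fst p * (fst p * (y3 / 6 * fst p + y3 / 2 * snd p))
       + snd p * (snd p * (- z1 / 2 * fst p + I / 6 * snd p)))
      + z 0 / 2 * ((X (fst p) (snd p) - (fst p + snd p)) *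
                   (X (fst p) (snd p) + (fst p + snd p)))))).
  + apply filter_forall. intros p. unfold Z. field.
  + apply (small_plus _ _ 2); [now apply (small_weaken _ _ L L' 2 3); [lia |] |].
    apply (small_plus _ _ 2).
    * apply (big_small _ _ L L' 2 3); [lia |].
      big_poly.
    * apply (small_scal _ _ L 2).
      apply (big_small _ _ L L' 2 3); [lia |].
      apply (big_mult _ _ 2 1); [exact XS | big_poly].
- exists d0, u, v. split; [exact Hd0 |]. split; [| exact Hl].
  intros d Hd. destruct (Huv d Hd) as (A & B & C & D & E).
  repeat split; try assumption; try lra.
  unfold Z in D. rewrite C in D. lra.
Qed.

(** * Functions of class C1 in the plane *)

Lemma cont_plus {U : UniformSpace} (f g : U -> R) (x : U) :
  continuous f x -> continuous g x -> continuous (fun y => f y + g y) x.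
Proof. intros; now apply (continuous_plus (V := R_NormedModule) f g). Qed.

Lemma cont_mult {U : UniformSpace} (f g : U -> R) (x : U) :
  continuous f x -> continuous g x -> continuous (fun y => f y * g y) x.
Proof. intros; now apply (continuous_mult (K := R_AbsRing) f g). Qed.

Lemma cont_opp {U : UniformSpace} (f : U -> R) (x : U) :
  continuous f x -> continuous (fun y => - f y) x.
Proof. intros; now apply (continuous_opp (V := R_NormedModule) f). Qed.

Lemma cont_inv {U : UniformSpace} (f : U -> R) (x : U) :
  continuous f x -> f x <> 0 -> continuous (fun y => / f y) x.
Proof. intros H H0. apply (continuous_comp f Rinv); [exact H | now apply continuous_Rinv]. Qed.

Lemma der_eq (f : R -> R) (x l l' : R) : is_derive f x l -> l = l' -> is_derive f x l'.
Proof. now intros H <-. Qed.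

Lemma der_const (c x : R) : is_derive (fun _ => c) x 0.
Proof. exact (is_derive_const c x). Qed.

Lemma der_plus (f g : R -> R) (x l l' : R) :
  is_derive f x l -> is_derive g x l' -> is_derive (fun y => f y + g y) x (l + l').
Proof. exact (is_derive_plus f g x l l'). Qed.

Lemma der_opp (f : R -> R) (x l : R) :
  is_derive f x l -> is_derive (fun y => - f y) x (- l).
Proof. exact (is_derive_opp f x l). Qed.

Lemma der_mult (f g : R -> R) (x l l' : R) :
  is_derive f x l -> is_derive g x l' ->
  is_derive (fun y => f y * g y) x (l * g x + f x * l').
Proof. intros A B. exact (is_derive_mult f g x l l' A B Rmult_comm). Qed.

Lemma der_inv (f : R -> R) (x l : R) :
  is_derive f x l -> f x <> 0 -> is_derive (fun y => / f y) x (- l / f x ^ 2).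
Proof. exact (is_derive_inv f x l). Qed.

Ltac derive_poly :=
  eapply der_eq;
  [ repeat lazymatch goal with
    | |- is_derive (fun _ => ?c) _ _ => apply der_const
    | |- is_derive (fun u => _ + _) _ _ => apply der_plus
    | |- is_derive (fun u => - _) _ _ => apply der_opp
    | |- is_derive (fun u => _ * _) _ _ => apply der_mult
    | |- _ => eassumption
    end
  | cbv beta ].

Ltac cont_poly :=
  repeat lazymatch goal with
    | |- continuous (fun _ => ?c) _ => apply continuous_const
    | |- continuous (fun u => _ + _) _ => apply cont_plus
    | |- continuous (fun u => - _) _ => apply cont_opp
    | |- continuous (fun u => _ * _) _ => apply cont_mult
    | |- _ => assumption
    end.

(** The partial derivatives are named so that chain rule formulas can be written with them; [C1]
    below hides them where only regularity matters. *)
Definition C1_on (V : R * R -> Prop) (f fx fy : R * R -> R) : Prop :=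
  forall z, V z ->
    is_derive (fun x => f (x, snd z)) (fst z) (fx z) /\
    is_derive (fun y => f (fst z, y)) (snd z) (fy z) /\
    continuous fx z /\ continuous fy z.

Lemma open_planar (V : R * R -> Prop) (z : R * R) :
  open V -> V z -> exists r, 0 < r /\
    forall x y, Rabs (x - fst z) < r -> Rabs (y - snd z) < r -> V (x, y).
Proof.
intros HV Hz. destruct (HV z Hz) as [r Hr].
exists r; split; [apply cond_pos |]. intros x y Hx Hy. apply Hr. now split.
Qed.

Lemma C1_on_differentiable (V : R * R -> Prop) (f fx fy : R * R -> R) (z : R * R) :
  open V -> C1_on V f fx fy -> V z ->
  differentiable_pt_lim (fun x y => f (x, y)) (fst z) (snd z) (fx z) (fy z).
Proof.
intros HV Hf Hz. apply filterdiff_differentiable_pt_lim.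
destruct z as [x y]. simpl fst; simpl snd.
apply (is_derive_filterdiff (fun x y => f (x, y)) x y (fun x y => fx (x, y)) (fy (x, y))).
- generalize (HV _ Hz). apply filter_imp. intros [x' y'] H. apply (Hf _ H).
- apply (Hf _ Hz).
- apply (continuous_ext fx); [now intros [? ?] |]. apply (Hf _ Hz).
Qed.

Lemma C1_on_continuous (V : R * R -> Prop) (f fx fy : R * R -> R) (z : R * R) :
  open V -> C1_on V f fx fy -> V z -> continuous f z.
Proof.
intros HV Hf Hz.
assert (D := C1_on_differentiable V f fx fy z HV Hf Hz). destruct z as [x y].
simpl in D.
assert (C : continuity_2d_pt (fun x y => f (x, y)) x y)
  by (apply differentiable_continuity_pt; eexists; eexists; exact D).
apply continuity_2d_pt_filterlim in C.
apply (continuous_ext (fun z => f (fst z, snd z))); [now intros [? ?] |]. exact C.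
Qed.

Lemma C1_on_derive_comp (V : R * R -> Prop) (f fx fy : R * R -> R) (x y : R -> R)
  (t x' y' : R) :
  open V -> C1_on V f fx fy -> V (x t, y t) ->
  is_derive x t x' -> is_derive y t y' ->
  is_derive (fun u => f (x u, y u)) t (fx (x t, y t) * x' + fy (x t, y t) * y').
Proof.
intros HV Hf Hz Hx Hy. apply is_derive_Reals.
apply (derivable_pt_lim_comp_2d (fun x y => f (x, y)) x y).
- exact (C1_on_differentiable V f fx fy (x t, y t) HV Hf Hz).
- now apply is_derive_Reals.
- now apply is_derive_Reals.
Qed.

Lemma Ck2_C1_on (V : R * R -> Prop) (f : R * R -> R) :
  Ck2 1 V f -> C1_on V f (d1 f) (d2 f).
Proof.
intros (D & C1 & C2) z Hz. destruct (D z Hz) as [A B].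
split; [exact (Derive_correct _ _ A) |]. split; [exact (Derive_correct _ _ B) |].
split; [now apply C1 | now apply C2].
Qed.

Lemma Ck2_lower (k : nat) (V : R * R -> Prop) (f : R * R -> R) :
  open V -> Ck2 (S k) V f -> Ck2 k V f.
Proof.
intros HV. revert f. induction k as [|k IH]; intros f H.
- intros z Hz. exact (C1_on_continuous V f _ _ z HV (Ck2_C1_on V f H) Hz).
- destruct H as (D & H1 & H2). split; [exact D |].
  split; now apply IH.
Qed.

Definition C1 (V : R * R -> Prop) (f : R * R -> R) : Prop :=
  exists fx fy, C1_on V f fx fy.

Lemma C1_const (V : R * R -> Prop) (c : R) : C1 V (fun _ => c).
Proof.
exists (fun _ => 0), (fun _ => 0). intros z Hz.
split; [apply der_const |]. split; [apply der_const |].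
split; apply (continuous_const (V := R_UniformSpace)).
Qed.

Lemma C1_plus (V : R * R -> Prop) (f g : R * R -> R) :
  C1 V f -> C1 V g -> C1 V (fun z => f z + g z).
Proof.
intros (fx & fy & Hf) (gx & gy & Hg).
exists (fun z => fx z + gx z), (fun z => fy z + gy z). intros z Hz.
destruct (Hf z Hz) as (A & B & C & D). destruct (Hg z Hz) as (A' & B' & C' & D').
refine (conj _ (conj _ (conj _ _))).
- now apply (der_plus (fun x => f (x, snd z))).
- now apply (der_plus (fun y => f (fst z, y))).
- now apply cont_plus.
- now apply cont_plus.
Qed.

Lemma C1_opp (V : R * R -> Prop) (f : R * R -> R) : C1 V f -> C1 V (fun z => - f z).
Proof.
intros (fx & fy & Hf). exists (fun z => - fx z), (fun z => - fy z). intros z Hz.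
destruct (Hf z Hz) as (A & B & C & D).
refine (conj _ (conj _ (conj _ _))).
- now apply (der_opp (fun x => f (x, snd z))).
- now apply (der_opp (fun y => f (fst z, y))).
- now apply cont_opp.
- now apply cont_opp.
Qed.

Lemma C1_mult (V : R * R -> Prop) (f g : R * R -> R) :
  open V -> C1 V f -> C1 V g -> C1 V (fun z => f z * g z).
Proof.
intros HV (fx & fy & Hf) (gx & gy & Hg).
exists (fun z => fx z * g z + f z * gx z), (fun z => fy z * g z + f z * gy z).
intros z Hz.
assert (Cf := C1_on_continuous V f fx fy z HV Hf Hz).
assert (Cg := C1_on_continuous V g gx gy z HV Hg Hz).
destruct (Hf z Hz) as (A & B & C & D). destruct (Hg z Hz) as (A' & B' & C' & D').
destruct z as [x y]. simpl in *.
refine (conj _ (conj _ (conj _ _))).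
- exact (der_mult _ _ _ _ _ A A').
- exact (der_mult _ _ _ _ _ B B').
- cont_poly.
- cont_poly.
Qed.

Lemma C1_inv (V : R * R -> Prop) (f : R * R -> R) :
  open V -> (forall z, V z -> f z <> 0) -> C1 V f -> C1 V (fun z => / f z).
Proof.
intros HV Hf0 (fx & fy & Hf).
exists (fun z => - fx z / f z ^ 2), (fun z => - fy z / f z ^ 2). intros z Hz.
assert (Cf := C1_on_continuous V f fx fy z HV Hf Hz).
assert (N := Hf0 z Hz).
destruct (Hf z Hz) as (A & B & C & D). destruct z as [x y]. simpl in *.
assert (Ci : continuous (fun z => / (f z * (f z * 1))) (x, y)).
{ apply cont_inv; [cont_poly |]. rewrite Rmult_1_r. now apply Rmult_integral_contrapositive. }
refine (conj _ (conj _ (conj _ _))).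
- exact (der_inv _ _ _ A N).
- exact (der_inv _ _ _ B N).
- unfold Rdiv; cont_poly.
- unfold Rdiv; cont_poly.
Qed.

(** * Completeness of products, for Picard iteration in the phase space *)

Definition prod_lim {T U : CompleteSpace} (F : (T * U -> Prop) -> Prop) : T * U :=
  (lim (fun P => F (fun z => P (fst z))), lim (fun P => F (fun z => P (snd z)))).

Lemma prod_lim_cauchy {T U : CompleteSpace} (F : (T * U -> Prop) -> Prop) :
  ProperFilter F -> cauchy F -> forall eps : posreal, F (ball (prod_lim F) eps).
Proof.
intros FF HF eps.
apply filter_and.
- apply (complete_cauchy (fun P => F (fun z => P (fst z)))).
  + exact (filtermap_proper_filter _ _ fst F FF).
  + intros e. destruct (HF e) as [x Hx]. exists (fst x).
    generalize Hx. apply filter_imp. now intros z [A _].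
- apply (complete_cauchy (fun P => F (fun z => P (snd z)))).
  + exact (filtermap_proper_filter _ _ snd F FF).
  + intros e. destruct (HF e) as [x Hx]. exists (snd x).
    generalize Hx. apply filter_imp. now intros z [_ A].
Qed.

Lemma prod_lim_close {T U : CompleteSpace} (F1 F2 : (T * U -> Prop) -> Prop) :
  filter_le F1 F2 -> filter_le F2 F1 -> close (prod_lim F1) (prod_lim F2).
Proof.
intros H12 H21 eps. split.
- apply (close_lim (fun P => F1 (fun z => P (fst z))) (fun P => F2 (fun z => P (fst z)))).
  + intros P HP. now apply H12.
  + intros P HP. now apply H21.
- apply (close_lim (fun P => F1 (fun z => P (snd z))) (fun P => F2 (fun z => P (snd z)))).
  + intros P HP. now apply H12.
  + intros P HP. now apply H21.
Qed.

Definition prod_CompleteNormedModule (T U : CompleteNormedModule R_AbsRing) :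
  CompleteNormedModule R_AbsRing :=
  CompleteNormedModule.Pack R_AbsRing (T * U)
    (CompleteNormedModule.Class R_AbsRing (T * U)
      (NormedModule.class R_AbsRing (prod_NormedModule R_AbsRing T U))
      (CompleteSpace.Mixin _ (@prod_lim T U) prod_lim_cauchy prod_lim_close))
    (T * U).

(* Pairs of a position and a velocity. *)
Definition phase : CompleteNormedModule R_AbsRing :=
  prod_CompleteNormedModule
    (prod_CompleteNormedModule R_CompleteNormedModule R_CompleteNormedModule)
    (prod_CompleteNormedModule R_CompleteNormedModule R_CompleteNormedModule).

(** * Flows of second order equations in the plane *)

(** A closed cube in coordinates and not a ball of the product norm, since retracting onto a cube is
    done coordinate by coordinate. *)
Definition box (r : R) (p0 p : phase) : Prop :=
  Rabs (fst (fst p) - fst (fst p0)) <= r /\ Rabs (snd (fst p) - snd (fst p0)) <= r /\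
  Rabs (fst (snd p) - fst (snd p0)) <= r /\ Rabs (snd (snd p) - snd (snd p0)) <= r.

(** The product norm is a nested square root of sums of squares; these comparisons let later
    estimates work with coordinates. *)
Lemma phase_dist (p q : phase) :
  Rabs (fst (fst p) - fst (fst q)) <= dist p q /\
  Rabs (snd (fst p) - snd (fst q)) <= dist p q /\
  Rabs (fst (snd p) - fst (snd q)) <= dist p q /\
  Rabs (snd (snd p) - snd (snd q)) <= dist p q /\
  dist p q <= Rabs (fst (fst p) - fst (fst q)) + Rabs (snd (fst p) - snd (fst q)) +
    (Rabs (fst (snd p) - fst (snd q)) + Rabs (snd (snd p) - snd (snd q))).
Proof.
assert (S : forall u v, Rabs u <= sqrt (Rabs u ^ 2 + Rabs v ^ 2) /\
  Rabs v <= sqrt (Rabs u ^ 2 + Rabs v ^ 2) /\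
  sqrt (Rabs u ^ 2 + Rabs v ^ 2) <= Rabs u + Rabs v).
{ intros u v. assert (Pu := Rabs_pos u). assert (Pv := Rabs_pos v).
  repeat split.
  - rewrite <- (sqrt_pow2 (Rabs u)) at 1 by lra. apply sqrt_le_1_alt. nra.
  - rewrite <- (sqrt_pow2 (Rabs v)) at 1 by lra. apply sqrt_le_1_alt. nra.
  - rewrite <- (sqrt_pow2 (Rabs u + Rabs v)) by lra. apply sqrt_le_1_alt. nra. }
destruct p as [[x y] [a b]], q as [[x' y'] [a' b']]. simpl.
change (dist (((x, y), (a, b)) : phase) (((x', y'), (a', b')) : phase)) with
  (sqrt (sqrt (Rabs (x - x') ^ 2 + Rabs (y - y') ^ 2) ^ 2 +
         sqrt (Rabs (a - a') ^ 2 + Rabs (b - b') ^ 2) ^ 2)).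
destruct (S (x - x') (y - y')) as (A1 & A2 & A3).
destruct (S (a - a') (b - b')) as (B1 & B2 & B3).
set (u := sqrt (Rabs (x - x') ^ 2 + Rabs (y - y') ^ 2)) in *.
set (v := sqrt (Rabs (a - a') ^ 2 + Rabs (b - b') ^ 2)) in *.
assert (Pu : 0 <= u) by apply sqrt_pos. assert (Pv : 0 <= v) by apply sqrt_pos.
destruct (S u v) as (C1 & C2 & C3).
rewrite (Rabs_pos_eq u), (Rabs_pos_eq v) in C1, C2, C3 by assumption.
lra.
Qed.

Lemma box_refl (r : R) (p : phase) : 0 <= r -> box r p p.
Proof. intros H. unfold box. rewrite !Rminus_diag, Rabs_R0. lra. Qed.

Lemma box_weaken (r r' : R) (p0 p : phase) : r <= r' -> box r p0 p -> box r' p0 p.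
Proof. unfold box. intros; lra. Qed.

Lemma box_dist (r : R) (p0 p : phase) : dist p p0 <= r -> box r p0 p.
Proof. intros H. unfold box. generalize (phase_dist p p0). lra. Qed.

Lemma dist_box (r : R) (p0 p : phase) : box r p0 p -> dist p p0 <= 4 * r.
Proof. unfold box. intros H. generalize (phase_dist p p0). lra. Qed.

Definition lip_at (p0 : phase) (f : phase -> R) : Prop :=
  exists r M, 0 < r /\ 0 <= M /\ forall p q, box r p0 p -> box r p0 q ->
    Rabs (f p - f q) <= M * dist p q.

Lemma lip_plus (p0 : phase) (f g : phase -> R) :
  lip_at p0 f -> lip_at p0 g -> lip_at p0 (fun p => f p + g p).
Proof.
intros (r & M & Hr & HM & H) (r' & M' & Hr' & HM' & H').
exists (Rmin r r'), (M + M'). split; [now apply Rmin_glb_lt |]. split; [lra |].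
intros p q Hp Hq.
assert (A := H p q (box_weaken _ _ _ _ (Rmin_l _ _) Hp) (box_weaken _ _ _ _ (Rmin_l _ _) Hq)).
assert (B := H' p q (box_weaken _ _ _ _ (Rmin_r _ _) Hp) (box_weaken _ _ _ _ (Rmin_r _ _) Hq)).
replace (f p + g p - (f q + g q)) with ((f p - f q) + (g p - g q)) by ring.
eapply Rle_trans; [apply Rabs_triang |]. lra.
Qed.

Lemma lip_mult (p0 : phase) (f g : phase -> R) :
  lip_at p0 f -> lip_at p0 g -> lip_at p0 (fun p => f p * g p).
Proof.
intros (r & M & Hr & HM & H) (r' & M' & Hr' & HM' & H').
set (B := Rabs (f p0) + M * (4 * r)). set (B' := Rabs (g p0) + M' * (4 * r')).
assert (HB : 0 <= B) by (apply Rplus_le_le_0_compat; [apply Rabs_pos | apply Rmult_le_pos; lra]).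
assert (HB' : 0 <= B') by (apply Rplus_le_le_0_compat; [apply Rabs_pos | apply Rmult_le_pos; lra]).
exists (Rmin r r'), (B * M' + B' * M). split; [now apply Rmin_glb_lt |].
split; [apply Rplus_le_le_0_compat; now apply Rmult_le_pos |].
intros p q Hp Hq.
assert (Hp1 := box_weaken _ _ _ _ (Rmin_l _ _) Hp).
assert (Hq1 := box_weaken _ _ _ _ (Rmin_l _ _) Hq).
assert (Hp2 := box_weaken _ _ _ _ (Rmin_r _ _) Hp).
assert (Hq2 := box_weaken _ _ _ _ (Rmin_r _ _) Hq).
assert (A1 := H p q Hp1 Hq1). assert (A2 := H' p q Hp2 Hq2).
assert (F : Rabs (f p) <= B).
{ assert (A := H p p0 Hp1 (box_refl _ _ (Rlt_le _ _ Hr))).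
  assert (D := dist_box _ _ _ Hp1).
  replace (f p) with ((f p - f p0) + f p0) by ring.
  eapply Rle_trans; [apply Rabs_triang |]. unfold B.
  assert (M * dist p p0 <= M * (4 * r)) by now apply Rmult_le_compat_l. lra. }
assert (G : Rabs (g q) <= B').
{ assert (A := H' q p0 Hq2 (box_refl _ _ (Rlt_le _ _ Hr'))).
  assert (D := dist_box _ _ _ Hq2).
  replace (g q) with ((g q - g p0) + g p0) by ring.
  eapply Rle_trans; [apply Rabs_triang |]. unfold B'.
  assert (M' * dist q p0 <= M' * (4 * r')) by now apply Rmult_le_compat_l. lra. }
replace (f p * g p - f q * g q) with (f p * (g p - g q) + g q * (f p - f q)) by ring.
eapply Rle_trans; [apply Rabs_triang |]. rewrite !Rabs_mult.
assert (D := dist_ge_0 p q).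
assert (Rabs (f p) * Rabs (g p - g q) <= B * (M' * dist p q))
  by (apply Rmult_le_compat; try apply Rabs_pos; assumption).
assert (Rabs (g q) * Rabs (f p - f q) <= B' * (M * dist p q))
  by (apply Rmult_le_compat; try apply Rabs_pos; assumption).
lra.
Qed.

Lemma lip_opp (p0 : phase) (f : phase -> R) :
  lip_at p0 f -> lip_at p0 (fun p => - f p).
Proof.
intros (r & M & Hr & HM & H). exists r, M. split; [exact Hr |]. split; [exact HM |].
intros p q Hp Hq. replace (- f p - - f q) with (- (f p - f q)) by ring.
rewrite Rabs_Ropp. now apply H.
Qed.

Lemma lip_velocity (p0 : phase) :
  lip_at p0 (fun p => fst (snd p)) /\ lip_at p0 (fun p => snd (snd p)).
Proof.
split; exists 1, 1; repeat split; try lra; intros p q _ _;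
generalize (phase_dist p q); lra.
Qed.

(** Continuity bounds both partial derivatives by M near the point; the increment is then split
    along two sides of a rectangle and the mean value theorem is applied on each. *)
Lemma lip_position (V : R * R -> Prop) (f fx fy : R * R -> R) (p0 : phase) :
  open V -> C1_on V f fx fy -> V (fst p0) -> lip_at p0 (fun p => f (fst p)).
Proof.
intros HV Hf H0. destruct p0 as [[x0 y0] v0]. simpl in H0.
destruct (Hf _ H0) as (_ & _ & Cx & Cy).
destruct (proj1 (filterlim_locally fx (fx (x0, y0))) Cx (mkposreal 1 Rlt_0_1)) as [rx Hx].
destruct (proj1 (filterlim_locally fy (fy (x0, y0))) Cy (mkposreal 1 Rlt_0_1)) as [ry Hy].
destruct (open_planar V _ HV H0) as (rv & Hrv & Hv). simpl in Hv.
set (r := Rmin rv (Rmin rx ry)).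
assert (R1 : r <= rv) by apply Rmin_l.
assert (R2 : r <= rx) by (eapply Rle_trans; [apply Rmin_r | apply Rmin_l]).
assert (R3 : r <= ry) by (eapply Rle_trans; [apply Rmin_r | apply Rmin_r]).
assert (Hr : 0 < r).
{ unfold r. repeat apply Rmin_glb_lt; [exact Hrv | apply cond_pos | apply cond_pos]. }
set (M := Rabs (fx (x0, y0)) + Rabs (fy (x0, y0)) + 1).
assert (HM : 0 <= M).
{ unfold M. generalize (Rabs_pos (fx (x0, y0))) (Rabs_pos (fy (x0, y0))). lra. }
assert (I : forall x y, Rabs (x - x0) < r -> Rabs (y - y0) < r ->
  V (x, y) /\ Rabs (fx (x, y)) <= M /\ Rabs (fy (x, y)) <= M).
{ intros x y Ax Ay. split; [apply Hv; lra |].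
  assert (Bx : ball (x0, y0) rx (x, y)).
  { split; [change (Rabs (x - x0) < rx) | change (Rabs (y - y0) < rx)]; lra. }
  assert (By : ball (x0, y0) ry (x, y)).
  { split; [change (Rabs (x - x0) < ry) | change (Rabs (y - y0) < ry)]; lra. }
  specialize (Hx _ Bx). specialize (Hy _ By).
  change (Rabs (fx (x, y) - fx (x0, y0)) < 1) in Hx.
  change (Rabs (fy (x, y) - fy (x0, y0)) < 1) in Hy.
  assert (Tx := Rabs_triang_inv (fx (x, y)) (fx (x0, y0))).
  assert (Ty := Rabs_triang_inv (fy (x, y)) (fy (x0, y0))).
  assert (Px := Rabs_pos (fx (x0, y0))). assert (Py := Rabs_pos (fy (x0, y0))).
  unfold M. lra. }
exists (r / 2), (2 * M). split; [lra |]. split; [lra |].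
intros [[x y] v] [[x' y'] v'] (Ax & Ay & _) (Ax' & Ay' & _). simpl in *.
assert (D1 : Rabs (f (x, y) - f (x', y)) <= M * Rabs (x - x')).
{ destruct (MVT_gen (fun t => f (t, y)) x' x (fun t => fx (t, y))) as [c [Hc E]].
  - intros t Ht. apply (Hf (t, y)). apply I; [| lra].
    apply Rabs_def1; apply Rabs_le_between in Ax, Ax';
    unfold Rmin, Rmax in Ht; destruct (Rle_dec x' x); lra.
  - intros t Ht. apply continuity_pt_filterlim.
    apply (ex_derive_continuous (fun t => f (t, y))). exists (fx (t, y)).
    apply (Hf (t, y)). apply I; [| lra].
    apply Rabs_def1; apply Rabs_le_between in Ax, Ax';
    unfold Rmin, Rmax in Ht; destruct (Rle_dec x' x); lra.
  - rewrite E, Rabs_mult. apply Rmult_le_compat_r; [apply Rabs_pos |].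
    apply I; [| lra].
    apply Rabs_def1; apply Rabs_le_between in Ax, Ax';
    unfold Rmin, Rmax in Hc; destruct (Rle_dec x' x); lra. }
assert (D2 : Rabs (f (x', y) - f (x', y')) <= M * Rabs (y - y')).
{ destruct (MVT_gen (fun t => f (x', t)) y' y (fun t => fy (x', t))) as [c [Hc E]].
  - intros t Ht. apply (Hf (x', t)). apply I; [lra |].
    apply Rabs_def1; apply Rabs_le_between in Ay, Ay';
    unfold Rmin, Rmax in Ht; destruct (Rle_dec y' y); lra.
  - intros t Ht. apply continuity_pt_filterlim.
    apply (ex_derive_continuous (fun t => f (x', t))). exists (fy (x', t)).
    apply (Hf (x', t)). apply I; [lra |].
    apply Rabs_def1; apply Rabs_le_between in Ay, Ay';
    unfold Rmin, Rmax in Ht; destruct (Rle_dec y' y); lra.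
  - rewrite E, Rabs_mult. apply Rmult_le_compat_r; [apply Rabs_pos |].
    apply I; [lra |].
    apply Rabs_def1; apply Rabs_le_between in Ay, Ay';
    unfold Rmin, Rmax in Hc; destruct (Rle_dec y' y); lra. }
destruct (phase_dist (((x, y), v) : phase) (((x', y'), v') : phase)) as (E1 & E2 & _). simpl in E1, E2.
replace (f (x, y) - f (x', y')) with
  ((f (x, y) - f (x', y)) + (f (x', y) - f (x', y'))) by ring.
eapply Rle_trans; [apply Rabs_triang |].
assert (M * Rabs (x - x') <= M * dist (((x, y), v) : phase) (((x', y'), v') : phase))
  by now apply Rmult_le_compat_l.
assert (M * Rabs (y - y') <= M * dist (((x, y), v) : phase) (((x', y'), v') : phase))
  by now apply Rmult_le_compat_l.
lra.
Qed.

(* Retraction onto a box, making a locally Lipschitz vector field globally Lipschitz. *)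
Definition clamp_box (r : R) (p0 p : phase) : phase :=
  ((clamp (fst (fst p0) - r) (fst (fst p0) + r) (fst (fst p)),
    clamp (snd (fst p0) - r) (snd (fst p0) + r) (snd (fst p))),
   (clamp (fst (snd p0) - r) (fst (snd p0) + r) (fst (snd p)),
    clamp (snd (snd p0) - r) (snd (snd p0) + r) (snd (snd p)))).

Lemma clamp_box_range (r : R) (p0 p : phase) : 0 <= r -> box r p0 (clamp_box r p0 p).
Proof.
intros Hr. destruct p0 as [[x0 y0] [a0 b0]], p as [[x y] [a b]].
unfold box, clamp_box; simpl. repeat split; apply Rabs_le.
all: match goal with |- context [clamp ?a ?b ?x] =>
  assert (Q := clamp_range a b x ltac:(lra)) end.
- lra.
- lra.
- lra.
- lra.
Qed.

Lemma clamp_box_id (r : R) (p0 p : phase) : box r p0 p -> clamp_box r p0 p = p.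
Proof.
destruct p as [[x y] [a b]]. unfold box, clamp_box; simpl.
intros (A & B & C & D). apply Rabs_le_between in A, B, C, D.
rewrite !clamp_id by lra. reflexivity.
Qed.

Lemma clamp_box_lip (r : R) (p0 p q : phase) :
  dist (clamp_box r p0 p) (clamp_box r p0 q) <= 4 * dist p q.
Proof.
destruct p0 as [[x0 y0] [a0 b0]], p as [[x y] [a b]], q as [[x' y'] [a' b']].
set (p0 := (((x0, y0), (a0, b0)) : phase)). set (p := (((x, y), (a, b)) : phase)).
set (q := (((x', y'), (a', b')) : phase)).
change (dist (clamp_box r p0 p) (clamp_box r p0 q) <= 4 * dist p q).
destruct (phase_dist p q) as (A & B & C & D & _). simpl in A, B, C, D.
destruct (phase_dist (clamp_box r p0 p) (clamp_box r p0 q)) as (_ & _ & _ & _ & E).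
eapply Rle_trans; [exact E |]. generalize dependent (dist p q). intros m A B C D.
unfold clamp_box; simpl.
assert (H1 := clamp_lip (x0 - r) (x0 + r) x x').
assert (H2 := clamp_lip (y0 - r) (y0 + r) y y').
assert (H3 := clamp_lip (a0 - r) (a0 + r) a a').
assert (H4 := clamp_lip (b0 - r) (b0 + r) b b').
lra.
Qed.

Lemma der_fst {U V : NormedModule R_AbsRing} (f : R -> U * V) (t : R) (l : U * V) :
  is_derive f t l -> is_derive (fun u => fst (f u)) t (fst l).
Proof.
intros H.
exact (filterdiff_comp' f fst t _ _ H
  (filterdiff_linear (F := locally (f t)) _ (is_linear_fst (U := U) (V := V)))).
Qed.

Lemma der_snd {U V : NormedModule R_AbsRing} (f : R -> U * V) (t : R) (l : U * V) :
  is_derive f t l -> is_derive (fun u => snd (f u)) t (snd l).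
Proof.
intros H.
exact (filterdiff_comp' f snd t _ _ H
  (filterdiff_linear (F := locally (f t)) _ (is_linear_snd (U := U) (V := V)))).
Qed.

(** Composed with [clamp_box] the field is globally Lipschitz and has a flow on the whole phase
    space. While an orbit stays in the box the retraction is the identity, so the orbit solves the
    original equation. *)
Theorem local_flow (G1 G2 : phase -> R) (p0 : phase) (r0 : R) :
  lip_at p0 G1 -> lip_at p0 G2 -> 0 < r0 ->
  exists (h r : R) (phi : phase -> R -> phase), 0 < h /\ 0 < r /\
    (forall p, phi p 0 = p) /\
    (forall p q t, dist (phi p t) (phi q t) <= 2 * dist p q) /\
    (forall p, box r p0 p -> forall t, - h < t < h ->
      box r0 p0 (phi p t) /\
      is_derive (fun u => fst (fst (phi p u))) t (fst (snd (phi p t))) /\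
      is_derive (fun u => snd (fst (phi p u))) t (snd (snd (phi p t))) /\
      is_derive (fun u => fst (snd (phi p u))) t (G1 (phi p t)) /\
      is_derive (fun u => snd (snd (phi p u))) t (G2 (phi p t)) /\
      continuous (phi p) t).
Proof.
intros (r1 & M1 & Hr1 & HM1 & H1) (r2 & M2 & Hr2 & HM2 & H2) Hr0.
set (r := Rmin r0 (Rmin r1 r2)).
assert (Q0 : r <= r0) by apply Rmin_l.
assert (Q1 : r <= r1) by (eapply Rle_trans; [apply Rmin_r | apply Rmin_l]).
assert (Q2 : r <= r2) by (eapply Rle_trans; [apply Rmin_r | apply Rmin_r]).
assert (Hr : 0 < r) by (unfold r; repeat apply Rmin_glb_lt; assumption).
clearbody r.
set (f := fun p : phase => let c := clamp_box r p0 p in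
  (snd c, (G1 c, G2 c)) : phase).
(* The 2 counts the two velocity components, and 4 is the Lipschitz constant of [clamp_box]. *)
set (K := (2 + M1 + M2) * 4).
assert (f_lip : forall p q, dist (f p) (f q) <= K * dist p q).
{ intros p q. unfold f, K.
  assert (L := clamp_box_lip r p0 p q).
  assert (Bp := clamp_box_range r p0 p ltac:(lra)).
  assert (Bq := clamp_box_range r p0 q ltac:(lra)).
  set (p' := clamp_box r p0 p) in *. set (q' := clamp_box r p0 q) in *.
  assert (A1 := H1 p' q' (box_weaken _ _ _ _ Q1 Bp) (box_weaken _ _ _ _ Q1 Bq)).
  assert (A2 := H2 p' q' (box_weaken _ _ _ _ Q2 Bp) (box_weaken _ _ _ _ Q2 Bq)).
  destruct (phase_dist p' q') as (_ & _ & C & D & _).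
  destruct (phase_dist ((snd p', (G1 p', G2 p')) : phase) ((snd q', (G1 q', G2 q')) : phase))
    as (_ & _ & _ & _ & E). simpl in E.
  eapply Rle_trans; [exact E |].
  apply Rle_trans with ((2 + M1 + M2) * dist p' q').
  { eapply Rle_trans;
      [exact (Rplus_le_compat _ _ _ _ (Rplus_le_compat _ _ _ _ C D)
                (Rplus_le_compat _ _ _ _ A1 A2)) |].
    right; ring. }
  rewrite Rmult_assoc. apply Rmult_le_compat_l; lra. }
assert (HK : 0 < K) by (unfold K; lra).
destruct (lipschitz_flow f K (1 / 2 / K)) as (phi & P0 & PD & PL).
- apply Rdiv_lt_0_compat; lra.
- lra.
- right. field. lra.
- exact f_lip.
- assert (Hh : 0 < 1 / 2 / K) by (apply Rdiv_lt_0_compat; lra).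
  assert (PC : forall p t, - (1 / 2 / K) < t < 1 / 2 / K -> continuous (phi p) t).
  { intros p t Ht. apply (ex_derive_continuous (phi p)).
    exists (f (phi p t)). now apply PD. }
  assert (Hr4 : 0 < r / 4) by lra.
  assert (C0 := PC p0 0 ltac:(lra)).
  destruct (proj1 (continuous_dist (phi p0) 0) C0 (mkposreal _ Hr4)) as [h Hh0].
  (* A point of the box of radius r / 16 is within r / 4 of p0. The flow at most doubles this to r /
     2, and p0 itself moves by less than r / 4 up to time h. *)
  exists (Rmin h (1 / 2 / K)), (r / 16), phi.
  split; [apply Rmin_glb_lt; [apply cond_pos | exact Hh] |].
  split; [lra |]. split; [exact P0 |]. split; [exact PL |].
  intros p Hp t Ht.
  assert (Th : - h < t < h) by (generalize (Rmin_l h (1 / 2 / K)); lra).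
  assert (TK : - (1 / 2 / K) < t < 1 / 2 / K)
    by (generalize (Rmin_r h (1 / 2 / K)); lra).
  assert (Bt : ball 0 h t).
  { change (Rabs (t - 0) < h). rewrite Rminus_0_r. apply Rabs_def1; lra. }
  specialize (Hh0 t Bt). simpl in Hh0. rewrite P0 in Hh0.
  assert (Dp := dist_box _ _ _ Hp).
  assert (T := dist_triangle (phi p0 t) (phi p t) p0).
  assert (T' := PL p p0 t).
  assert (B : box r p0 (phi p t)) by (apply box_dist; lra).
  assert (D := PD p t TK). unfold f in D. rewrite (clamp_box_id _ _ _ B) in D.
  split; [exact (box_weaken _ _ _ _ Q0 B) |].
  assert (D1 := der_fst (phi p) t _ D). assert (D2 := der_snd (phi p) t _ D).
  split; [exact (der_fst (fun u => fst (phi p u)) t _ D1) |].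
  split; [exact (der_snd (fun u => fst (phi p u)) t _ D1) |].
  split; [exact (der_fst (fun u => snd (phi p u)) t _ D2) |].
  split; [exact (der_snd (fun u => snd (phi p u)) t _ D2) |].
  now apply PC.
Qed.

Lemma der_shift (f : R -> R) (s d l : R) :
  is_derive f (s + d) l -> is_derive (fun u => f (s + u)) d l.
Proof.
intros H. apply (der_eq _ _ (1 * l)); [| ring].
apply (is_derive_comp f (fun u => s + u)); [exact H |].
apply (der_eq _ _ (0 + 1)); [| ring].
apply der_plus; [apply der_const | exact (is_derive_id (K := R_AbsRing) d)].
Qed.

(* A component of the Christoffel term, with coefficients [P], [Q], [N]; [bil] is the
   bilinear form polarizing it. *)
Definition chr (P Q N : R * R -> R) (p : phase) : R :=
  P (fst p) * (fst (snd p) * fst (snd p)) + Q (fst p) * (fst (snd p) * snd (snd p))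
  + N (fst p) * (snd (snd p) * snd (snd p)).

Definition bil (P Q N : R) (a b c d : R) : R :=
  P * (a * c) + Q / 2 * (a * d + b * c) + N * (b * d).

(** * Derivative and continuity of the Christoffel terms *)

Section Chr.

Variables (V : R * R -> Prop) (P Px Py Q Qx Qy N Nx Ny : R * R -> R).
Hypothesis V_open : open V.
Hypothesis HP : C1_on V P Px Py.
Hypothesis HQ : C1_on V Q Qx Qy.
Hypothesis HN : C1_on V N Nx Ny.

(* The derivative of [chr] along a curve with velocity [snd p] and acceleration [(a', b')]. *)
Definition dchr (p : phase) (a' b' : R) : R :=
  let z := fst p in let a := fst (snd p) in let b := snd (snd p) in
  (Px z * a + Py z * b) * (a * a) + (Qx z * a + Qy z * b) * (a * b)
  + (Nx z * a + Ny z * b) * (b * b)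
  + 2 * bil (P z) (Q z) (N z) a b a' b'.

Lemma der_chr (x y a b : R -> R) (t a' b' : R) :
  V (x t, y t) ->
  is_derive x t (a t) -> is_derive y t (b t) -> is_derive a t a' -> is_derive b t b' ->
  is_derive (fun u => chr P Q N ((x u, y u), (a u, b u))) t
    (dchr ((x t, y t), (a t, b t)) a' b').
Proof.
intros Hz Hx Hy Ha Hb. unfold chr. simpl.
assert (DP := C1_on_derive_comp V P Px Py x y t _ _ V_open HP Hz Hx Hy).
assert (DQ := C1_on_derive_comp V Q Qx Qy x y t _ _ V_open HQ Hz Hx Hy).
assert (DN := C1_on_derive_comp V N Nx Ny x y t _ _ V_open HN Hz Hx Hy).
derive_poly. unfold dchr, bil; simpl. field.
Qed.

Lemma lip_chr (p0 : phase) : V (fst p0) -> lip_at p0 (chr P Q N).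
Proof.
intros H0. destruct (lip_velocity p0) as [La Lb].
unfold chr. repeat apply lip_plus; repeat apply lip_mult; try assumption;
eapply lip_position; eassumption.
Qed.

Lemma cont_coefficient (f fx fy : R * R -> R) (p0 : phase) :
  C1_on V f fx fy -> V (fst p0) ->
  continuous (fun p : phase => f (fst p)) p0 /\
  continuous (fun p : phase => fx (fst p)) p0 /\
  continuous (fun p : phase => fy (fst p)) p0.
Proof.
intros Hf H0. destruct (Hf _ H0) as (_ & _ & Cx & Cy).
assert (Cf := C1_on_continuous V f fx fy _ V_open Hf H0).
destruct p0 as [z v].
assert (F : continuous (fst : phase -> _) (z, v)).
{ exact (continuous_fst (U := prod_UniformSpace R_UniformSpace R_UniformSpace)
    (V := prod_UniformSpace R_UniformSpace R_UniformSpace) z v). }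
split; [exact (continuous_comp (fst : phase -> _) f _ F Cf) |].
split; [exact (continuous_comp (fst : phase -> _) fx _ F Cx) |].
exact (continuous_comp (fst : phase -> _) fy _ F Cy).
Qed.

Lemma cont_velocity (p0 : phase) :
  continuous (fun p : phase => fst (snd p)) p0 /\
  continuous (fun p : phase => snd (snd p)) p0.
Proof.
destruct p0 as [z [a b]].
assert (F : continuous (snd : phase -> _) (z, (a, b))).
{ exact (continuous_snd (U := prod_UniformSpace R_UniformSpace R_UniformSpace)
    (V := prod_UniformSpace R_UniformSpace R_UniformSpace) z (a, b)). }
split.
- exact (continuous_comp (snd : phase -> _) fst _ F (continuous_fst a b)).
- exact (continuous_comp (snd : phase -> _) snd _ F (continuous_snd a b)).
Qed.

Lemma cont_chr (p0 : phase) : V (fst p0) -> continuous (chr P Q N) p0.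
Proof.
intros H0. destruct (cont_velocity p0) as [Ca Cb].
destruct (cont_coefficient _ _ _ p0 HP H0) as (C1 & _).
destruct (cont_coefficient _ _ _ p0 HQ H0) as (C2 & _).
destruct (cont_coefficient _ _ _ p0 HN H0) as (C3 & _).
unfold chr. cont_poly.
Qed.

Lemma cont_dchr (p0 : phase) (a' b' : phase -> R) :
  V (fst p0) -> continuous a' p0 -> continuous b' p0 ->
  continuous (fun p => dchr p (a' p) (b' p)) p0.
Proof.
intros H0 Ha Hb. destruct (cont_velocity p0) as [Ca Cb].
destruct (cont_coefficient _ _ _ p0 HP H0) as (C1 & C1x & C1y).
destruct (cont_coefficient _ _ _ p0 HQ H0) as (C2 & C2x & C2y).
destruct (cont_coefficient _ _ _ p0 HN H0) as (C3 & C3x & C3y).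
unfold dchr, bil, Rdiv. cont_poly.
Qed.

End Chr.

(** * Geodesics tangent to a curve *)

Lemma chr_eta (P Q N : R * R -> R) (p : phase) :
  chr P Q N ((fst (fst p), snd (fst p)), (fst (snd p), snd (snd p))) = chr P Q N p.
Proof. now destruct p as [[x y] [a b]]. Qed.

Lemma dchr_eta (P Px Py Q Qx Qy N Nx Ny : R * R -> R) (p : phase) (a' b' : R) :
  dchr P Px Py Q Qx Qy N Nx Ny
    ((fst (fst p), snd (fst p)), (fst (snd p), snd (snd p))) a' b' =
  dchr P Px Py Q Qx Qy N Nx Ny p a' b'.
Proof. now destruct p as [[x y] [a b]]. Qed.

Section PlanarMetric.

Variables (V : R * R -> Prop).
Variables (E Ex Ey F Fx Fy G Gx Gy : R * R -> R).
Variables (P1 P1x P1y Q1 Q1x Q1y N1 N1x N1y : R * R -> R).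
Variables (P2 P2x P2y Q2 Q2x Q2y N2 N2x N2y : R * R -> R).
Hypothesis V_open : open V.
Hypothesis HE : C1_on V E Ex Ey.
Hypothesis HF : C1_on V F Fx Fy.
Hypothesis HG : C1_on V G Gx Gy.
Hypothesis HP1 : C1_on V P1 P1x P1y.
Hypothesis HQ1 : C1_on V Q1 Q1x Q1y.
Hypothesis HN1 : C1_on V N1 N1x N1y.
Hypothesis HP2 : C1_on V P2 P2x P2y.
Hypothesis HQ2 : C1_on V Q2 Q2x Q2y.
Hypothesis HN2 : C1_on V N2 N2x N2y.

Definition gm (z : R * R) (a b c d : R) : R :=
  E z * (a * c) + F z * (a * d + b * c) + G z * (b * d).

(* The derivative of the metric in the direction [(a, b)], applied to [(a, b)] and [(c, d)]. *)
Definition dgm (z : R * R) (a b c d : R) : R :=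
  (Ex z * a + Ey z * b) * (a * c) + (Fx z * a + Fy z * b) * (a * d + b * c)
  + (Gx z * a + Gy z * b) * (b * d).

Let G1 := chr P1 Q1 N1.
Let G2 := chr P2 Q2 N2.
Let B1 (z : R * R) := bil (P1 z) (Q1 z) (N1 z).
Let B2 (z : R * R) := bil (P2 z) (Q2 z) (N2 z).
Let D1 := dchr P1 P1x P1y Q1 Q1x Q1y N1 N1x N1y.
Let D2 := dchr P2 P2x P2y Q2 Q2x Q2y N2 N2x N2y.

(** The parallelism of the metric, in the case where the direction of differentiation is also the
    first argument. It is the only link in this section between the coefficients of the equation and
    the metric. *)
Hypothesis compat : forall z a b c d, V z ->
  dgm z a b c d = gm z (G1 (z, (a, b))) (G2 (z, (a, b))) c d
                  + gm z a b (B1 z a b c d) (B2 z a b c d).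

(** The product rule for <velocity, W> along a curve: each ordinary derivative is completed to a
    covariant one by its Christoffel term. *)
Lemma der_gm (x y a b c d : R -> R) (t a' b' c' d' : R) :
  V (x t, y t) -> is_derive x t (a t) -> is_derive y t (b t) ->
  is_derive a t a' -> is_derive b t b' -> is_derive c t c' -> is_derive d t d' ->
  is_derive (fun u => gm (x u, y u) (a u) (b u) (c u) (d u)) t
    (gm (x t, y t) (a' + G1 ((x t, y t), (a t, b t))) (b' + G2 ((x t, y t), (a t, b t)))
        (c t) (d t)
     + gm (x t, y t) (a t) (b t) (c' + B1 (x t, y t) (a t) (b t) (c t) (d t))
        (d' + B2 (x t, y t) (a t) (b t) (c t) (d t))).
Proof.
intros Hz Hx Hy Ha Hb Hc Hd.
assert (DE := C1_on_derive_comp V E Ex Ey x y t _ _ V_open HE Hz Hx Hy).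
assert (DF := C1_on_derive_comp V F Fx Fy x y t _ _ V_open HF Hz Hx Hy).
assert (DG := C1_on_derive_comp V G Gx Gy x y t _ _ V_open HG Hz Hx Hy).
assert (M := compat (x t, y t) (a t) (b t) (c t) (d t) Hz).
unfold gm in *. unfold dgm in M.
set (g1 := G1 _) in *. set (g2 := G2 _) in *. set (b1 := B1 _ _ _ _ _) in *.
set (b2 := B2 _ _ _ _ _) in *. clearbody g1 g2 b1 b2.
derive_poly. lra.
Qed.

Variables (cx cx1 cx2 cx3 cy cy1 cy2 cy3 : R -> R) (sb e : R).
Hypothesis e_pos : 0 < e.

Let pt (s : R) : phase := ((cx s, cy s), (cx1 s, cy1 s)).
(* The covariant acceleration of the curve, and its squared norm. *)
Let k1 (s : R) := cx2 s + G1 (pt s).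
Let k2 (s : R) := cy2 s + G2 (pt s).
Let K (s : R) := gm (fst (pt s)) (k1 s) (k2 s) (k1 s) (k2 s).

Hypothesis curve : forall s, Rabs (s - sb) < e ->
  V (fst (pt s)) /\
  is_derive cx s (cx1 s) /\ is_derive cx1 s (cx2 s) /\ is_derive cx2 s (cx3 s) /\
  is_derive cy s (cy1 s) /\ is_derive cy1 s (cy2 s) /\ is_derive cy2 s (cy3 s) /\
  gm (fst (pt s)) (cx1 s) (cy1 s) (cx1 s) (cy1 s) = 1 /\ 0 < K s.

Lemma locally_near (s : R) : Rabs (s - sb) < e -> locally s (fun u => Rabs (u - sb) < e).
Proof.
intros H. assert (He : 0 < e - Rabs (s - sb)) by lra.
exists (mkposreal _ He). intros u Hu. change (Rabs (u - s) < e - Rabs (s - sb)) in Hu.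
replace (u - sb) with ((u - s) + (s - sb)) by ring.
eapply Rle_lt_trans; [apply Rabs_triang |]. lra.
Qed.

(** Obtained by differentiating <T, T> = 1. *)
Lemma curvature_orthogonal (s : R) : Rabs (s - sb) < e ->
  gm (fst (pt s)) (cx1 s) (cy1 s) (k1 s) (k2 s) = 0.
Proof.
intros Hs. destruct (curve s Hs) as (A & B & C & _ & B' & C' & _).
assert (D := der_gm cx cy cx1 cy1 cx1 cy1 s _ _ _ _ A B B' C C' C C').
assert (D0 : is_derive (fun u => gm (cx u, cy u) (cx1 u) (cy1 u) (cx1 u) (cy1 u)) s 0).
{ apply (is_derive_ext_loc (fun _ => 1)); [| apply der_const].
  generalize (locally_near s Hs). apply filter_imp. intros u Hu.
  symmetry. apply (curve u Hu). }
assert (U := is_derive_unique _ _ _ D). rewrite (is_derive_unique _ _ _ D0) in U.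
assert (S1 : B1 (cx s, cy s) (cx1 s) (cy1 s) (cx1 s) (cy1 s) = G1 (pt s)).
{ unfold B1, G1, bil, chr, pt; simpl. field. }
assert (S2 : B2 (cx s, cy s) (cx1 s) (cy1 s) (cx1 s) (cy1 s) = G2 (pt s)).
{ unfold B2, G2, bil, chr, pt; simpl. field. }
rewrite S1, S2 in U. unfold k1, k2, gm in *. simpl fst in *.
change ((cx s, cy s), (cx1 s, cy1 s)) with (pt s) in U. lra.
Qed.

(** Differentiating <T, k> = 0 gives <T, Dk> = - K. The Christoffel part of Dk is moved to the
    right, leaving on the left the ordinary derivative of k, which is what the jets contain. *)
Lemma curvature_derivative (s : R) : Rabs (s - sb) < e ->
  let z := fst (pt s) in
  gm z (cx1 s) (cy1 s) (cx3 s + D1 (pt s) (cx2 s) (cy2 s)) (cy3 s + D2 (pt s) (cx2 s) (cy2 s))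
  = - K s - gm z (cx1 s) (cy1 s) (B1 z (cx1 s) (cy1 s) (k1 s) (k2 s))
                                 (B2 z (cx1 s) (cy1 s) (k1 s) (k2 s)).
Proof.
intros Hs z. destruct (curve s Hs) as (A & B & C & C3 & B' & C' & C3' & _).
assert (DG1 := der_chr V P1 P1x P1y Q1 Q1x Q1y N1 N1x N1y V_open HP1 HQ1 HN1
  cx cy cx1 cy1 s _ _ A B B' C C').
assert (DG2 := der_chr V P2 P2x P2y Q2 Q2x Q2y N2 N2x N2y V_open HP2 HQ2 HN2
  cx cy cx1 cy1 s _ _ A B B' C C').
assert (Dk1 : is_derive k1 s (cx3 s + D1 (pt s) (cx2 s) (cy2 s)))
  by exact (der_plus _ _ _ _ _ C3 DG1).
assert (Dk2 : is_derive k2 s (cy3 s + D2 (pt s) (cx2 s) (cy2 s)))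
  by exact (der_plus _ _ _ _ _ C3' DG2).
assert (D := der_gm cx cy cx1 cy1 k1 k2 s _ _ _ _ A B B' C C' Dk1 Dk2).
assert (D0 : is_derive (fun u => gm (cx u, cy u) (cx1 u) (cy1 u) (k1 u) (k2 u)) s 0).
{ apply (is_derive_ext_loc (fun _ => 0)); [| apply der_const].
  generalize (locally_near s Hs). apply filter_imp. intros u Hu.
  symmetry. exact (curvature_orthogonal u Hu). }
assert (U := is_derive_unique _ _ _ D). rewrite (is_derive_unique _ _ _ D0) in U.
change ((cx s, cy s), (cx1 s, cy1 s)) with (pt s) in U.
change (cx2 s + G1 (pt s)) with (k1 s) in U. change (cy2 s + G2 (pt s)) with (k2 s) in U.
change (cx s, cy s) with z in U. unfold K. fold z. unfold gm in *. lra.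
Qed.

(** Thanks to this the parameters u and v on the tangent geodesics are signed lengths. *)
Lemma geodesic_unit_speed (x y a b : R -> R) (h : R) :
  (forall t, - h < t < h -> V (x t, y t) /\ is_derive x t (a t) /\ is_derive y t (b t) /\
     is_derive a t (- G1 ((x t, y t), (a t, b t))) /\
     is_derive b t (- G2 ((x t, y t), (a t, b t)))) ->
  gm (x 0, y 0) (a 0) (b 0) (a 0) (b 0) = 1 ->
  forall t, - h < t < h -> gm (x t, y t) (a t) (b t) (a t) (b t) = 1.
Proof.
intros H H0 t Ht.
assert (D : forall u, - h < u < h ->
  is_derive (fun u => gm (x u, y u) (a u) (b u) (a u) (b u)) u 0).
{ intros u Hu. destruct (H u Hu) as (A & Hx & Hy & Ha & Hb).
  eapply der_eq; [exact (der_gm x y a b a b u _ _ _ _ A Hx Hy Ha Hb Ha Hb) |].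
  assert (S1 : B1 (x u, y u) (a u) (b u) (a u) (b u) = G1 ((x u, y u), (a u, b u))).
  { unfold B1, G1, bil, chr; simpl. field. }
  assert (S2 : B2 (x u, y u) (a u) (b u) (a u) (b u) = G2 ((x u, y u), (a u, b u))).
  { unfold B2, G2, bil, chr; simpl. field. }
  rewrite S1, S2. unfold gm. ring. }
destruct (MVT_cor4 (fun u => gm (x u, y u) (a u) (b u) (a u) (b u)) (fun _ => 0) 0 (Rabs t))
  with (b := t) as [c [Hc _]].
- intros c Hc. apply D. rewrite Rminus_0_r in Hc.
  assert (Rabs t < h) by (apply Rabs_def1; lra).
  assert (Hc' : Rabs c < h) by lra. apply Rabs_def2 in Hc'. lra.
- rewrite Rminus_0_r. apply Rle_refl.
- lra.
Qed.

Lemma pt_continuous (s : R) : Rabs (s - sb) < e ->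
  forall eps, 0 < eps -> exists r, 0 < r /\
    forall u, Rabs (u - s) < r -> dist (pt u) (pt s) < eps.
Proof.
intros Hs eps Heps. destruct (curve s Hs) as (_ & A & B & _ & A' & B' & _).
assert (Q : 0 < eps / 4) by lra.
assert (C : forall f l, is_derive f s l -> exists r, 0 < r /\
  forall y, Rabs (y - s) < r -> Rabs (f y - f s) < eps / 4).
{ intros f l Hf. apply (proj1 (continuous_eps f s)); [| exact Q].
  apply (ex_derive_continuous f). now exists l. }
destruct (C _ _ A) as [r1 [Hr1 C1]]. destruct (C _ _ A') as [r2 [Hr2 C2]].
destruct (C _ _ B) as [r3 [Hr3 C3]]. destruct (C _ _ B') as [r4 [Hr4 C4]].
exists (Rmin (Rmin r1 r2) (Rmin r3 r4)). split; [repeat apply Rmin_glb_lt; assumption |].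
intros u Hu.
assert (U1 := Rlt_le_trans _ _ _ Hu (Rmin_l _ _)).
assert (U2 := Rlt_le_trans _ _ _ Hu (Rmin_r _ _)).
specialize (C1 u (Rlt_le_trans _ _ _ U1 (Rmin_l _ _))).
specialize (C2 u (Rlt_le_trans _ _ _ U1 (Rmin_r _ _))).
specialize (C3 u (Rlt_le_trans _ _ _ U2 (Rmin_l _ _))).
specialize (C4 u (Rlt_le_trans _ _ _ U2 (Rmin_r _ _))).
destruct (phase_dist (pt u) (pt s)) as (_ & _ & _ & _ & D).
eapply Rle_lt_trans; [exact D |]. simpl. lra.
Qed.

Lemma tangent_geodesics_exist :
  exists (phi : phase -> R -> phase) (h e1 : R), 0 < h /\ 0 < e1 <= e /\
    (forall p, phi p 0 = p) /\
    (forall p q t, dist (phi p t) (phi q t) <= 2 * dist p q) /\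
    (forall s, Rabs (s - sb) < e1 -> forall t, - h < t < h ->
      V (fst (phi (pt s) t)) /\
      is_derive (fun u => fst (fst (phi (pt s) u))) t (fst (snd (phi (pt s) t))) /\
      is_derive (fun u => snd (fst (phi (pt s) u))) t (snd (snd (phi (pt s) t))) /\
      is_derive (fun u => fst (snd (phi (pt s) u))) t (- G1 (phi (pt s) t)) /\
      is_derive (fun u => snd (snd (phi (pt s) u))) t (- G2 (phi (pt s) t)) /\
      continuous (phi (pt s)) t).
Proof.
assert (Hsb : Rabs (sb - sb) < e) by (rewrite Rminus_diag, Rabs_R0; exact e_pos).
destruct (curve sb Hsb) as (A & _).
destruct (open_planar V _ V_open A) as (rv & Hrv & HV).
destruct (local_flow (fun p => - G1 p) (fun p => - G2 p) (pt sb) (rv / 2))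
  as (h & r & phi & Hh & Hr & P0 & PL & PF).
- apply lip_opp. exact (lip_chr V P1 P1x P1y Q1 Q1x Q1y N1 N1x N1y V_open HP1 HQ1 HN1 _ A).
- apply lip_opp. exact (lip_chr V P2 P2x P2y Q2 Q2x Q2y N2 N2x N2y V_open HP2 HQ2 HN2 _ A).
- lra.
- destruct (pt_continuous sb Hsb r Hr) as [r1 [Hr1 H1]].
  exists phi, h, (Rmin r1 e). split; [exact Hh |].
  split; [split; [now apply Rmin_glb_lt | apply Rmin_r] |].
  split; [exact P0 |]. split; [exact PL |].
  intros s Hs t Ht.
  assert (Hs1 := Rlt_le_trans _ _ _ Hs (Rmin_l _ _)).
  assert (B : box r (pt sb) (pt s)) by (apply box_dist, Rlt_le, H1; exact Hs1).
  destruct (PF (pt s) B t Ht) as (Bt & D). split; [| exact D].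
  destruct Bt as (Bx & By & _).
  rewrite (surjective_pairing (fst (phi (pt s) t))). apply HV.
  + eapply Rle_lt_trans; [exact Bx | lra].
  + eapply Rle_lt_trans; [exact By | lra].
Qed.

(** * Intersection of the geodesics tangent at two points of the curve *)

Section Flow.

Variables (phi : phase -> R -> phase) (h e1 : R).
Hypothesis h_pos : 0 < h.
Hypothesis e1_le : e1 <= e.
Hypothesis phi_0 : forall p, phi p 0 = p.
Hypothesis phi_lip : forall p q t, dist (phi p t) (phi q t) <= 2 * dist p q.
Hypothesis phi_flow : forall s, Rabs (s - sb) < e1 -> forall t, - h < t < h ->
  V (fst (phi (pt s) t)) /\
  is_derive (fun u => fst (fst (phi (pt s) u))) t (fst (snd (phi (pt s) t))) /\
  is_derive (fun u => snd (fst (phi (pt s) u))) t (snd (snd (phi (pt s) t))) /\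
  is_derive (fun u => fst (snd (phi (pt s) u))) t (- G1 (phi (pt s) t)) /\
  is_derive (fun u => snd (snd (phi (pt s) u))) t (- G2 (phi (pt s) t)) /\
  continuous (phi (pt s)) t.

(** Continuity in time of the single orbit of [pt s], together with the Lipschitz bound in the
    initial state, which is uniform in time, gives joint continuity at the origin. *)
Lemma phi_jointly_continuous (s : R) (f : phase -> R) : Rabs (s - sb) < e1 ->
  continuous f (pt s) ->
  small2 0 (fun p => f (phi (pt (s + fst p)) (snd p)) - f (pt s)).
Proof.
intros Hs Hf eps Heps.
destruct (proj1 (filterlim_locally f (f (pt s))) Hf (mkposreal _ Heps)) as [r Hr].
destruct (phi_flow s Hs 0 ltac:(lra)) as (_ & _ & _ & _ & _ & C).
assert (Hr2 : 0 < r / 2) by (generalize (cond_pos r); lra).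
destruct (proj1 (continuous_dist _ _) C (mkposreal _ Hr2)) as [r1 H1].
destruct (pt_continuous s ltac:(lra) (r / 4) ltac:(generalize (cond_pos r); lra))
  as [r2 [Hr2' H2]].
apply locally_planar. exists (Rmin r1 r2). split; [apply Rmin_glb_lt; [apply cond_pos | exact Hr2'] |].
intros d v Hd Hv. simpl fst; simpl snd. rewrite pow_O, Rmult_1_r.
assert (Hd2 := Rlt_le_trans _ _ _ Hd (Rmin_r _ _)).
assert (Hv1 := Rlt_le_trans _ _ _ Hv (Rmin_l _ _)).
left. apply Hr. apply (norm_compat1 (V := phase)).
change (dist (phi (pt (s + d)) v) (pt s) < r).
assert (Bv : ball 0 r1 v) by (change (Rabs (v - 0) < r1); now rewrite Rminus_0_r).
specialize (H1 v Bv). simpl in H1. rewrite phi_0 in H1.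
specialize (H2 (s + d)). replace (s + d - s) with d in H2 by ring.
specialize (H2 Hd2).
assert (T := dist_triangle (phi (pt s) v) (phi (pt (s + d)) v) (pt s)).
assert (L := phi_lip (pt (s + d)) (pt s) v). lra.
Qed.

Lemma phi_continuous_base (s v : R) : Rabs (s - sb) < e1 ->
  continuous (fun u => fst (fst (phi (pt u) v))) s /\
  continuous (fun u => snd (fst (phi (pt u) v))) s.
Proof.
intros Hs.
split; apply continuous_eps; intros eps Heps;
destruct (pt_continuous s ltac:(lra) (eps / 2) ltac:(lra)) as [r [Hr H]];
exists r; (split; [exact Hr |]); intros u Hu; specialize (H u Hu);
assert (L := phi_lip (pt u) (pt s) v);
destruct (phase_dist (phi (pt u) v) (phi (pt s) v)) as (A & B & _).
- eapply Rle_lt_trans; [exact A |]. lra.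
- eapply Rle_lt_trans; [exact B |]. lra.
Qed.

Let D1geo (p : phase) : R := D1 p (- G1 p) (- G2 p).
Let D2geo (p : phase) : R := D2 p (- G1 p) (- G2 p).

(** Stated for an arbitrary covector, constant in the chart, because it serves both for T and for k.
    The last two entries differentiate the same Christoffel term along the curve and along the
    geodesic; comparing them produces m. *)
Lemma covector_jet (s al be : R) : Rabs (s - sb) < e1 ->
  jet (fun d v => al * (fst (fst (phi (pt (s + d)) v)) - cx s)
                  + be * (snd (fst (phi (pt (s + d)) v)) - cy s))
      (fun d v => al * fst (snd (phi (pt (s + d)) v)) + be * snd (snd (phi (pt (s + d)) v)))
      (fun d v => - (al * G1 (phi (pt (s + d)) v) + be * G2 (phi (pt (s + d)) v)))
      (fun d v => - (al * D1geo (phi (pt (s + d)) v) + be * D2geo (phi (pt (s + d)) v)))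
      (fun d => al * (cx (s + d) - cx s) + be * (cy (s + d) - cy s))
      (fun d => al * cx1 (s + d) + be * cy1 (s + d))
      (fun d => al * cx2 (s + d) + be * cy2 (s + d))
      (fun d => al * G1 (pt (s + d)) + be * G2 (pt (s + d)))
      (al * cx3 s + be * cy3 s)
      (al * D1 (pt s) (cx2 s) (cy2 s) + be * D2 (pt s) (cx2 s) (cy2 s))
      (- (al * D1geo (pt s) + be * D2geo (pt s))).
Proof.
intros Hs.
assert (S0 : s + 0 = s) by ring.
assert (N : forall d, Rabs d < e1 - Rabs (s - sb) -> Rabs (s + d - sb) < e1).
{ intros d Hd. replace (s + d - sb) with (d + (s - sb)) by ring.
  eapply Rle_lt_trans; [apply Rabs_triang |]. lra. }
split; [| split; [| split; [| split]]].
- apply locally_planar. exists (Rmin h (e1 - Rabs (s - sb))).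
  split; [apply Rmin_glb_lt; lra |]. intros d v Hd Hv. simpl fst; simpl snd.
  assert (Hd2 := Rlt_le_trans _ _ _ Hd (Rmin_r _ _)).
  assert (Hv1 := Rlt_le_trans _ _ _ Hv (Rmin_l _ _)).
  apply Rabs_def2 in Hv1.
  destruct (phi_flow (s + d) (N d Hd2) v ltac:(lra)) as (A & Dx & Dy & Da & Db & _).
  assert (A' : V (fst (fst (phi (pt (s + d)) v)), snd (fst (phi (pt (s + d)) v))))
    by now rewrite <- surjective_pairing.
  assert (DG1 := der_chr V P1 P1x P1y Q1 Q1x Q1y N1 N1x N1y V_open HP1 HQ1 HN1
    _ _ _ _ v _ _ A' Dx Dy Da Db).
  assert (DG2 := der_chr V P2 P2x P2y Q2 Q2x Q2y N2 N2x N2y V_open HP2 HQ2 HN2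
    _ _ _ _ v _ _ A' Dx Dy Da Db).
  assert (DG1' : is_derive (fun u => G1 (phi (pt (s + d)) u)) v (D1geo (phi (pt (s + d)) v))).
  { eapply der_eq; [refine (is_derive_ext _ _ _ _ _ DG1); intros u; apply chr_eta |].
    apply dchr_eta. }
  assert (DG2' : is_derive (fun u => G2 (phi (pt (s + d)) u)) v (D2geo (phi (pt (s + d)) v))).
  { eapply der_eq; [refine (is_derive_ext _ _ _ _ _ DG2); intros u; apply chr_eta |].
    apply dchr_eta. }
  split; [| split]; unfold Rminus; derive_poly.
  + rewrite !Rmult_0_l, !Rplus_0_l, !Rplus_0_r. reflexivity.
  + ring.
  + ring.
- apply (small_ext _ _ _ (fun p =>
    (fun q => - (al * D1geo q + be * D2geo q)) (phi (pt (s + fst p)) (snd p))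
    - (fun q => - (al * D1geo q + be * D2geo q)) (pt s))).
  + apply filter_forall. intros p. reflexivity.
  + apply (phi_jointly_continuous s (fun q => - (al * D1geo q + be * D2geo q)) Hs).
    assert (A : V (fst (pt s))) by (apply curve; lra).
    assert (C1 := cont_chr V P1 P1x P1y Q1 Q1x Q1y N1 N1x N1y V_open HP1 HQ1 HN1 _ A).
    assert (C2 := cont_chr V P2 P2x P2y Q2 Q2x Q2y N2 N2x N2y V_open HP2 HQ2 HN2 _ A).
    assert (C3 := cont_dchr V P1 P1x P1y Q1 Q1x Q1y N1 N1x N1y V_open HP1 HQ1 HN1 _
      (fun p => - G1 p) (fun p => - G2 p) A (cont_opp _ _ C1) (cont_opp _ _ C2)).
    assert (C4 := cont_dchr V P2 P2x P2y Q2 Q2x Q2y N2 N2x N2y V_open HP2 HQ2 HN2 _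
      (fun p => - G1 p) (fun p => - G2 p) A (cont_opp _ _ C1) (cont_opp _ _ C2)).
    apply cont_opp, cont_plus; apply cont_mult.
    * apply (continuous_const (V := R_UniformSpace)).
    * exact C3.
    * apply (continuous_const (V := R_UniformSpace)).
    * exact C4.
- apply locally_0. exists (e1 - Rabs (s - sb)). split; [lra |]. intros d Hd.
  rewrite phi_0. destruct (curve (s + d)) as (_ & A & B & _ & A' & B' & _).
  { generalize (N d Hd); lra. }
  split; [reflexivity |]. split; [reflexivity |]. split; [reflexivity |].
  apply der_shift in A, B, A', B'.
  split; unfold Rminus; derive_poly; ring.
- destruct (curve s ltac:(lra)) as (_ & _ & _ & C & _ & _ & C' & _).
  rewrite <- S0 in C, C'. apply der_shift in C, C'.
  derive_poly. rewrite S0. ring.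
- destruct (curve s ltac:(lra)) as (A & B & C & _ & B' & C' & _).
  change (V (cx s, cy s)) in A. rewrite <- S0 in A, B, C, B', C'.
  apply der_shift in B, C, B', C'.
  assert (DG1 := der_chr V P1 P1x P1y Q1 Q1x Q1y N1 N1x N1y V_open HP1 HQ1 HN1
    _ _ _ _ 0 _ _ A B B' C C').
  assert (DG2 := der_chr V P2 P2x P2y Q2 Q2x Q2y N2 N2x N2y V_open HP2 HQ2 HN2
    _ _ _ _ 0 _ _ A B B' C C').
  cbv beta in DG1, DG2. rewrite S0 in DG1, DG2.
  change (is_derive (fun d => G1 (pt (s + d))) 0 (D1 (pt s) (cx2 s) (cy2 s))) in DG1.
  change (is_derive (fun d => G2 (pt (s + d))) 0 (D2 (pt s) (cx2 s) (cy2 s))) in DG2.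
  derive_poly. ring.
Qed.

(** By the Gram identity, (E G - F^2) (a d - b c)^2 = |T|^2 |k|^2 - <T, k>^2 > 0, so a d - b c is
    nonzero and the two equations determine the vector. This turns equality of the components into
    equality of the points. *)
Lemma gm_frame_injective (z : R * R) (a b c d w1 w2 : R) :
  gm z a b a b = 1 -> gm z a b c d = 0 -> 0 < gm z c d c d ->
  gm z a b w1 w2 = 0 -> gm z c d w1 w2 = 0 -> w1 = 0 /\ w2 = 0.
Proof.
intros H1 H0 HK Hw Hw'.
assert (Gram : (E z * G z - F z ^ 2) * (a * d - b * c) ^ 2 = gm z c d c d).
{ transitivity (gm z a b a b * gm z c d c d - gm z a b c d ^ 2).
  - unfold gm; ring.
  - rewrite H1, H0; ring. }
assert (D : a * d - b * c <> 0).
{ intros D. rewrite D in Gram. replace 0 with ((E z * G z - F z ^ 2) * 0 ^ 2) in HK by ring.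
  rewrite Gram in HK. lra. }
assert (A : w1 * d - w2 * c = 0).
{ transitivity (gm z a b a b * (w1 * d - w2 * c) + gm z a b c d * (a * w2 - b * w1)).
  - rewrite H1, H0; ring.
  - transitivity (gm z a b w1 w2 * (a * d - b * c)); [unfold gm; ring |].
    rewrite Hw; ring. }
assert (B : a * w2 - b * w1 = 0).
{ apply (Rmult_eq_reg_l (gm z c d c d)); [| lra].
  transitivity (gm z a b c d * (w1 * d - w2 * c) + gm z c d c d * (a * w2 - b * w1)).
  - rewrite H0; ring.
  - transitivity (gm z c d w1 w2 * (a * d - b * c)); [unfold gm; ring |].
    rewrite Hw'; ring. }
split; apply (Rmult_eq_reg_r (a * d - b * c)); try exact D.
- transitivity (a * (w1 * d - w2 * c) + c * (a * w2 - b * w1)); [ring |].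
  rewrite A, B; ring.
- transitivity (b * (w1 * d - w2 * c) + d * (a * w2 - b * w1)); [ring |].
  rewrite A, B; ring.
Qed.

Theorem tangent_geodesics_intersection (s : R) : Rabs (s - sb) < e1 ->
  exists d0 u v, 0 < d0 /\
    (forall d, 0 < d < d0 ->
      0 < u d < d /\ - d < v d < 0 /\
      fst (phi (pt (s + d)) (v d)) = fst (phi (pt s) (u d)) /\
      continuous (fun d => u d - v d - d) d) /\
    small1 3 (fun d => u d - v d - d - K s / 12 * d ^ 3).
Proof.
intros Hs.
set (z := fst (pt s)).
set (al := E z * cx1 s + F z * cy1 s). set (be := F z * cx1 s + G z * cy1 s).
set (al' := E z * k1 s + F z * k2 s). set (be' := F z * k1 s + G z * k2 s).
destruct (curve s ltac:(lra)) as (_ & _ & _ & _ & _ & _ & _ & Unit & HK). fold z in Unit.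
assert (Orth := curvature_orthogonal s ltac:(lra)). fold z in Orth.
assert (KD := curvature_derivative s ltac:(lra)). cbv zeta in KD. fold z in KD.
set (b1 := B1 z (cx1 s) (cy1 s) (k1 s) (k2 s)) in *.
set (b2 := B2 z (cx1 s) (cy1 s) (k1 s) (k2 s)) in *.
assert (S0 : s + 0 = s) by ring.
(* The accelerations of the curve and of its tangent geodesic differ by k, and [dchr] is affine in
   the acceleration with linear part 2 B. *)
assert (Lin1 : D1 (pt s) (cx2 s) (cy2 s) = D1geo (pt s) + 2 * b1).
{ unfold b1, D1geo, D1, B1, k1, k2, dchr, bil, z. simpl. field. }
assert (Lin2 : D2 (pt s) (cx2 s) (cy2 s) = D2geo (pt s) + 2 * b2).
{ unfold b2, D2geo, D2, B2, k1, k2, dchr, bil, z. simpl. field. }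
destruct (string_intersection_jet _ _ _ _ _ _ _ _ _ _ _ _ _ _ _ _ _ _ _ _ _ _ (K s)
  (gm z (cx1 s) (cy1 s) b1 b2) HK (covector_jet s al be Hs) (covector_jet s al' be' Hs))
  as (d0 & u & v & Hd0 & Huv & Hlim).
- apply locally_planar. exists (e1 - Rabs (s - sb)). split; [lra |].
  intros d v Hd _. simpl fst; simpl snd.
  assert (N : Rabs (s + d - sb) < e1).
  { replace (s + d - sb) with (d + (s - sb)) by ring.
    eapply Rle_lt_trans; [apply Rabs_triang |]. lra. }
  destruct (phi_continuous_base (s + d) v N) as [Cx Cy].
  assert (Sh : continuous (fun d => s + d) d).
  { apply (ex_derive_continuous (fun d => s + d)). exists 1.
    apply (der_shift (fun x => x)). exact (is_derive_id (K := R_AbsRing) (s + d)). }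
  assert (Cx' := continuous_comp (fun d => s + d) _ d Sh Cx).
  assert (Cy' := continuous_comp (fun d => s + d) _ d Sh Cy).
  unfold Rminus. split; cont_poly.
- rewrite S0. ring.
- rewrite S0. rewrite <- Unit. unfold al, be, gm. ring.
- rewrite S0. unfold k1, k2, gm, al, be in *. lra.
- rewrite S0. ring.
- rewrite S0. rewrite <- Orth. unfold al', be', gm. ring.
- rewrite S0. unfold K, al', be', gm. fold z. unfold k1, k2. ring.
- rewrite Lin1, Lin2. unfold al, be, gm. ring.
(* The sum x3 + w1 is the pairing of T with the ordinary derivative of k, evaluated in KD. *)
- unfold al, be, gm in *. lra.
- exists d0, u, v. split; [exact Hd0 |]. split; [| exact Hlim].
  intros d Hd. destruct (Huv d Hd) as (A & B & C & D & Cont).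
  rewrite S0 in C, D.
  split; [exact A |]. split; [exact B |]. split; [| exact Cont].
  destruct (phi (pt (s + d)) (v d)) as [[x y] w]. destruct (phi (pt s) (u d)) as [[x' y'] w'].
  simpl in *.
  destruct (gm_frame_injective z (cx1 s) (cy1 s) (k1 s) (k2 s) (x - x') (y - y') Unit Orth HK)
    as [Ex' Ey'].
  + unfold gm, al, be in *. lra.
  + unfold gm, al', be' in *. lra.
  + f_equal; lra.
Qed.

End Flow.

Theorem planar_string :
  exists (phi : phase -> R -> phase) (h e1 : R), 0 < h /\ 0 < e1 <= e /\
    (forall p, phi p 0 = p) /\
    forall s, Rabs (s - sb) < e1 ->
      (forall t, - h < t < h ->
        V (fst (phi (pt s) t)) /\
        is_derive (fun u => fst (fst (phi (pt s) u))) t (fst (snd (phi (pt s) t))) /\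
        is_derive (fun u => snd (fst (phi (pt s) u))) t (snd (snd (phi (pt s) t))) /\
        is_derive (fun u => fst (snd (phi (pt s) u))) t (- G1 (phi (pt s) t)) /\
        is_derive (fun u => snd (snd (phi (pt s) u))) t (- G2 (phi (pt s) t)) /\
        gm (fst (phi (pt s) t)) (fst (snd (phi (pt s) t))) (snd (snd (phi (pt s) t)))
          (fst (snd (phi (pt s) t))) (snd (snd (phi (pt s) t))) = 1) /\
      exists d0 u v, 0 < d0 /\
        (forall d, 0 < d < d0 ->
          0 < u d < d /\ - d < v d < 0 /\
          fst (phi (pt (s + d)) (v d)) = fst (phi (pt s) (u d)) /\
          continuous (fun d => u d - v d - d) d) /\
        small1 3 (fun d => u d - v d - d - K s / 12 * d ^ 3).
Proof.
destruct tangent_geodesics_exist as (phi & h & e1 & Hh & He1 & P0 & PL & PF).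
exists phi, h, e1. split; [exact Hh |]. split; [exact He1 |]. split; [exact P0 |].
intros s Hs. split.
- intros t Ht. destruct (PF s Hs t Ht) as (A & B & C & D & D' & _).
  split; [exact A |]. split; [exact B |]. split; [exact C |]. split; [exact D |].
  split; [exact D' |].
  assert (Q := geodesic_unit_speed (fun t => fst (fst (phi (pt s) t)))
    (fun t => snd (fst (phi (pt s) t))) (fun t => fst (snd (phi (pt s) t)))
    (fun t => snd (snd (phi (pt s) t))) h).
  cbv beta in Q. rewrite (surjective_pairing (fst (phi (pt s) t))). apply Q.
  + intros u Hu. destruct (PF s Hs u Hu) as (A' & B' & C' & E1 & E2 & _).
    split; [now rewrite <- surjective_pairing |]. split; [exact B' |]. split; [exact C' |].
    split.
    * eapply der_eq; [exact E1 |]. f_equal. symmetry. apply chr_eta.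
    * eapply der_eq; [exact E2 |]. f_equal. symmetry. apply chr_eta.
  + rewrite P0. apply (curve s). lra.
  + exact Ht.
- exact (tangent_geodesics_intersection phi h e1 Hh (proj2 He1) P0 PL PF s Hs).
Qed.

End PlanarMetric.

(** * The string function of a germ *)

(** For each p one suitable d is enough, since the increment of t will be known to depend on p only.
    Cubing that increment makes it comparable with L. *)
Lemma string_length_inverse (t L : R -> R) (s l d0 K : R) :
  0 < d0 -> 0 < K -> is_derive t s l ->
  (forall d, 0 < d < d0 -> continuous L d) ->
  small1 3 (fun d => L d - K / 12 * d ^ 3) ->
  forall eps, 0 < eps -> exists p1, 0 < p1 /\ forall p, 0 < p < p1 ->
    exists d, 0 < d < d0 /\ L d = p /\
      Rabs ((t (s + d) - t s) ^ 3 / p - 12 * l ^ 3 / K) < eps.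
Proof.
intros Hd0 HK Ht HL HS eps Heps.
assert (LL := Rabs_pos). assert (LL' := Rabs_at_right_lim).
assert (Bd := big1_id).
assert (T1 : small1 1 (fun d => t (s + d) - t s - l * d)).
{ rewrite <- (Rplus_0_r s) in Ht. apply der_shift in Ht.
  apply small0_derive in Ht. intros e He. specialize (Ht e He).
  destruct (proj1 (locally_0 _) Ht) as [r [Hr H]].
  apply at_right_0. exists r; split; [exact Hr |]. intros d Hd.
  specialize (H d ltac:(rewrite Rabs_pos_eq; lra)). rewrite Rplus_0_r in H. exact H. }
assert (B1 : big1 1 (fun d => t (s + d) - t s)).
{ apply (big_ext _ _ _ (fun d => (t (s + d) - t s - l * d) + l * d)).
  - apply filter_forall. intros d. ring.
  - apply (big_plus _ _ 1); [now apply small_big | now apply (big_scal _ _ 1)]. }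
assert (T3 : small1 3 (fun d => (t (s + d) - t s) ^ 3 - l ^ 3 * d ^ 3)).
{ apply (small_ext _ _ _ (fun d => (t (s + d) - t s - l * d) *
    ((t (s + d) - t s) * (t (s + d) - t s) + (l * d) * (t (s + d) - t s)
     + (l * d) * (l * d)))).
  - apply filter_forall. intros d. ring.
  - assert (Bl : big1 1 (fun d => l * d)) by now apply (big_scal _ _ 1).
    apply (small_mult_big _ _ LL 1 2); [exact T1 |].
    apply (big_plus _ _ 2); [apply (big_plus _ _ 2) |]; apply (big_mult _ _ 1 1); assumption. }
assert (T : small1 3 (fun d => (t (s + d) - t s) ^ 3 - 12 * l ^ 3 / K * L d)).
{ apply (small_ext _ _ _ (fun d => ((t (s + d) - t s) ^ 3 - l ^ 3 * d ^ 3)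
    - 12 * l ^ 3 / K * (L d - K / 12 * d ^ 3))).
  - apply filter_forall. intros d. field. lra.
  - apply (small_minus _ _ 3); [exact T3 |]. now apply (small_scal _ _ LL 3). }
(* As K d^3 / 24 <= L d = p, an error of eps K d^3 / 48 is at most eps p / 2. *)
assert (E1 : 0 < eps * K / 48) by nra.
assert (E2 : 0 < K / 24) by lra.
destruct (proj1 (at_right_0 _) (filter_and _ _ (T _ E1) (HS _ E2))) as [r [Hr H]].
set (d2 := Rmin d0 r / 2).
assert (Hm : 0 < Rmin d0 r) by now apply Rmin_glb_lt.
assert (Hm1 := Rmin_l d0 r). assert (Hm2 := Rmin_r d0 r).
assert (Bds : forall d, 0 < d <= d2 -> K / 24 * d ^ 3 <= L d <= K * d ^ 3).
{ intros d Hd. unfold d2 in Hd. destruct (H d ltac:(lra)) as [_ A].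
  rewrite (Rabs_pos_eq d) in A by lra. apply Rabs_le_between in A.
  assert (0 < d ^ 3) by (apply pow_lt; lra). nra. }
assert (Hd2 : 0 < d2) by (unfold d2; lra).
assert (P3 : 0 < d2 ^ 3) by (apply pow_lt; exact Hd2).
exists (L d2). split; [generalize (Bds d2 ltac:(lra)); nra |].
intros p Hp.
(* The left end for the intermediate value theorem: L d3 <= K d3^3 <= K d3 <= p / 2 < p. *)
set (d3 := Rmin 1 (Rmin (d2 / 2) (p / (2 * K)))).
assert (Hpk : 0 < p / (2 * K)) by (apply Rdiv_lt_0_compat; lra).
assert (H3 : 0 < d3) by (unfold d3; repeat apply Rmin_glb_lt; lra).
assert (A1 : d3 <= 1) by apply Rmin_l.
assert (A2 : d3 <= d2 / 2) by (eapply Rle_trans; [apply Rmin_r | apply Rmin_l]).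
assert (A3 : d3 <= p / (2 * K)) by (eapply Rle_trans; [apply Rmin_r | apply Rmin_r]).
assert (L3 : L d3 < p).
{ destruct (Bds d3 ltac:(lra)) as [_ B].
  assert (C : d3 ^ 3 <= d3) by (simpl; nra).
  apply (Rmult_le_compat_l K) in A3; [| lra].
  replace (K * (p / (2 * K))) with (p / 2) in A3 by (field; lra).
  assert (K * d3 ^ 3 <= K * d3) by (apply Rmult_le_compat_l; lra). lra. }
destruct (IVT_interv (fun d => L d - p) d3 d2) as [d [Hd Ed]].
- intros d Hd. apply continuity_pt_minus.
  + apply continuity_pt_filterlim, HL. unfold d2 in *; lra.
  + apply continuity_pt_const. now intros ? ?.
- lra.
- lra.
- lra.
- exists d. assert (Ld : L d = p) by lra.
  split; [unfold d2 in *; lra |]. split; [exact Ld |].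
  assert (Hd' : 0 < d < r) by (unfold d2 in *; lra).
  destruct (H d Hd') as [A _]. rewrite Ld, (Rabs_pos_eq d) in A by lra.
  destruct (Bds d ltac:(lra)) as [B _]. rewrite Ld in B.
  replace ((t (s + d) - t s) ^ 3 / p - 12 * l ^ 3 / K) with
    (((t (s + d) - t s) ^ 3 - 12 * l ^ 3 / K * p) / p) by (field; lra).
  unfold Rdiv at 1. rewrite Rabs_mult, (Rabs_pos_eq (/ p))
    by (apply Rlt_le, Rinv_0_lt_compat; lra).
  apply Rmult_lt_reg_r with p; [lra |].
  rewrite Rmult_assoc, Rinv_l by lra. rewrite Rmult_1_r. nra.
Qed.

(** * The metric and its Christoffel symbols in a chart *)

Section Chart.

Variables (S : surface) (g : C3_metric S) (i : chart S).

Let V : R * R -> Prop := overlap i i.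
Let E := mE g i.
Let F := mF g i.
Let G := mG g i.

Lemma chart_open : open V.
Proof. exact (overlap_open S i i). Qed.

Definition det_g (z : R * R) : R := E z * G z + - (F z * F z).

(** The form takes the value E at (1, 0) and E (E G - F^2) at (- F, E). *)
Lemma det_g_pos (z : R * R) : V z -> 0 < det_g z.
Proof.
intros Hz.
assert (A := metric_pos _ g i z Hz (1, 0) ltac:(intros H; injection H; lra)).
assert (B := metric_pos _ g i z Hz (- mF g i z, mE g i z)).
unfold qform in A, B. simpl in A, B. fold E F G in A, B.
assert (HE : 0 < E z) by lra.
assert (B' := B ltac:(intros H; injection H; fold E; lra)).
apply Rmult_lt_reg_l with (E z); [exact HE |]. unfold det_g.
nra.
Qed.

(** With upper index 1, then 2, these are Gamma_11, twice Gamma_12, and Gamma_22. Only sums,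
    opposites, products and inverses are used, so that [christoffel_C1] can proceed by syntax. *)
Definition gP1 (z : R * R) : R :=
  (G z * (d1 E z * / 2) + - (F z * (d1 F z + - (d2 E z * / 2)))) * / det_g z.
Definition gQ1 (z : R * R) : R :=
  (G z * d2 E z + - (F z * d1 G z)) * / det_g z.
Definition gN1 (z : R * R) : R :=
  (G z * (d2 F z + - (d1 G z * / 2)) + - (F z * (d2 G z * / 2))) * / det_g z.
Definition gP2 (z : R * R) : R :=
  (E z * (d1 F z + - (d2 E z * / 2)) + - (F z * (d1 E z * / 2))) * / det_g z.
Definition gQ2 (z : R * R) : R :=
  (E z * d1 G z + - (F z * d2 E z)) * / det_g z.
Definition gN2 (z : R * R) : R :=
  (E z * (d2 G z * / 2) + - (F z * (d2 F z + - (d1 G z * / 2)))) * / det_g z.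

Lemma christoffel_chr (p : phase) : V (fst p) ->
  christoffel g i (fst p) (snd p) = (chr gP1 gQ1 gN1 p, chr gP2 gQ2 gN2 p).
Proof.
intros Hz. assert (D := det_g_pos _ Hz).
unfold christoffel, chr, gP1, gQ1, gN1, gP2, gQ2, gN2. fold E F G.
destruct p as [z [a b]]; simpl in *. unfold det_g in *.
f_equal; field; lra.
Qed.

Lemma metric_C1 :
  (C1 V E /\ C1 V F /\ C1 V G) /\ (C1 V (d1 E) /\ C1 V (d2 E)) /\
  (C1 V (d1 F) /\ C1 V (d2 F)) /\ (C1 V (d1 G) /\ C1 V (d2 G)).
Proof.
destruct (metric_C3 _ g i) as (HE & HF & HG).
assert (H : forall f, Ck2 3 V f -> C1 V f /\ C1 V (d1 f) /\ C1 V (d2 f)).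
{ intros f Hf. assert (O := chart_open).
  assert (H2 := Ck2_lower 2 V f O Hf). assert (H1 := Ck2_lower 1 V f O H2).
  split; [exists (d1 f), (d2 f); exact (Ck2_C1_on V f H1) |].
  destruct H2 as (_ & A & B).
  split; [exists (d1 (d1 f)), (d2 (d1 f)) | exists (d1 (d2 f)), (d2 (d2 f))];
  now apply Ck2_C1_on. }
destruct (H _ HE) as (A & A1 & A2). destruct (H _ HF) as (B & B1 & B2).
destruct (H _ HG) as (C & D1 & D2).
repeat split; assumption.
Qed.

Lemma christoffel_C1 :
  C1 V gP1 /\ C1 V gQ1 /\ C1 V gN1 /\ C1 V gP2 /\ C1 V gQ2 /\ C1 V gN2.
Proof.
assert (O := chart_open).
destruct metric_C1 as ((HE & HF & HG) & (HE1 & HE2) & (HF1 & HF2) & (HG1 & HG2)).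
assert (HD : C1 V (fun z => / det_g z)).
{ apply C1_inv; [exact O | intros z Hz; generalize (det_g_pos z Hz); lra |].
  unfold det_g. apply C1_plus; [now apply C1_mult |]. apply C1_opp. now apply C1_mult. }
unfold gP1, gQ1, gN1, gP2, gQ2, gN2.
repeat split;
repeat lazymatch goal with
  | |- C1 _ (fun z => / det_g z) => exact HD
  | |- C1 _ (fun _ => ?c) => apply C1_const
  | |- C1 _ (fun z => _ + _) => apply C1_plus
  | |- C1 _ (fun z => - _) => apply C1_opp
  | |- C1 _ (fun z => _ * _) => apply C1_mult; [exact O | |]
  | |- _ => assumption
  end.
Qed.

Lemma metric_compatibility (z : R * R) (a b c d : R) : V z ->
  dgm (d1 E) (d2 E) (d1 F) (d2 F) (d1 G) (d2 G) z a b c d =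
  gm E F G z (chr gP1 gQ1 gN1 (z, (a, b))) (chr gP2 gQ2 gN2 (z, (a, b))) c d
  + gm E F G z a b (bil (gP1 z) (gQ1 z) (gN1 z) a b c d)
                   (bil (gP2 z) (gQ2 z) (gN2 z) a b c d).
Proof.
intros Hz. assert (D := det_g_pos _ Hz).
unfold dgm, gm, chr, bil, gP1, gQ1, gN1, gP2, gQ2, gN2. simpl. unfold det_g in *.
field. lra.
Qed.

Lemma gnorm_gm (P : S) (v : R * R) :
  gnorm g i P v = sqrt (gm E F G (coord i P) (fst v) (snd v) (fst v) (snd v)).
Proof.
unfold gnorm, qform, gm. fold E F G. f_equal. ring.
Qed.

Lemma chart_param (P : S) : dom i P -> V (coord i P) /\ param i (coord i P) = P.
Proof.
intros H. assert (Q := paramK S i P H). split; [| exact Q].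
unfold V, overlap. rewrite Q. auto.
Qed.

(** * The curve and its tangent geodesics read in the chart *)

Section Curve.

Variables (c : R -> S) (sb : R).

Let x (j : nat) (s : R) : R := Derive_n (cx i c) j s.
Let y (j : nat) (s : R) : R := Derive_n (cy i c) j s.
Let pt (s : R) : phase := ((x 0 s, y 0 s), (x 1 s, y 1 s)).
Let k1 (s : R) := x 2 s + chr gP1 gQ1 gN1 (pt s).
Let k2 (s : R) := y 2 s + chr gP2 gQ2 gN2 (pt s).
Let K (s : R) := gm E F G (fst (pt s)) (k1 s) (k2 s) (k1 s) (k2 s).

Lemma coord_pt (s : R) : coord i (c s) = fst (pt s).
Proof. unfold pt, x, y, cx, cy; simpl. apply surjective_pairing. Qed.

Lemma velocity_pt (s : R) : velocity i c s = snd (pt s).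
Proof. reflexivity. Qed.

Lemma curvature_K (s : R) : dom i (c s) -> geodesic_curvature g i c s = sqrt (K s).
Proof.
intros H. destruct (chart_param _ H) as [Hz _].
unfold geodesic_curvature. rewrite gnorm_gm. unfold cov_acceleration.
rewrite coord_pt in *. rewrite velocity_pt, (christoffel_chr (pt s) Hz). reflexivity.
Qed.

Lemma natural_germ_curve : C3_natural_germ g i c sb ->
  locally sb (fun s => 0 < geodesic_curvature g i c s) ->
  exists e, 0 < e /\ forall s, Rabs (s - sb) < e ->
    dom i (c s) /\ gnorm g i (c s) (velocity i c s) = 1 /\
    0 < geodesic_curvature g i c s /\ geodesic_curvature g i c s ^ 2 = K s /\
    V (fst (pt s)) /\
    is_derive (x 0) s (x 1 s) /\ is_derive (x 1) s (x 2 s) /\ is_derive (x 2) s (x 3 s) /\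
    is_derive (y 0) s (y 1 s) /\ is_derive (y 1) s (y 2 s) /\ is_derive (y 2) s (y 3 s) /\
    gm E F G (fst (pt s)) (x 1 s) (y 1 s) (x 1 s) (y 1 s) = 1 /\ 0 < K s.
Proof.
intros (Hx & Hy & Hn) Hk.
destruct (filter_and _ _ (filter_and _ _ Hx Hy) (filter_and _ _ Hn Hk)) as [e He].
exists e. split; [apply cond_pos |]. intros s Hs.
destruct (He s Hs) as (((Dx & _) & (Dy & _)) & (Hd & Hu) & Hκ).
destruct (chart_param _ Hd) as [Hz _]. rewrite coord_pt in Hz.
assert (DD : forall f, (forall j, (j <= 3)%nat -> ex_derive_n f j s) ->
  forall j, (j < 3)%nat -> is_derive (Derive_n f j) s (Derive_n f (Datatypes.S j) s)).
{ intros f Hf j Hj. apply Derive_correct. exact (Hf (Datatypes.S j) Hj). }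
assert (Hκ' := Hκ). rewrite (curvature_K s Hd) in Hκ'.
assert (HK : 0 < K s).
(* [sqrt] is 0 on nonpositive numbers, so positive curvature forces K s > 0. *)
{ apply Rnot_le_lt. intros Hle. rewrite sqrt_neg_0 in Hκ' by exact Hle. lra. }
assert (Hu' := Hu). rewrite gnorm_gm, coord_pt, velocity_pt in Hu'.
assert (U : gm E F G (fst (pt s)) (x 1 s) (y 1 s) (x 1 s) (y 1 s) = 1).
{ simpl fst in Hu'. simpl snd in Hu'.
  set (w := gm E F G _ _ _ _ _) in Hu'. change (w = 1).
  assert (0 < w) by (apply Rnot_le_lt; intros Hle; rewrite sqrt_neg_0 in Hu' by exact Hle; lra).
  rewrite <- (sqrt_sqrt w) by lra. rewrite Hu'. ring. }
split; [exact Hd |]. split; [exact Hu |]. split; [exact Hκ |].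
split; [rewrite (curvature_K s Hd); simpl; rewrite Rmult_1_r; apply sqrt_sqrt; lra |].
split; [exact Hz |].
split; [apply (DD _ Dx 0%nat); lia |]. split; [apply (DD _ Dx 1%nat); lia |].
split; [apply (DD _ Dx 2%nat); lia |]. split; [apply (DD _ Dy 0%nat); lia |].
split; [apply (DD _ Dy 1%nat); lia |]. split; [apply (DD _ Dy 2%nat); lia |].
split; [exact U | exact HK].
Qed.

Lemma unit_speed_length (q : R -> S) (a b : R) :
  (forall u, Rmin a b < u < Rmax a b -> gnorm g i (q u) (velocity i q u) = 1) ->
  arc_length g i q a b = Rabs (b - a).
Proof.
intros H. unfold arc_length.
rewrite (RInt_ext _ (fun _ => 1)).
- rewrite RInt_const. unfold scal; simpl. unfold mult; simpl. rewrite Rmult_1_r.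
  unfold Rmin, Rmax. destruct (Rle_dec a b); unfold Rabs; destruct (Rcase_abs _); lra.
- intros u Hu. apply H.
  assert (M : Rmin a b <= Rmax a b) by (eapply Rle_trans; [apply Rmin_l | apply Rmax_l]).
  now rewrite Rmin_left, Rmax_right in Hu by exact M.
Qed.

(** Lifts an orbit of the phase flow to the surface by [param]. Since [coord] undoes [param] on V
    only, the derivatives are identified through local equality on (- h, h). *)
Lemma flow_tangent_segment (p : R -> phase) (s h r u : R) :
  dom i (c s) -> 0 < h -> p 0 = pt s ->
  (forall t, - h < t < h ->
    V (fst (p t)) /\
    is_derive (fun t => fst (fst (p t))) t (fst (snd (p t))) /\
    is_derive (fun t => snd (fst (p t))) t (snd (snd (p t))) /\
    is_derive (fun t => fst (snd (p t))) t (- chr gP1 gQ1 gN1 (p t)) /\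
    is_derive (fun t => snd (snd (p t))) t (- chr gP2 gQ2 gN2 (p t)) /\
    gm E F G (fst (p t)) (fst (snd (p t))) (snd (snd (p t)))
      (fst (snd (p t))) (snd (snd (p t))) = 1) ->
  - h < u < h -> Rabs u < r ->
  tangent_segment g i c r s (param i (fst (p u))) (Rabs u).
Proof.
intros Hd Hh P0 H Hu Hr.
set (q := fun t => param i (fst (p t))).
assert (Q : forall t, - h < t < h -> dom i (q t) /\ coord i (q t) = fst (p t)).
{ intros t Ht. destruct (H t Ht) as ((A & B & _) & _). now split. }
assert (Loc : forall t, - h < t < h -> locally t (fun w => - h < w < h)).
{ intros t Ht. apply (open_and _ _ (open_gt (- h)) (open_lt h)). exact Ht. }
assert (X1 : forall t, - h < t < h -> is_derive (cx i q) t (fst (snd (p t)))).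
{ intros t Ht. refine (is_derive_ext_loc _ _ _ _ _ (proj1 (proj2 (H t Ht)))).
  generalize (Loc t Ht). apply filter_imp. intros w Hw. unfold cx.
  now rewrite (proj2 (Q w Hw)). }
assert (Y1 : forall t, - h < t < h -> is_derive (cy i q) t (snd (snd (p t)))).
{ intros t Ht. refine (is_derive_ext_loc _ _ _ _ _ (proj1 (proj2 (proj2 (H t Ht))))).
  generalize (Loc t Ht). apply filter_imp. intros w Hw. unfold cy.
  now rewrite (proj2 (Q w Hw)). }
assert (Vel : forall t, - h < t < h -> velocity i q t = snd (p t)).
{ intros t Ht. unfold velocity.
  rewrite (is_derive_unique _ _ _ (X1 t Ht)), (is_derive_unique _ _ _ (Y1 t Ht)).
  symmetry. apply surjective_pairing. }
assert (X2 : forall t, - h < t < h ->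
  is_derive (Derive (cx i q)) t (- chr gP1 gQ1 gN1 (p t))).
{ intros t Ht. destruct (H t Ht) as (_ & _ & _ & D & _).
  refine (is_derive_ext_loc _ _ _ _ _ D). generalize (Loc t Ht). apply filter_imp.
  intros w Hw. symmetry. exact (is_derive_unique _ _ _ (X1 w Hw)). }
assert (Y2 : forall t, - h < t < h ->
  is_derive (Derive (cy i q)) t (- chr gP2 gQ2 gN2 (p t))).
{ intros t Ht. destruct (H t Ht) as (_ & _ & _ & _ & D & _).
  refine (is_derive_ext_loc _ _ _ _ _ D). generalize (Loc t Ht). apply filter_imp.
  intros w Hw. symmetry. exact (is_derive_unique _ _ _ (Y1 w Hw)). }
exists q, (- h), h, u.
split; [lra |]. split; [exact Hu |]. split; [exact Hr |].
split; [| split; [| split; [| split]]].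
- intros t Ht. split; [now apply Q |].
  split; [now exists (fst (snd (p t))); apply X1 |].
  split; [now exists (- chr gP1 gQ1 gN1 (p t)); apply X2 |].
  split; [now exists (snd (snd (p t))); apply Y1 |].
  split; [now exists (- chr gP2 gQ2 gN2 (p t)); apply Y2 |].
  unfold cov_acceleration. rewrite (proj2 (Q t Ht)), (Vel t Ht).
  rewrite (christoffel_chr (p t) (proj1 (H t Ht))). simpl fst; simpl snd.
  change (Derive_n (cx i q) 2 t) with (Derive (Derive (cx i q)) t).
  change (Derive_n (cy i q) 2 t) with (Derive (Derive (cy i q)) t).
  rewrite (is_derive_unique _ _ _ (X2 t Ht)), (is_derive_unique _ _ _ (Y2 t Ht)).
  f_equal; ring.
- unfold q. rewrite P0, <- coord_pt. now apply chart_param.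
- rewrite Vel by lra. now rewrite P0.
- reflexivity.
- rewrite unit_speed_length; [f_equal; ring |]. intros t Ht.
  assert (Ht' : - h < t < h).
  { unfold Rmin, Rmax in Ht. destruct (Rle_dec 0 u); lra. }
  rewrite gnorm_gm, (proj2 (Q t Ht')), (Vel t Ht').
  destruct (H t Ht') as (_ & _ & _ & _ & _ & U).
  transitivity (sqrt 1); [exact (f_equal sqrt U) | apply sqrt_1].
Qed.

Theorem string_function : C3_natural_germ g i c sb ->
  locally sb (fun s => 0 < geodesic_curvature g i c s) ->
  exists e1, 0 < e1 /\ forall s, Rabs (s - sb) < e1 ->
    0 < geodesic_curvature g i c s /\
    forall r, 0 < r -> exists d0 L, 0 < d0 /\
      (forall d, 0 < d < d0 -> Rabs (s + d - sb) < e1 /\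
        string_L g i c r (s + d) s (L d) /\ continuous L d) /\
      small1 3 (fun d => L d - geodesic_curvature g i c s ^ 2 / 12 * d ^ 3).
Proof.
intros HC Hk.
destruct (natural_germ_curve HC Hk) as (e & He & H).
destruct christoffel_C1 as ((P1x & P1y & HP1) & (Q1x & Q1y & HQ1) & (N1x & N1y & HN1) &
  (P2x & P2y & HP2) & (Q2x & Q2y & HQ2) & (N2x & N2y & HN2)).
destruct (metric_C3 _ g i) as (HE & HF & HG).
assert (HH : forall f, Ck2 3 V f -> C1_on V f (d1 f) (d2 f)).
{ intros f Hf. assert (O := chart_open). apply Ck2_C1_on.
  now apply (Ck2_lower 1), (Ck2_lower 2). }
destruct (planar_string V E _ _ F _ _ G _ _ gP1 P1x P1y gQ1 Q1x Q1y gN1 N1x N1y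
  gP2 P2x P2y gQ2 Q2x Q2y gN2 N2x N2y chart_open (HH _ HE) (HH _ HF) (HH _ HG)
  HP1 HQ1 HN1 HP2 HQ2 HN2 metric_compatibility
  (x 0) (x 1) (x 2) (x 3) (y 0) (y 1) (y 2) (y 3) sb e He
  (fun s Hs => proj2 (proj2 (proj2 (proj2 (H s Hs))))))
  as (phi & h & e1 & Hh & He1 & P0 & Hphi).
exists e1. split; [lra |]. intros s Hs.
destruct (H s ltac:(lra)) as (Hd & _ & Hκ & HK & _).
split; [exact Hκ |]. intros r Hr.
destruct (Hphi s Hs) as (Flow & d0 & u & v & Hd0 & Huv & HS).
(* As |u| and |v| are less than d, this bound on d keeps them below the flow time h and the search
   radius r, and keeps s + d in range. *)
assert (Hm : 0 < Rmin (Rmin d0 h) (Rmin r (e1 - Rabs (s - sb))))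
  by (repeat apply Rmin_glb_lt; lra).
exists (Rmin (Rmin d0 h) (Rmin r (e1 - Rabs (s - sb)))), (fun d => u d - v d - d).
split; [exact Hm |]. split.
- intros d [Hd1 Hd2].
  assert (A1 := Rlt_le_trans _ _ _ Hd2 (Rmin_l _ _)).
  assert (A2 := Rlt_le_trans _ _ _ Hd2 (Rmin_r _ _)).
  assert (B1 := Rlt_le_trans _ _ _ A1 (Rmin_l _ _)).
  assert (B2 := Rlt_le_trans _ _ _ A1 (Rmin_r _ _)).
  assert (B3 := Rlt_le_trans _ _ _ A2 (Rmin_l _ _)).
  assert (B4 := Rlt_le_trans _ _ _ A2 (Rmin_r _ _)).
  assert (Hsd : Rabs (s + d - sb) < e1).
  { replace (s + d - sb) with (d + (s - sb)) by ring.
    eapply Rle_lt_trans; [apply Rabs_triang |]. rewrite (Rabs_pos_eq d); lra. }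
  destruct (Huv d (conj Hd1 B1)) as (Ud & Vd & Eq & Cont).
  split; [exact Hsd |]. split; [| exact Cont].
  destruct (H (s + d) ltac:(lra)) as (Hd' & _).
  assert (EqP : param i (fst (phi (pt (s + d)) (v d))) = param i (fst (phi (pt s) (u d))))
    by exact (f_equal (param i) Eq).
  exists (param i (fst (phi (pt s) (u d)))), (Rabs (v d)), (Rabs (u d)).
  split; [| split].
  + rewrite <- EqP.
    apply (flow_tangent_segment (phi (pt (s + d))) (s + d) h r (v d) Hd' Hh (P0 _)).
    * apply Hphi. exact Hsd.
    * lra.
    * apply Rabs_def1; lra.
  + apply (flow_tangent_segment (phi (pt s)) s h r (u d) Hd Hh (P0 _)).
    * exact Flow.
    * lra.
    * apply Rabs_def1; lra.
  + rewrite unit_speed_length.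
    * rewrite (Rabs_pos_eq (u d)), (Rabs_left (v d)) by lra.
      replace (s - (s + d)) with (- d) by ring. rewrite Rabs_Ropp, Rabs_pos_eq; lra.
    * intros w Hw. rewrite Rmin_right, Rmax_left in Hw by lra.
      apply H. apply Rabs_def2 in Hsd, Hs. apply Rabs_def1; lra.
- rewrite HK. exact HS.
Qed.

End Curve.

End Chart.

(** * Comparison of the limits at two base points *)

Theorem theorem1p15 :
  forall (S : surface) (g : C3_metric S) (i : chart S)
         (c : R -> S) (sb : R) (t : R -> R),
    C3_natural_germ g i c sb ->
    locally sb (fun s => 0 < geodesic_curvature g i c s) ->
    string_Poritsky g i c sb t ->
    exists (a eps : R), a <> 0 /\ 0 < eps /\
      (forall s0, Rabs (s0 - sb) < eps -> exists b,
         forall s, Rabs (s - sb) < eps -> t s = a * Lazutkin g i c s0 s + b) /\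
      (forall s, Rabs (s - sb) < eps -> is_derive t s (a * kappa23 g i c s)).
Proof.
intros S g i c sb t HC Hk ((Ht & Ht0) & eps0 & r & p0 & Heps0 & Hr & Hp0 & HP).
destruct (string_function S g i c sb HC Hk) as (e1 & He1 & H).
destruct (filter_and _ _ Ht Ht0) as [e2 H2].
set (eps := Rmin (Rmin eps0 e1) e2).
assert (M1 : eps <= eps0) by (eapply Rle_trans; [apply Rmin_l | apply Rmin_l]).
assert (M2 : eps <= e1) by (eapply Rle_trans; [apply Rmin_l | apply Rmin_r]).
assert (M3 : eps <= e2) by apply Rmin_r.
assert (Heps : 0 < eps) by (unfold eps; repeat apply Rmin_glb_lt; [lra | lra | apply cond_pos]).
clearbody eps.
set (kap := geodesic_curvature g i c).
assert (Dt : forall s, Rabs (s - sb) < eps ->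
  is_derive t s (Derive t s) /\ continuous (Derive t) s /\ Derive t s <> 0).
{ intros s Hs. assert (B : ball sb e2 s) by (change (Rabs (s - sb) < e2); lra).
  destruct (H2 s B) as ((A & C) & N).
  split; [apply Derive_correct; exact (A 1%nat (le_n _)) |]. split; [exact C | exact N]. }
assert (Inv : forall s s', Rabs (s - sb) < eps -> Rabs (s' - sb) < eps ->
  Derive t s ^ 3 / kap s ^ 2 = Derive t s' ^ 3 / kap s' ^ 2).
(* Here cp is any number with the defining property of the string constant for p, so that the same
   cp can be used at s and at s'. *)
{ assert (Lim : forall s, Rabs (s - sb) < eps -> forall e, 0 < e ->
    exists p1, 0 < p1 /\ forall p cp, 0 < p < p1 ->
      (forall sB sA, Rabs (sB - sb) < eps0 -> Rabs (sA - sb) < eps0 -> sB < sA ->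
        string_L g i c r sA sB p -> t sA - t sB = cp) ->
      Rabs (cp ^ 3 / p - 12 * Derive t s ^ 3 / kap s ^ 2) < e).
  { intros s Hs e He. destruct (H s ltac:(lra)) as (Kp & HL).
    destruct (HL r Hr) as (d0 & L & Hd0 & HLd & HS).
    assert (K2 : 0 < kap s ^ 2) by (apply pow_lt; exact Kp).
    assert (Hm : 0 < Rmin d0 (eps0 - Rabs (s - sb))) by (apply Rmin_glb_lt; lra).
    destruct (string_length_inverse t L s (Derive t s) (Rmin d0 (eps0 - Rabs (s - sb)))
      (kap s ^ 2) Hm K2 (proj1 (Dt s Hs))) with (eps := e) as (p1 & Hp1 & Hp).
    - intros d [Hd1 Hd2]. apply HLd. split; [exact Hd1 |].
      exact (Rlt_le_trans _ _ _ Hd2 (Rmin_l _ _)).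
    - exact HS.
    - exact He.
    - exists p1. split; [exact Hp1 |]. intros p cp Hpp Hcp.
      destruct (Hp p Hpp) as (d & [Hd1 Hd2] & Ld & Bd).
      assert (A1 := Rlt_le_trans _ _ _ Hd2 (Rmin_l _ _)).
      assert (A2 := Rlt_le_trans _ _ _ Hd2 (Rmin_r _ _)).
      destruct (HLd d (conj Hd1 A1)) as (_ & St & _). rewrite Ld in St.
      rewrite (Hcp s (s + d)) in Bd; [exact Bd | lra | | lra | exact St].
      replace (s + d - sb) with (d + (s - sb)) by ring.
      eapply Rle_lt_trans; [apply Rabs_triang |]. rewrite (Rabs_pos_eq d); lra. }
  intros s s' Hs Hs'.
  destruct (H s ltac:(lra)) as (Kp & _). destruct (H s' ltac:(lra)) as (Kp' & _).
  fold (kap s) in Kp. fold (kap s') in Kp'.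
  apply (Rmult_eq_reg_l 12); [| lra].
  replace (12 * (Derive t s ^ 3 / kap s ^ 2)) with (12 * Derive t s ^ 3 / kap s ^ 2)
    by (field; lra).
  replace (12 * (Derive t s' ^ 3 / kap s' ^ 2)) with (12 * Derive t s' ^ 3 / kap s' ^ 2)
    by (field; lra).
  apply Rminus_diag_uniq, Rabs_eq_0, Rle_antisym; [| apply Rabs_pos].
  apply le_epsilon. intros e He. rewrite Rplus_0_l.
  destruct (Lim s Hs (e / 2) ltac:(lra)) as (p1 & Hp1 & A).
  destruct (Lim s' Hs' (e / 2) ltac:(lra)) as (p2 & Hp2 & B).
  (* A single p below the three thresholds, hence a single cp within e / 2 of both limits after
     division. *)
  set (p := Rmin p0 (Rmin p1 p2) / 2).
  assert (Hm : 0 < Rmin p0 (Rmin p1 p2)) by (repeat apply Rmin_glb_lt; assumption).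
  assert (N0 : Rmin p0 (Rmin p1 p2) <= p0) by apply Rmin_l.
  assert (N1 : Rmin p0 (Rmin p1 p2) <= p1) by (eapply Rle_trans; [apply Rmin_r | apply Rmin_l]).
  assert (N2 : Rmin p0 (Rmin p1 p2) <= p2) by (eapply Rle_trans; [apply Rmin_r | apply Rmin_r]).
  assert (Pp : 0 < p0 -> 0 < p < p0) by (unfold p; lra).
  destruct (HP p (Pp Hp0)) as (cp & _ & Hcp).
  assert (A' := A p cp ltac:(unfold p; lra) Hcp).
  assert (B' := B p cp ltac:(unfold p; lra) Hcp).
  apply Rabs_def2 in A', B'. apply Rabs_le. lra. }
assert (K3 : forall s, Rabs (s - sb) < eps ->
  0 < kappa23 g i c s /\ kappa23 g i c s ^ 3 = kap s ^ 2).
{ intros s Hs. destruct (H s ltac:(lra)) as (Kp & _). fold (kap s) in Kp.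
  unfold kappa23. fold kap. split; [apply exp_pos |].
  rewrite <- Rpower_pow by apply exp_pos. rewrite Rpower_mult.
  rewrite <- Rpower_pow by exact Kp. f_equal. simpl. field. }
assert (Hsb : Rabs (sb - sb) < eps) by (rewrite Rminus_diag, Rabs_R0; exact Heps).
set (a := Derive t sb / kappa23 g i c sb).
assert (Ha : a <> 0).
{ unfold a. destruct (K3 sb Hsb) as [A _]. destruct (Dt sb Hsb) as (_ & _ & B).
  apply Rmult_integral_contrapositive_currified; [exact B | apply Rinv_neq_0_compat; lra]. }
assert (Der : forall s, Rabs (s - sb) < eps -> Derive t s = a * kappa23 g i c s).
{ intros s Hs. destruct (K3 s Hs) as [A A3]. destruct (K3 sb Hsb) as [B B3].
  destruct (Dt sb Hsb) as (_ & _ & Tb).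
  assert (I := Inv s sb Hs Hsb). rewrite <- A3, <- B3 in I.
  set (w := Derive t s / kappa23 g i c s).
  assert (W : w ^ 3 = a ^ 3).
  { unfold w, a. transitivity (Derive t s ^ 3 / kappa23 g i c s ^ 3); [field; lra |].
    rewrite I. field; lra. }
  (* Cubing is injective: w^2 + w a + a^2 is positive because a is nonzero. *)
  assert (Wa : w = a).
  { assert (Z : (w - a) * (w * w + w * a + a * a) = 0)
      by (transitivity (w ^ 3 - a ^ 3); [ring | rewrite W; ring]).
    apply Rmult_integral in Z. destruct Z as [Z | Z]; [lra |].
    assert (0 < a * a) by nra. nra. }
  rewrite <- Wa. unfold w. field; lra. }
exists a, eps. split; [exact Ha |]. split; [exact Heps |]. split.
- intros s0 Hs0. exists (t s0). intros s Hs.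
  assert (I : forall x, Rmin s0 s <= x <= Rmax s0 s -> Rabs (x - sb) < eps).
  { intros x Hx. apply Rabs_def2 in Hs0, Hs. apply Rabs_def1;
    unfold Rmin, Rmax in Hx; destruct (Rle_dec s0 s); lra. }
  assert (D : is_RInt (Derive t) s0 s (minus (t s) (t s0))).
  { apply (is_RInt_derive (V := R_CompleteNormedModule) t (Derive t)).
    - intros x Hx. apply Dt, I, Hx.
    - intros x Hx. apply Dt, I, Hx. }
  (* Integrability of [kappa23] is inherited from the continuous t', of which it is the multiple by
     1 / a. *)
  assert (D' : is_RInt (kappa23 g i c) s0 s (scal (/ a) (minus (t s) (t s0)))).
  { refine (is_RInt_ext _ _ _ _ _ _ (is_RInt_scal (V := R_NormedModule) _ _ _ (/ a) _ D)).
    intros x Hx. unfold scal; simpl; unfold mult; simpl.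
    rewrite Der by (apply I; lra). field. exact Ha. }
  unfold Lazutkin. rewrite (is_RInt_unique _ _ _ _ D').
  unfold scal, minus, plus, opp; simpl. unfold mult; simpl. field. exact Ha.
- intros s Hs. rewrite <- (Der s Hs). now apply Dt.
Qed.
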